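(* Let $F$ be a non-discrete locally compact non-Archimedean field with $\mathrm{char}(F)\neq 2$. Let $\tau:\mathrm{Mat}(\mathbb{N},F)\to\mathrm{Skew}(\mathbb{N},F)$ be the map $\tau(X)=X-X^t$. Then the map $$\tau_*:\mathcal{P}_{\mathrm{inv}}(\mathrm{Mat}(\mathbb{N},F))\to\mathcal{P}_{\mathrm{inv}}(\mathrm{Skew}(\mathbb{N},F)),$$ obtained by restricting the pushforward of measures under $\tau$ to $\mathcal{P}_{\mathrm{inv}}(\mathrm{Mat}(\mathbb{N},F))$, is a homeomorphic affine isomorphism between topological convex sets (i.e. it is an affine bijection which is a homeomorphism).
   Context: Let $|\cdot|$ be the absolute value on $F$ and $\mathcal{O}_F=\{x\in F:|x|\le1\}$ the ring of integers. $\mathrm{GL}(\infty,\mathcal{O}_F)=\varinjlim\mathrm{GL}(n,\mathcal{O}_F)$ is the group of infinite invertible matrices $g=[g_{ij}]_{i,j\in\mathbb{N}}$ with entries in $\mathcal{O}_F$ such that $g_{ij}=\delta_{ij}$ whenever $i+j$ is large enough. $\mathrm{Mat}(\mathbb{N},F)$ is the space of all infinite matrices $[X(i,j)]_{i,j\in\mathbb{N}}$ with entries in $F$, and $\mathrm{Skew}(\mathbb{N},F)$ is the subspace of those with $X(i,j)=-X(j,i)$ for all $i,j$; both have the topology of entrywise convergence. The group $\mathrm{GL}(\infty,\mathcal{O}_F)\times\mathrm{GL}(\infty,\mathcal{O}_F)$ acts on $\mathrm{Mat}(\mathbb{N},F)$ by $((g_1,g_2),X)\mapsto g_1Xg_2^{-1}$,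 and $\mathrm{GL}(\infty,\mathcal{O}_F)$ acts on $\mathrm{Skew}(\mathbb{N},F)$ by $(g,A)\mapsto gAg^t$. $\mathcal{P}_{\mathrm{inv}}(\mathrm{Mat}(\mathbb{N},F))$ and $\mathcal{P}_{\mathrm{inv}}(\mathrm{Skew}(\mathbb{N},F))$ denote the sets of Borel probability measures invariant under these respective actions, with the topology of weak convergence of probability measures. *)

(* Defs.v *)
From HB Require Import structures.
From mathcomp Require Import all_boot all_order all_algebra generic_quotient.
From mathcomp Require Import all_classical all_reals all_analysis.

Set Implicit Arguments.
Unset Strict Implicit.
Unset Printing Implicit Defensive.

Import Order.TTheory GRing.Theory Num.Theory.
Import numFieldNormedType.Exports.

Local Open Scope classical_set_scope.
Local Open Scope ring_scope.
Local Open Scope quotient_scope.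
Local Open Scope convex_scope.

(* A field with a non-Archimedean absolute value, carrying the uniform
   structure induced by it.  The normed structures of the library are not usable here: their
   axiom [normrMn], |x *+ n| = |x| *+ n, fails for a non-Archimedean absolute
   value. *)
HB.mixin Record isNonArchField (R : realType) F
    & GRing.Field F & Uniform F := {
  absv : F -> R ;
  absv_ge0 : forall x, 0 <= absv x ;
  absv_eq0 : forall x, (absv x == 0) = (x == 0) ;
  absvM : forall x y, absv (x * y) = absv x * absv y ;
  absvD : forall x y, absv (x + y) <= Num.max (absv x) (absv y) ;
  entourage_absv :
    entourage = entourage_ (fun (x : F) (e : R) => [set y : F | absv (x - y : F) < e])
}.

#[short(type="nonArchFieldType")]
HB.structure Definition NonArchField (R : realType) :=
  { F of GRing.Field F & Uniform F & isNonArchField R F }.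

Section NonArchTheory.
Context {R : realType} {F : nonArchFieldType R}.

Lemma absv0 : absv (0 : F) = 0.
Proof. by apply/eqP; rewrite absv_eq0. Qed.

Lemma na_cvgP (T : Type) (G : set_system T) (FG : Filter G) (f : T -> F) (a : F) :
  f @ G --> a <-> forall e, 0 < e -> \forall x \near G, absv (a - f x) < e.
Proof.
split=> [fa e e0|fa].
  apply: (fa [set y | absv (a - y) < e]); rewrite -nbhs_entourageE.
  exists [set xy | absv (xy.1 - xy.2) < e]; last by move=> y; rewrite /xsection/= inE.
  by rewrite entourage_absv; exists e.
apply/cvg_entourageP => E; rewrite entourage_absv => -[e /= e0 eE].
by apply: filterS (fa e e0) => x ax; exact: (eE (a, f x)).
Qed.

Lemma na_continuousD (T : topologicalType) (f g : T -> F) :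
  continuous f -> continuous g -> continuous (fun x => f x + g x).
Proof.
move=> cf cg x; apply/na_cvgP => e e0.
near=> y.
rewrite opprD addrACA (le_lt_trans (absvD _ _))// gt_max; apply/andP; split.
- by near: y; move/na_cvgP: (cf x); apply.
- by near: y; move/na_cvgP: (cg x); apply.
Unshelve. all: by end_near. Qed.

Lemma na_continuousZ (T : topologicalType) (c : F) (f : T -> F) :
  continuous f -> continuous (fun x => c * f x).
Proof.
move=> cf x; apply/na_cvgP => e e0.
have [->|c0] := eqVneq c 0.
  by apply: nearW => y; rewrite !mul0r subrr absv0.
have c_gt0 : 0 < absv c by rewrite lt_neqAle eq_sym absv_eq0 c0 absv_ge0.
have /na_cvgP/(_ _ (divr_gt0 e0 c_gt0)) := cf x; apply: filterS => y.
by rewrite -mulrBr absvM ltr_pdivlMr// mulrC.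
Qed.

Lemma na_continuousB (T : topologicalType) (f g : T -> F) :
  continuous f -> continuous g -> continuous (fun x => f x - g x).
Proof.
move=> cf cg; apply: na_continuousD => //.
rewrite (_ : (fun x => - g x) = (fun x => -1 * g x)).
  exact: na_continuousZ.
by apply/funext => x; rewrite mulN1r.
Qed.

Lemma na_continuous_sum (T : topologicalType) n (f : 'I_n -> T -> F) :
  (forall i, continuous (f i)) -> continuous (fun x => \sum_(i < n) f i x).
Proof.
elim: n f => [|n IH] f cf.
  rewrite (_ : (fun _ => _) = fun=> 0); first exact: cst_continuous.
  by apply/funext => x; rewrite big_ord0.
rewrite (_ : (fun _ => _) = fun x => f ord0 x + \sum_(i < n) f (lift ord0 i) x).
  by apply: na_continuousD => //; exact: IH.
by apply/funext => x; rewrite big_ord_recl.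
Qed.

End NonArchTheory.

Definition infmx {R : realType} (F : nonArchFieldType R) : Type :=
  {ptws (nat * nat)%type -> F}.

HB.instance Definition _ (R : realType) (F : nonArchFieldType R) :=
  Topological.on (infmx F).
HB.instance Definition _ (R : realType) (F : nonArchFieldType R) :=
  isPointed.Build (infmx F) (fun=> 0).

Section InfiniteMatrices.
Context {R : realType} {F : nonArchFieldType R}.
Implicit Types X Y g : infmx F.

Definition infmx1 : infmx F := fun ij => (ij.1 == ij.2)%:R.

(* Meaningful when the sums are finite, which is always the case below: the
   left factor has finitely supported rows or the right factor has finitely
   supported columns. *)
Definition infmx_mul X Y : infmx F :=
  fun ij => \sum_(k \in [set: nat]) X (ij.1, k) * Y (k, ij.2).

Definition infmx_tr X : infmx F := fun ij => X (ij.2, ij.1).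

Definition infmx_sub X Y : infmx F := fun ij => X ij - Y ij.

Definition eventually_id X := exists N : nat,
  forall i j : nat, (N <= i + j)%N -> X (i, j) = (i == j)%:R.

Definition ring_of_integers : set F := [set x | absv x <= 1].

Definition Skew : set (infmx F) :=
  [set X | forall i j : nat, X (i, j) = - X (j, i)].

End InfiniteMatrices.
Arguments Skew {R} F.

(* The inverse is determined by the matrix; it is kept as a field so that it can
   be used in the action. *)
Record GLinfty {R : realType} (F : nonArchFieldType R) := {
  gl_mx : infmx F ;
  gl_inv : infmx F ;
  gl_mx_id : eventually_id gl_mx ;
  gl_inv_id : eventually_id gl_inv ;
  gl_mx_int : forall ij, ring_of_integers (gl_mx ij) ;
  gl_inv_int : forall ij, ring_of_integers (gl_inv ij) ;
  gl_mulV : infmx_mul gl_mx gl_inv = infmx1 ;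
  gl_mulVr : infmx_mul gl_inv gl_mx = infmx1
}.

Definition skew_infmx {R : realType} (F : nonArchFieldType R) : Type :=
  set_type (Skew F).

Section InfiniteMatricesTheory.
Context {R : realType} {F : nonArchFieldType R}.
Implicit Types X Y g h : infmx F.

Lemma Skew0 : Skew F (fun=> 0).
Proof. by move=> i j; rewrite oppr0. Qed.

HB.instance Definition _ := Topological.on (skew_infmx F).
HB.instance Definition _ := isPointed.Build (skew_infmx F)
  (exist _ (fun=> 0) (mem_set Skew0)).

Lemma continuous_to_infmx (T : topologicalType) (f : T -> infmx F) :
  (forall ij, continuous (fun x => f x ij)) -> continuous f.
Proof.
move=> cf x; apply/cvg_sup => ij.
by apply/continuous_comp_initial : x; exact: cf.
Qed.

Lemma coord_continuous ij : continuous (fun X : infmx F => X ij).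
Proof. exact: (@proj_continuous _ (fun _ : nat * nat => F) ij). Qed.

Lemma fsum_ord (f : nat -> F) n : (forall k, (n <= k)%N -> f k = 0) ->
  \sum_(k \in [set: nat]) f k = \sum_(k < n) f k.
Proof.
move=> f0; rewrite (fsbig_ord _ n f); apply/esym/fsbig_widen => //.
by move=> k /= [_ /negP]; rewrite -leqNgt => /f0.
Qed.

Lemma eventually_id_tr g : eventually_id g -> eventually_id (infmx_tr g).
Proof.
by case=> N gN; exists N => i j Nij; rewrite /infmx_tr/= gN 1?addnC// eq_sym.
Qed.

Lemma eventually_id_row g i : eventually_id g ->
  exists n, forall k, (n <= k)%N -> g (i, k) = 0.
Proof.
case=> N gN; exists (maxn N i.+1) => k; rewrite geq_max => /andP[Nk ik].
by rewrite gN ?(leq_trans Nk) ?leq_addl//; case: eqP ik => // ->; rewrite ltnn.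
Qed.

Lemma eventually_id_col g j : eventually_id g ->
  exists n, forall k, (n <= k)%N -> g (k, j) = 0.
Proof. by move=> /eventually_id_tr /eventually_id_row -/(_ j). Qed.

Lemma infmx_mul2E g h X i j n m :
  (forall k, (n <= k)%N -> g (i, k) = 0) ->
  (forall k, (m <= k)%N -> h (k, j) = 0) ->
  infmx_mul (infmx_mul g X) h (i, j) =
  \sum_(k < m) \sum_(l < n) h (k : nat, j) * (g (i, l : nat) * X (l : nat, k : nat)).
Proof.
move=> gn hm; rewrite /infmx_mul/= (@fsum_ord _ m); last first.
  by move=> k mk; rewrite hm// mulr0.
apply: eq_bigr => k _; rewrite mulrC -mulr_sumr; congr (_ * _).
by rewrite (@fsum_ord _ n)// => l nl; rewrite gn// mul0r.
Qed.

Lemma infmx_mul2_continuous g h : eventually_id g -> eventually_id h ->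
  continuous (fun X => infmx_mul (infmx_mul g X) h).
Proof.
move=> eg eh; apply: continuous_to_infmx => -[i j].
have [n gn] := eventually_id_row i eg.
have [m hm] := eventually_id_col j eh.
under eq_fun do rewrite (infmx_mul2E _ gn hm).
apply: na_continuous_sum => k; apply: na_continuous_sum => l.
by do 2 apply: na_continuousZ; exact: coord_continuous.
Qed.

Lemma infmx_tr_conj g X : eventually_id g ->
  infmx_tr (infmx_mul (infmx_mul g X) (infmx_tr g)) =
  infmx_mul (infmx_mul g (infmx_tr X)) (infmx_tr g).
Proof.
move=> eg; apply/funext => -[i j]; rewrite {1}/infmx_tr /=.
have [n gn] := eventually_id_row i eg.
have [m gm] := eventually_id_row j eg.
rewrite (@infmx_mul2E _ _ _ _ _ m n)// (@infmx_mul2E _ _ _ _ _ n m)//.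
rewrite exchange_big/=; apply: eq_bigr => k _; apply: eq_bigr => l _.
by rewrite /infmx_tr/= mulrCA.
Qed.

Lemma infmx_sub_conj g h X Y : eventually_id g -> eventually_id h ->
  infmx_mul (infmx_mul g (infmx_sub X Y)) h =
  infmx_sub (infmx_mul (infmx_mul g X) h) (infmx_mul (infmx_mul g Y) h).
Proof.
move=> eg eh; apply/funext => -[i j]; rewrite {2}/infmx_sub.
have [n gn] := eventually_id_row i eg.
have [m hm] := eventually_id_col j eh.
rewrite !(infmx_mul2E _ gn hm) -sumrB; apply: eq_bigr => k _.
by rewrite -sumrB; apply: eq_bigr => l _; rewrite -!mulrBr.
Qed.

Lemma infmx_tr_mul X Y : infmx_tr (infmx_mul X Y) =
  infmx_mul (infmx_tr Y) (infmx_tr X).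
Proof.
apply/funext => -[i j]; rewrite /infmx_tr /infmx_mul /=.
by apply: eq_fsbigr => k _; rewrite mulrC.
Qed.

Lemma infmx_tr1 : infmx_tr (infmx1 : infmx F) = infmx1.
Proof. by apply/funext => -[i j]; rewrite /infmx_tr /infmx1/= eq_sym. Qed.

Lemma Skew_conj g X : eventually_id g -> Skew F X ->
  Skew F (infmx_mul (infmx_mul g X) (infmx_tr g)).
Proof.
move=> eg sX i j.
rewrite -[X in - X]/(infmx_tr (infmx_mul (infmx_mul g X) (infmx_tr g)) (i, j)).
rewrite infmx_tr_conj//.
have [n gn] := eventually_id_row i eg.
have [m gm] := eventually_id_row j eg.
rewrite !(@infmx_mul2E _ _ _ _ _ n m)// -sumrN; apply: eq_bigr => k _.
by rewrite -sumrN; apply: eq_bigr => l _; rewrite /infmx_tr/= -!mulrN -sX.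
Qed.

Lemma Skew_tau X : Skew F (infmx_sub X (infmx_tr X)).
Proof. by move=> i j; rewrite /infmx_sub /infmx_tr/= opprB. Qed.

Definition tau X : skew_infmx F :=
  exist _ (infmx_sub X (infmx_tr X)) (mem_set (Skew_tau X)).

Lemma tau_continuous : continuous tau.
Proof.
apply/continuous_comp_initial; apply: continuous_to_infmx => -[i j].
by apply: na_continuousB; exact: coord_continuous.
Qed.

End InfiniteMatricesTheory.

(* [G] is only a family of parameters here: the group law plays no role in the
   definition of the invariant measures. *)
Record cont_action (G : Type) (T : topologicalType) := ContAction {
  act_fun :> G -> T -> T ;
  act_continuous : forall g, continuous (act_fun g)
}.
Arguments act_continuous {G T} a g : rename.

Section Actions.
Context {R : realType} (F : nonArchFieldType R).

Lemma mat_act_continuous (g : GLinfty F * GLinfty F) :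
  continuous (fun X : infmx F =>
    infmx_mul (infmx_mul (gl_mx g.1) X) (gl_inv g.2)).
Proof. by apply: infmx_mul2_continuous; [exact: gl_mx_id|exact: gl_inv_id]. Qed.

Definition mat_act : cont_action (GLinfty F * GLinfty F)%type (infmx F) :=
  ContAction mat_act_continuous.

Definition skew_act_fun (g : GLinfty F) (A : skew_infmx F) : skew_infmx F :=
  exist _ (infmx_mul (infmx_mul (gl_mx g) (val A)) (infmx_tr (gl_mx g)))
    (mem_set (Skew_conj (gl_mx_id g) (set_mem (valP A)))).

Lemma skew_act_continuous (g : GLinfty F) : continuous (skew_act_fun g).
Proof.
apply/continuous_comp_initial.
have c := infmx_mul2_continuous (gl_mx_id g) (eventually_id_tr (gl_mx_id g)).
have v : continuous (set_val : skew_infmx F -> infmx F) by exact: initial_continuous.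
by move=> A; exact: (continuous_comp (v A) (c (set_val A))).
Qed.

Definition skew_act : cont_action (GLinfty F) (skew_infmx F) :=
  ContAction skew_act_continuous.

End Actions.

Definition borel (T : ptopologicalType) := g_sigma_algebraType (@open T).

Lemma continuous_borel (T U : ptopologicalType) (f : T -> U) : continuous f ->
  measurable_fun [set: borel T] (f : borel T -> borel U).
Proof.
move=> /continuousP cf; apply: (@measurability _ _ (borel T) (borel U) _ _ (@open U)) => //.
by move=> _ [A oA <-]; rewrite setTI; apply: sub_gen_smallest; exact: cf.
Qed.

(* A [probability] of the library is a function on all subsets, whose values on
   non-measurable sets are arbitrary; it is therefore considered up to equality
   on Borel sets. *)
Section BorelProbability.
Context (R : realType) (T : ptopologicalType).
Implicit Types (m : probability (borel T) R) (A : set (borel T)).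

Definition prob_eq m1 m2 : bool :=
  `[< forall A, measurable A -> m1 A = m2 A >].

Lemma prob_eq_equiv : equiv_class_of prob_eq.
Proof.
split=> [m|m1 m2|m2 m1 m3].
- exact/asboolP.
- by apply/asboolP/asboolP => m12 A mA; rewrite m12.
- by move=> /asboolP m12 /asboolP m23; apply/asboolP => A mA; rewrite m12// m23.
Qed.

Canonical prob_eq_equivRel := EquivRelPack prob_eq_equiv.

Definition borel_prob : Type := {eq_quot prob_eq}.

HB.instance Definition _ := Choice.on borel_prob.
HB.instance Definition _ := Quotient.on borel_prob.

Definition borel_class m : borel_prob := \pi_{eq_quot prob_eq} m.

Definition repr_prob (mu : borel_prob) : probability (borel T) R :=
  repr (mu : {eq_quot prob_eq}).

Lemma repr_probK : cancel repr_prob borel_class.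
Proof. by move=> mu; exact: reprK. Qed.

Lemma borel_classK m : forall A, measurable A -> repr_prob (borel_class m) A = m A.
Proof.
by apply/asboolP; apply/(@eqmodP _ prob_eq_equivRel); exact: repr_probK.
Qed.

Lemma borel_classP m1 m2 : borel_class m1 = borel_class m2 <->
  (forall A, measurable A -> m1 A = m2 A).
Proof.
split=> [m12|m12].
  by apply/asboolP; apply/(@eqmodP _ prob_eq_equivRel); exact: m12.
by apply/(@eqmodP _ prob_eq_equivRel); exact/asboolP.
Qed.

Lemma borel_prob_ext (mu nu : borel_prob) :
  (forall A, measurable A -> repr_prob mu A = repr_prob nu A) -> mu = nu.
Proof. by move=> /borel_classP; rewrite !repr_probK. Qed.

(* Weak convergence: the coarsest topology making integration of every bounded
   continuous real function continuous. *)
Definition Cb : set (T -> R) := [set f | continuous f /\ bounded_fun f].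

Definition integration (mu : borel_prob) : {ptws Cb -> R} :=
  fun f => \int[repr_prob mu]_x (set_val f x).

HB.instance Definition _ :=
  Topological.copy borel_prob (initial_topology integration).

Section Mixture.
Variables (t : {i01 R}) (m1 m2 : probability (borel T) R).

Definition mixture (A : set (borel T)) : \bar R :=
  (t%:num%:E * m1 A + (1 - t%:num)%:E * m2 A)%E.

Let t_ge0 : 0 <= t%:num. Proof. by []. Qed.

Let onem_t_ge0 : 0 <= 1 - t%:num.
Proof. by rewrite subr_ge0. Qed.

Let mixture0 : mixture set0 = 0%E.
Proof. by rewrite /mixture !measure0 !mule0 adde0. Qed.

Let mixture_ge0 A : (0 <= mixture A)%E.
Proof. by rewrite /mixture adde_ge0// mule_ge0// lee_fin. Qed.

Let mixture_sigma_additive : semi_sigma_additive mixture.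
Proof.
pose m := measure_add (mscale (NngNum t_ge0) m1) (mscale (NngNum onem_t_ge0) m2).
rewrite (_ : mixture = m); first exact: measure_semi_sigma_additive.
by apply/funext => A; rewrite /m measure_addE.
Qed.

HB.instance Definition _ := isMeasure.Build _ _ _ mixture
  mixture0 mixture_ge0 mixture_sigma_additive.

Let mixture_setT : mixture setT = 1%E.
Proof.
by rewrite /mixture !probability_setT !mule1 -EFinD addrC subrK.
Qed.

HB.instance Definition _ := Measure_isProbability.Build _ _ _ mixture
  mixture_setT.

End Mixture.

Definition borel_conv (t : {i01 R}) (mu nu : borel_prob) : borel_prob :=
  borel_class (mixture t (repr_prob mu) (repr_prob nu)).

Lemma borel_convE t mu nu A : measurable A ->
  repr_prob (borel_conv t mu nu) A =
  (t%:num%:E * repr_prob mu A + (1 - t%:num)%:E * repr_prob nu A)%E.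
Proof. by move=> mA; rewrite (borel_classK _ mA). Qed.

Let fineE m A : measurable A -> m A = (fine (m A))%:E.
Proof. by move=> mA; rewrite fineK// fin_num_measure. Qed.

Let borel_conv1 mu nu : borel_conv 1%:i01 mu nu = mu.
Proof.
apply: borel_prob_ext => A mA; rewrite borel_convE//= subrr mul0e adde0.
by rewrite mul1e.
Qed.

Let borel_convmm t mu : borel_conv t mu mu = mu.
Proof.
apply: borel_prob_ext => A mA; rewrite borel_convE// fineE//.
by rewrite -!EFinM -EFinD -mulrDl addrC subrK mul1r.
Qed.

Let borel_convC t mu nu :
  borel_conv t mu nu = borel_conv (1 - t%:inum)%:i01 nu mu.
Proof.
by apply: borel_prob_ext => A mA; rewrite !borel_convE//= subKr addeC.
Qed.

Let borel_convA : convex_quasi_associative borel_conv.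
Proof.
move=> p q r s a b c prs spq; apply: borel_prob_ext => A mA.
have {}spq : 1 - s%:num = (1 - p%:num) * (1 - q%:num) by exact: spq.
rewrite !borel_convE// (fineE (repr_prob a))// (fineE (repr_prob b))//.
rewrite (fineE (repr_prob c))// -!(EFinM, EFinD); congr EFin.
rewrite !mulrDr addrA; congr (_ + _ + _).
- by rewrite mulrA [s%:num * _]mulrC -prs.
- by rewrite !mulrA; congr (_ * _); rewrite (ConvexQuasiAssoc.pq_sr prs).
- by rewrite mulrA spq.
Qed.

HB.instance Definition _ := isConvexSpace.Build R borel_prob
  borel_conv1 borel_convmm borel_convC borel_convA.

End BorelProbability.

Section Pushforward.
Context {R : realType} {T U : ptopologicalType}.

Definition borel_fun (f : T -> U) of continuous f : borel T -> borel U := f.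

HB.instance Definition _ (f : T -> U) (cf : continuous f) :=
  isMeasurableFun.Build _ _ (borel T) (borel U) (borel_fun cf)
    (continuous_borel cf).

(* [distribution] is the pushforward of a probability measure. *)
Definition borel_push (f : T -> U) (cf : continuous f) (mu : borel_prob R T) :
  borel_prob R U := borel_class (distribution (repr_prob mu) (borel_fun cf)).

Lemma borel_pushE (f : T -> U) (cf : continuous f) mu (A : set (borel U)) :
  measurable A ->
  repr_prob (borel_push cf mu) A = repr_prob mu (f @^-1` A).
Proof. by move=> mA; rewrite (borel_classK _ mA). Qed.

End Pushforward.

Definition invariant (R : realType) (G : Type) (T : ptopologicalType)
    (a : cont_action G T) : set (borel_prob R T) :=
  [set mu | forall g, borel_push (act_continuous a g) mu = mu].

Definition Pinv (R : realType) (G : Type) (T : ptopologicalType)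
  (a : cont_action G T) : Type := set_type (@invariant R G T a).

Section Pinv.
Context {R : realType} {G : Type} {T : ptopologicalType}.
Variable a : cont_action G T.

HB.instance Definition _ := Topological.on (Pinv R a).

Lemma invariantP (mu : borel_prob R T) : invariant a mu <->
  forall g (A : set (borel T)), measurable A ->
    repr_prob mu (a g @^-1` A) = repr_prob mu A.
Proof.
split=> [imu g A mA|imu g]; first by rewrite -(borel_pushE (act_continuous a g))// imu.
by apply: borel_prob_ext => A mA; rewrite borel_pushE// imu.
Qed.

Lemma measurable_preimage_act g (A : set (borel T)) :
  measurable A -> measurable (a g @^-1` A : set (borel T)).
Proof.
by move=> mA; rewrite -[X in measurable X]setTI; apply: continuous_borel => //;
  exact: act_continuous.
Qed.

Lemma invariant_conv t (mu nu : borel_prob R T) :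
  invariant a mu -> invariant a nu -> invariant a (mu <| t |> nu).
Proof.
move=> /invariantP imu /invariantP inu; apply/invariantP => g A mA.
by rewrite !borel_convE// ?imu ?inu//; exact: measurable_preimage_act.
Qed.

Definition Pinv_conv (t : {i01 R}) (mu nu : Pinv R a) : Pinv R a :=
  exist _ (set_val mu <| t |> set_val nu)
    (mem_set (invariant_conv t (set_valP mu) (set_valP nu))).

Let Pinv_conv1 mu nu : Pinv_conv 1%:i01 mu nu = mu.
Proof. by apply: val_inj => /=; rewrite conv1. Qed.

Let Pinv_convmm t mu : Pinv_conv t mu mu = mu.
Proof. by apply: val_inj => /=; rewrite convmm. Qed.

Let Pinv_convC t mu nu : Pinv_conv t mu nu = Pinv_conv (1 - t%:inum)%:i01 nu mu.
Proof. by apply: val_inj => /=; rewrite convC. Qed.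

Let Pinv_convA : convex_quasi_associative Pinv_conv.
Proof.
by move=> p q r s b c d prs spq; apply: val_inj => /=; exact: convA prs spq.
Qed.

HB.instance Definition _ := isConvexSpace.Build R (Pinv R a)
  Pinv_conv1 Pinv_convmm Pinv_convC Pinv_convA.

End Pinv.

Section TauStar.
Context {R : realType} (F : nonArchFieldType R).

Definition gl_contragredient (g : GLinfty F) : GLinfty F.
Proof.
refine (@Build_GLinfty R F (infmx_tr (gl_inv g)) (infmx_tr (gl_mx g))
  (eventually_id_tr (gl_inv_id g)) (eventually_id_tr (gl_mx_id g))
  (fun ij => gl_inv_int g (ij.2, ij.1)) (fun ij => gl_mx_int g (ij.2, ij.1))
  _ _).
- by rewrite -infmx_tr_mul gl_mulV infmx_tr1.
- by rewrite -infmx_tr_mul gl_mulVr infmx_tr1.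
Defined.

Lemma tau_equivariant (g : GLinfty F) (X : infmx F) :
  tau (mat_act F (g, gl_contragredient g) X) = skew_act F g (tau X).
Proof.
apply: val_inj => /=.
have eg := gl_mx_id g.
by rewrite infmx_sub_conj//; [rewrite infmx_tr_conj|exact: eventually_id_tr].
Qed.

Lemma tau_push_invariant (mu : borel_prob R (infmx F)) :
  invariant (mat_act F) mu ->
  invariant (skew_act F) (borel_push tau_continuous mu).
Proof.
move=> /invariantP imu; apply/invariantP => g A mA.
rewrite !borel_pushE//; last exact: measurable_preimage_act.
have mtA : measurable (tau @^-1` A : set (borel (infmx F))).
  rewrite -[X in measurable X]setTI; apply: continuous_borel => //.
  exact: tau_continuous.
rewrite -(imu (g, gl_contragredient g) _ mtA); congr (repr_prob mu _).
by apply/seteqP; split => X /=; rewrite tau_equivariant.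
Qed.

Definition tau_star (mu : Pinv R (mat_act F)) : Pinv R (skew_act F) :=
  exist _ (borel_push tau_continuous (set_val mu))
    (mem_set (tau_push_invariant (set_valP mu))).

End TauStar.

Definition is_affine {R : realType} {A B : convType R} (f : A -> B) :=
  forall (t : {i01 R}) (a b : A), f (a <| t |> b) = f a <| t |> f b.

Definition is_homeomorphism {S T : topologicalType} (f : S -> T) :=
  exists g : T -> S, [/\ cancel f g, cancel g f, continuous f & continuous g].

(* Main.v *)
(** Write [tau X = X - X^T].  An invariant measure is determined by the content it
    induces on cylinder sets, and an invariant content [m] on cylinder sets extends
    to a measure as soon as its image under [tau] is a measure: a row operation
    bounds the tails of the entries of [X] by those of [tau X], and balls are
    compact.

    Injectivity.  Let [c] be the real part of an additive character of conductor
    the ring of integers, and [phi y] the expectation of [c (\sum_i y_i X_ii)].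
    By column operations, [phi y] is, up to [O(1/L)], the probability that
    [y_i X_il] is integral for all [i] and for [l] in [L] other columns.  Hence
    [phi] at [k] copies of [y] is the [k]-th moment of a variable with values in
    [0, 1] (a frequency of such events), and only its even moments are visible on
    [tau X].  They determine the first moment [phi y], the square root being a
    uniform limit of polynomials on [0, 1].  By the Smith normal form, [phi] gives
    the expectations of all the [c (tr (Y X))], and a finite Fourier inversion
    gives the measure of the balls.

    Surjectivity.  A skew-symmetric corner [A] can be written
    [H A H^T = S - S^T] with [H] in GL(n, O) and [S] supported on the product of a
    set of indices and its complement.  For independent uniform integral [k x n]
    matrices [u] and [v] put [X = u S v^T]; its law is invariant.  Because of the
    support of [S], [X = w S w^T], where the columns of [w] come from [u] or [v],
    so that [tau X = W A W^T] with [W = w H] uniform.  For large [n], [W] most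
    often consists of the first [k] rows of an element of GL(n, O), hence [tau X]
    has nearly the law of the corner of [A].  An ultralimit of these laws is the
    required content.

    Continuity of the inverse.  Along an ultrafilter converging to [nu], the
    contents of the preimages converge to an invariant content with image [nu],
    which by injectivity is that of the preimage of [nu]. *)

From HB Require Import structures.
Require Import Defs.
From mathcomp Require Import all_boot all_order fingroup perm all_algebra.
From mathcomp Require Import all_classical all_reals all_analysis measurable_realfun.
From mathcomp Require Import ring lra zify.

Set Implicit Arguments.
Unset Strict Implicit.
Unset Printing Implicit Defensive.

Import Order.TTheory GRing.Theory Num.Theory.
Import numFieldNormedType.Exports.

Local Open Scope classical_set_scope.
Local Open Scope ring_scope.

(** * Absolute values and residue systems *)

Section AbsoluteValue.
Context {R : realType} {F : nonArchFieldType R}.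
Implicit Types x y : F.

Lemma absv1 : absv (1 : F) = 1.
Proof.
have /eqP := absvM (1 : F) 1; rewrite mulr1 -subr_eq0 -{1}[absv 1]mulr1 -mulrBr.
rewrite mulf_eq0 absv_eq0 oner_eq0/= subr_eq0 => /eqP <- //.
Qed.

Lemma absvN x : absv (- x) = absv x.
Proof.
have m1 : absv (-1 : F) = 1.
  have : absv (-1 : F) ^+ 2 = 1 by rewrite expr2 -absvM mulrNN mulr1 absv1.
  by move/eqP; rewrite -[X in _ == X](expr1n _ 2) eqrXn2// ?absv_ge0// => /eqP.
by rewrite -mulN1r absvM m1 mul1r.
Qed.

Lemma absvB x y : absv (x - y) = absv (y - x).
Proof. by rewrite -absvN opprB. Qed.

Lemma absvV x : absv (x^-1) = (absv x)^-1.
Proof.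
have [->|x0] := eqVneq x 0; first by rewrite invr0 absv0 invr0.
have ax0 : absv x != 0 by rewrite absv_eq0.
by apply: (mulfI ax0); rewrite -absvM divff// absv1 divff.
Qed.

Lemma absv_gt0 x : (0 < absv x) = (x != 0).
Proof. by rewrite lt_neqAle eq_sym absv_eq0 absv_ge0 andbT. Qed.

Lemma absvD_le x y e : absv x <= e -> absv y <= e -> absv (x + y) <= e.
Proof. by move=> xe ye; rewrite (le_trans (absvD x y))// ge_max xe. Qed.

Lemma absvB_le x y e : absv x <= e -> absv y <= e -> absv (x - y) <= e.
Proof. by move=> xe ye; apply: absvD_le => //; rewrite absvN. Qed.

Lemma absv_sum_le I (r : seq I) (P : pred I) (f : I -> F) e : 0 <= e ->
  (forall i, P i -> absv (f i) <= e) -> absv (\sum_(i <- r | P i) f i) <= e.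
Proof.
move=> e0 fe; elim/big_rec : _ => [|i x Pi xe]; first by rewrite absv0.
by apply: absvD_le => //; exact: fe.
Qed.

Lemma absv_prod_le1 I (r : seq I) (P : pred I) (f : I -> F) :
  (forall i, P i -> absv (f i) <= 1) -> absv (\prod_(i <- r | P i) f i) <= 1.
Proof.
move=> fe; elim/big_rec : _ => [|i x Pi xe]; first by rewrite absv1.
by rewrite absvM mulr_ile1// ?absv_ge0//; exact: fe.
Qed.

Lemma absv_near_le x y e : absv (x - y) <= e -> (absv x <= e) = (absv y <= e).
Proof.
move=> xy; apply/idP/idP => h.
  by rewrite -[y](subKr x) absvB_le.
by rewrite -[x](subrK y) absvD_le.
Qed.

Lemma absvM_le x y a b : absv x <= a -> absv y <= b -> absv (x * y) <= a * b.
Proof. by move=> xa yb; rewrite absvM ler_pM// absv_ge0. Qed.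

Lemma absvM_le1 x y a : absv x <= 1 -> absv y <= a -> absv (x * y) <= a.
Proof. by move=> x1 ya; rewrite -(mul1r a); exact: absvM_le. Qed.

Lemma na_nbhsP (x : F) (A : set F) :
  nbhs x A <-> exists2 e, 0 < e & forall y, absv (x - y) < e -> A y.
Proof.
split=> [|[e e0 eA]].
  rewrite -nbhs_entourageE => -[E]; rewrite entourage_absv => -[e /= e0 eE EA].
  by exists e => // y xy; apply: EA; rewrite /xsection/= inE; exact: (eE (x, y)).
have /na_cvgP/(_ _ e0) : id @ nbhs x --> x by [].
exact: filterS.
Qed.

Lemma ball_open (x : F) e : 0 < e -> open [set y | absv (x - y) <= e].
Proof.
move=> e0; rewrite openE => y /= xy; apply/na_nbhsP; exists e => // z yz /=.
by rewrite -[x](subrK y) -addrA absvD_le// ltW.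
Qed.

Lemma ball_closed e : closed [set y : F | absv y <= e].
Proof.
rewrite (_ : [set _ | _] = ~` [set y | e < absv y]); last first.
  by apply/seteqP; split=> y /=; [rewrite leNgt => /negP|move=> /negP; rewrite -leNgt].
apply: open_closedC; rewrite openE => y /= ey; apply/na_nbhsP.
have [y0|y0] := eqVneq (absv y) 0.
  by exists 1 => // z _; rewrite /= (lt_le_trans _ (absv_ge0 z))// -y0.
exists (absv y) => [|z yz /=]; first by rewrite lt_neqAle eq_sym y0 absv_ge0.
rewrite ltNge; apply/negP => ze.
have : absv y <= Num.max (absv (y - z)) (absv z) by rewrite -{1}[y](subrK z) absvD.
by rewrite leNgt gt_max yz (le_lt_trans ze).
Qed.

End AbsoluteValue.

Section LocalField.
Context {R : realType} {F : nonArchFieldType R}.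
Context (F_nondiscrete : ~ (forall A : set F, open A))
  (F_locally_compact : locally_compact [set: F]).

Lemma exists_absv_lt1 : exists2 x : F, x != 0 & absv x < 1.
Proof.
apply: contrapT => nx; apply: F_nondiscrete => A; rewrite openE => x Ax.
apply/na_nbhsP; exists 1 => // y xy; suff -> : y = x by [].
apply/eqP; rewrite eq_sym -subr_eq0; apply/negP => /negP xy0.
by apply: nx; exists (x - y).
Qed.

Lemma exists_absv_small e : 0 < e -> exists2 x : F, x != 0 & absv x < e.
Proof.
move=> e0; have [x x0 x1] := exists_absv_lt1.
have xn n : absv (x ^+ n) = absv x ^+ n.
  by elim: n => [|n IH]; rewrite ?expr0 ?absv1// !exprS absvM IH.
have : (absv x) ^+ n @[n --> \oo] --> 0 by apply: cvg_expr; rewrite ger0_norm// absv_ge0.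
move=> /cvgr0Pnorm_lt/(_ _ e0)[n _ /(_ n (leqnn _))].
rewrite /= ger0_norm ?exprn_ge0 ?absv_ge0// => h.
by exists (x ^+ n); rewrite ?expf_neq0// xn.
Qed.

Lemma ball_compact r : compact [set x : F | absv x <= r].
Proof.
have [U /=] := F_locally_compact (I : [set: F] 0).
rewrite /within/= => /na_nbhsP[e e0 eU] [cU _].
have r1 : 0 < `|r| + 1 by rewrite ltr_pwDr.
have [s s0 se] := exists_absv_small (divr_gt0 e0 r1).
have as0 : 0 < absv s by rewrite absv_gt0.
rewrite (_ : [set _ | _] = (fun x => s^-1 * x) @` [set x | absv x <= absv s * r]).
  apply: continuous_compact.
    by apply: continuous_subspaceT; apply: na_continuousZ => ?; exact: cvg_id.
  apply: (subclosed_compact (@ball_closed _ _ _) cU) => x /= xs.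
  apply: eU => //; rewrite sub0r absvN (le_lt_trans xs)//.
  move: se; rewrite ltr_pdivlMr// => se; rewrite (le_lt_trans _ se)//.
  by rewrite ler_pM2l// (le_trans (ler_norm r))// lerDl.
apply/seteqP; split=> [x /= xr|_ [x /= xs <-]].
  by exists (s * x); rewrite ?mulKf//= absvM ler_pM2l.
by rewrite absvM absvV mulrC ler_pdivrMr// mulrC.
Qed.

Lemma finite_net r e : 0 < e -> exists s : seq F,
  forall x, absv x <= r -> exists2 y, y \in s & absv (x - y) <= e.
Proof.
move=> e0; pose pF : ptopologicalType := HB.pack F (isPointed.Build F 0).
have := @ball_compact r; rewrite (@compact_cover pF).
move=> /(_ F setT (fun y => [set x | absv (y - x) <= e]))[|x _|D _ Dr].
- by move=> i _; exact: ball_open.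
- by exists x => //=; rewrite subrr absv0 ltW.
- exists (finmap.enum_fset D) => x /Dr[y Dy /= yx]; exists y => //.
  by rewrite absvB.
Qed.

Lemma exists_uniformizer : exists2 p : F, p != 0 /\ absv p < 1 &
  forall x : F, absv x < 1 -> absv x <= absv p.
Proof.
have [p p0 p1] := exists_absv_lt1.
have ap0 : 0 < absv p by rewrite absv_gt0.
have [s sP] := finite_net 1 ap0.
pose P := [pred x : F | (absv x < 1) && (absv p <= absv x)].
suff [q /andP[q1 pq] qmax] : exists2 q, P q &
    forall x : F, x \in s -> absv x < 1 -> absv x <= absv q.
  exists q => [|x x1]; first by rewrite -absv_gt0 (lt_le_trans ap0).
  have [y ys xy] := sP x (ltW x1).
  have y1 : absv y < 1.
    rewrite -[y](subKr x) (le_lt_trans (absvD _ _))// gt_max x1 absvN.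
    exact: le_lt_trans p1.
  rewrite -[x](subrK y) absvD_le//; first exact: le_trans xy pq.
  exact: qmax.
elim: s {sP} => [|y s [q Pq qmax]]; first by exists p; rewrite //= p1 lexx.
have [y1|y1] := ltP (absv y) 1; last first.
  exists q => // x; rewrite inE => /predU1P[->|]; last exact: qmax.
  by rewrite ltNge y1.
have [yq|qy] := leP (absv y) (absv q).
  by exists q => // x; rewrite inE => /predU1P[->|] //; exact: qmax.
exists y; first by rewrite /= y1 (le_trans _ (ltW qy))//; case/andP: Pq.
move=> x; rewrite inE => /predU1P[->|xs x1] //.
by rewrite (le_trans (qmax _ xs x1))// ltW.
Qed.

End LocalField.

(* [res_cls] is only meaningful on the ring of integers. *)
Record residue_system (R : realType) (F : nonArchFieldType R) (e : R) := {
  res_type :> finType ;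
  res_val : res_type -> F ;
  res_cls : F -> res_type ;
  res_val_int : forall k, absv (res_val k) <= 1 ;
  res_valP : forall x, absv x <= 1 -> absv (x - res_val (res_cls x)) <= e ;
  res_cls_eq : forall x y, absv x <= 1 -> absv y <= 1 -> absv (x - y) <= e ->
    res_cls x = res_cls y ;
  res_valK : forall k, res_cls (res_val k) = k
}.

Section ResidueSystem.
Context {R : realType} {F : nonArchFieldType R}
  (F_nondiscrete : ~ (forall A : set F, open A))
  (F_locally_compact : locally_compact [set: F]).

Lemma exists_residue_system e : 0 < e -> e <= 1 -> inhabited (residue_system F e).
Proof.
move=> e0 e1; have [s sP] := finite_net F_nondiscrete F_locally_compact 1 e0.
pose near (x y : F) := absv (x - y) <= e.
pose canon x := nth 0 s (find (near x) s).
have canonP x : absv x <= 1 -> near x (canon x).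
  by move=> /sP[y ys xy]; apply: nth_find; apply/hasP; exists y.
have canon_s x : absv x <= 1 -> canon x \in s.
  by move=> /sP[y ys xy]; apply/mem_nth; rewrite -has_find; apply/hasP; exists y.
have canon1 x : absv x <= 1 -> absv (canon x) <= 1.
  move=> x1; rewrite -(@absv_near_le _ _ x)//.
  exact: le_trans (canonP _ x1) e1.
have canon_eq x y : near x y -> canon x = canon y.
  move=> xy; rewrite /canon; congr nth; apply: eq_find => z; rewrite /near.
  by apply: absv_near_le; rewrite opprB addrA subrK.
pose rs := [seq canon x | x <- s & absv x <= 1].
have canon_rs x : absv x <= 1 -> canon x \in rs.
  move=> x1; apply/mapP; exists (canon x); last exact/canon_eq/canonP.
  by rewrite mem_filter canon1//= canon_s.
have rsP x : x \in rs -> absv x <= 1 /\ canon x = x.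
  move=> /mapP[y]; rewrite mem_filter => /andP[y1 _] ->.
  by split; [exact: canon1|exact/esym/canon_eq/canonP].
have c0 : canon 0 \in rs by rewrite canon_rs// absv0 ler01.
pose T : finType := seq_sub rs.
constructor; apply: (@Build_residue_system _ F e T val
  (fun x => insubd (SeqSub c0) (canon x))).
- by move=> k; have [] := rsP _ (valP k).
- by move=> x x1; rewrite insubdK ?canon_rs//; exact: canonP.
- by move=> x y _ _ xy; rewrite (canon_eq _ _ xy).
- move=> k; have [k1 kk] := rsP _ (valP k).
  by apply: val_inj; rewrite insubdK ?canon_rs//.
Qed.

End ResidueSystem.

(** * Cylinder sets and expectations *)

Section Cylinders.
Context {R : realType} {F : nonArchFieldType R}.
Implicit Types X Y Z : infmx F.

Definition mxnear (n : nat) (e : R) X Y :=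
  forall i j, (i < n)%N -> (j < n)%N -> absv (X (i, j) - Y (i, j)) <= e.

Lemma mxnear_refl n e X : 0 <= e -> mxnear n e X X.
Proof. by move=> e0 i j _ _; rewrite subrr absv0. Qed.

Lemma mxnear_sym n e X Y : mxnear n e X Y -> mxnear n e Y X.
Proof. by move=> XY i j ni nj; rewrite absvB XY. Qed.

Lemma mxnear_trans n e X Y Z : mxnear n e X Y -> mxnear n e Y Z -> mxnear n e X Z.
Proof.
move=> XY YZ i j ni nj; rewrite -[X (i, j)](subrK (Y (i, j))) -addrA.
by rewrite absvD_le// ?XY ?YZ.
Qed.

Lemma mxnear_le n m e d X Y : (n <= m)%N -> d <= e ->
  mxnear m d X Y -> mxnear n e X Y.
Proof.
move=> nm de XY i j ni nj; rewrite (le_trans _ de)// XY//.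
  exact: leq_trans nm.
exact: leq_trans nm.
Qed.

Definition inv_succ n : R := n.+1%:R^-1.

Lemma inv_succ_gt0 n : 0 < inv_succ n. Proof. by rewrite /inv_succ. Qed.

Lemma inv_succ_le n m : (n <= m)%N -> inv_succ m <= inv_succ n.
Proof. by move=> nm; rewrite /inv_succ lef_pV2 ?posrE// ler_nat. Qed.

Lemma inv_succ_small e : 0 < e -> exists n, inv_succ n <= e.
Proof.
move=> e0; have [n _ /(_ n (leqnn n))] := near_infty_natSinv_lt (PosNum e0).
by move=> /= /ltW; exists n.
Qed.

Lemma infmx_nbhsP X (A : set (infmx F)) :
  nbhs X A -> exists n, mxnear n (inv_succ n) X `<=` A.
Proof.
pose G : set_system (infmx F) := [set A | exists n, mxnear n (inv_succ n) X `<=` A].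
have FG : Filter G.
  split; first by exists 0%N.
  - move=> P Q [n nP] [m mQ]; exists (maxn n m) => Y XY; split.
      by apply: nP; apply: mxnear_le XY; [exact: leq_maxl|exact/inv_succ_le/leq_maxl].
    by apply: mQ; apply: mxnear_le XY; [exact: leq_maxr|exact/inv_succ_le/leq_maxr].
  - by move=> P Q PQ [n nP]; exists n => Y /nP/PQ.
suff : G --> X by apply.
apply/(pointwise_cvgP (F := G) (X : nat * nat -> F)) => -[i j].
apply/na_cvgP => e e0; have [n ne] := inv_succ_small (divr_gt0 e0 (ltr0n _ 2)).
exists (maxn n (maxn i j).+1) => Y XY /=.
rewrite (@le_lt_trans _ _ (e / 2%:R))//; last by rewrite ltr_pdivrMr// ltr_pMr// ltr1n.
apply: le_trans ne; rewrite (le_trans _ (inv_succ_le (leq_maxl n (maxn i j).+1)))//.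
by apply: XY; rewrite leq_max ltnS ?leq_maxl ?leq_maxr orbT.
Qed.

Lemma mxnear_nbhs X n e : 0 < e -> nbhs X (mxnear n e X).
Proof.
move=> e0; have near_e ij : \forall Y \near X, absv (X ij - Y ij) <= e.
  have /na_cvgP/(_ e e0) := @Defs.coord_continuous R F ij X.
  by apply: filterS => Y /ltW.
rewrite (_ : mxnear n e X = [set Y | forall i : 'I_n, forall j : 'I_n,
    absv (X (i : nat, j : nat) - Y (i : nat, j : nat)) <= e]).
  have FX : Filter (nbhs X) by exact: nbhs_filter.
  have near_row (i : 'I_n) : nbhs X [set Y | forall j : 'I_n,
      absv (X (i : nat, j : nat) - Y (i : nat, j : nat)) <= e].
    by apply: (filter_forall (F := nbhs X)) => j; exact: near_e.
  by apply: (filter_forall (F := nbhs X)) => i; exact: near_row.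
apply/seteqP; split=> Y /= XY; first by move=> i j; exact: XY.
by move=> i j ni nj; exact: (XY (Ordinal ni) (Ordinal nj)).
Qed.

(* For [A := Prop], the clopen sets that depend on finitely many entries, each
   one up to a fixed precision. *)
Definition cyl (A : Type) (f : infmx F -> A) :=
  exists n e, 0 < e /\ forall X Y, mxnear n e X Y -> f X = f Y.

Lemma cyl_comp A B (h : A -> B) (f : infmx F -> A) : cyl f -> cyl (h \o f).
Proof. by move=> [n [e [e0 fe]]]; exists n, e; split=> // X Y /fe /= ->. Qed.

Lemma cyl_cst A (a : A) : cyl (fun=> a).
Proof. by exists 0%N, 1; split. Qed.

Lemma cyl_pair A B (f : infmx F -> A) (g : infmx F -> B) :
  cyl f -> cyl g -> cyl (fun X => (f X, g X)).
Proof.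
move=> [n [e [e0 fe]]] [m [d [d0 gd]]]; exists (maxn n m), (Num.min e d).
split=> [|X Y XY]; first by rewrite lt_min e0.
congr pair; [apply: fe|apply: gd]; apply: mxnear_le XY;
  by rewrite ?leq_maxl ?leq_maxr ?ge_min ?lexx ?orbT.
Qed.

Lemma cyl_comp2 A B C (h : A -> B -> C) (f : infmx F -> A) (g : infmx F -> B) :
  cyl f -> cyl g -> cyl (fun X => h (f X) (g X)).
Proof. by move=> cf cg; exact: (cyl_comp (fun ab => h ab.1 ab.2) (cyl_pair cf cg)). Qed.

Lemma cyl_big A (op : A -> A -> A) (idx : A) I (r : seq I) (P : pred I)
    (f : I -> infmx F -> A) :
  (forall i, P i -> cyl (f i)) -> cyl (fun X => \big[op/idx]_(i <- r | P i) f i X).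
Proof.
move=> cf; elim: r => [|i r IH].
  by under eq_fun do rewrite big_nil; exact: cyl_cst.
have [Pi|nPi] := boolP (P i); last first.
  by rewrite (_ : (fun _ => _) = (fun X => \big[op/idx]_(i <- r | P i) f i X)) ?IH//;
    apply/funext => X; rewrite big_cons (negPf nPi).
under eq_fun do rewrite big_cons Pi.
exact: (cyl_comp2 op (cf _ Pi) IH).
Qed.

Lemma cyl_forall (I : finType) (P : I -> infmx F -> Prop) :
  (forall i, cyl (P i)) -> cyl (fun X => forall i, P i X).
Proof.
move=> cP; rewrite (_ : (fun X => _) =
  (fun X => is_true (\big[andb/true]_i `[< P i X >]))).
  apply: cyl_comp; apply: cyl_big => i _.
  exact: (cyl_comp (fun p : Prop => `[< p >]) (cP i)).
apply/funext => X; apply/propext; split=> [PX|].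
  by elim/big_ind : _ => // [x y -> ->//|i _]; exact/asboolP.
by rewrite big_andE => /forallP h i; have /asboolP := h i.
Qed.

Lemma cyl_coord A (h : F -> A) ij e : 0 < e ->
  (forall x y, absv (x - y) <= e -> h x = h y) -> cyl (fun X => h (X ij)).
Proof.
move=> e0 he; exists (maxn ij.1 ij.2).+1, e; split=> // X Y XY; apply: he.
by case: ij XY => i j XY; apply: XY; rewrite ltnS ?leq_maxl ?leq_maxr.
Qed.

Lemma cyl_setC (A : set (infmx F)) : cyl A -> cyl (~` A).
Proof. exact: cyl_comp. Qed.

Lemma cyl_setI (A B : set (infmx F)) : cyl A -> cyl B -> cyl (A `&` B).
Proof. exact: cyl_comp2. Qed.

Lemma cyl_setU (A B : set (infmx F)) : cyl A -> cyl B -> cyl (A `|` B).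
Proof. exact: cyl_comp2. Qed.

Lemma cyl_preimage A (f : infmx F -> A) (B : set A) : cyl f -> cyl (f @^-1` B).
Proof. exact: cyl_comp. Qed.

Lemma cyl_open (A : set (infmx F)) : cyl A -> open A.
Proof.
move=> [n [e [e0 Ae]]]; rewrite openE => X AX; apply: filterS (mxnear_nbhs X n e0).
by move=> Y /Ae <-.
Qed.

Lemma cyl_continuous (T : topologicalType) (f : infmx F -> T) : cyl f -> continuous f.
Proof. by move=> cf; apply/continuousP => A _; apply: cyl_open; exact: cyl_preimage. Qed.

Lemma cyl_affine_le ij (a b : F) r : 0 < r -> cyl (fun X : infmx F => absv (a * X ij + b) <= r).
Proof.
move=> r0; have a1 : 0 < absv a + 1 by rewrite ltr_pwDr// absv_ge0.
have e0 : 0 < r / (absv a + 1) by rewrite divr_gt0.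
apply: (@cyl_coord _ (fun x => absv (a * x + b) <= r) ij _ e0) => x y xy.
apply: absv_near_le; rewrite opprD addrACA subrr addr0 -mulrBr absvM.
rewrite (le_trans (ler_wpM2l (absv_ge0 _) xy))// mulrA ler_pdivrMr// mulrC ler_pM2l//.
by rewrite lerDl.
Qed.

Lemma cyl_affine_gt ij (a b : F) r : 0 < r -> cyl [set X : infmx F | r < absv (a * X ij + b)].
Proof.
move=> /(cyl_affine_le ij a b)/(cyl_comp (fun p : bool => ~~ p : Prop)).
by congr cyl; apply/funext => X /=; rewrite -ltNge.
Qed.

Lemma cyl_tail ij r : 0 < r -> cyl [set X : infmx F | r < absv (X ij)].
Proof.
by move=> /(cyl_affine_gt ij 1 0); congr cyl; apply/funext => X /=; rewrite mul1r addr0.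
Qed.

Definition saturation n (U : set (infmx F)) : set (infmx F) :=
  [set X | mxnear n (inv_succ n) X `<=` U].

Lemma cyl_saturation n U : cyl (saturation n U).
Proof.
exists n, (inv_succ n); split=> [|X Y XY]; first exact: inv_succ_gt0.
apply/propext; split=> h Z YZ; apply: h; first exact: mxnear_trans YZ.
exact: mxnear_trans (mxnear_sym XY) YZ.
Qed.

Lemma saturation_sub n U : saturation n U `<=` U.
Proof. by move=> X; apply; apply/mxnear_refl/ltW/inv_succ_gt0. Qed.

Lemma saturation_homo n m U : (n <= m)%N -> saturation n U `<=` saturation m U.
Proof. by move=> nm X XU Y XY; apply: XU; apply: mxnear_le XY => //; exact: inv_succ_le. Qed.

Lemma bigcup_saturation U : open U -> \bigcup_n saturation n U = U.
Proof.
move=> oU; apply/seteqP; split=> [X [n _] /saturation_sub//|X UX].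
by have [n nU] := infmx_nbhsP (open_nbhs_nbhs (conj oU UX)); exists n.
Qed.

End Cylinders.

Lemma normr_indic_le1 (R : realType) T (A : set T) x : `|\1_A x| <= 1 :> R.
Proof. by rewrite indicE ger0_norm// lern1 leq_b1. Qed.

Section BoundedMeasurable.
Context d (T : measurableType d) (R : realType).
Implicit Types (f g : T -> R) (m : probability T R).

Definition bmeas f := measurable_fun setT f /\ exists M, forall x, `|f x| <= M.

Lemma bmeas_bounded f : bmeas f -> [bounded f x | x in [set: T]].
Proof.
move=> [_ [M fM]]; exists M; split; first by rewrite num_real.
by move=> N MN x _ /=; rewrite (le_trans (fM x))// ltW.
Qed.

Lemma bmeas_integrable m f : bmeas f -> m.-integrable setT (EFin \o f).
Proof.
move=> bf; have [mf _] := bf.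
apply: measurable_bounded_integrable => //; last exact: bmeas_bounded.
by rewrite -ge0_fin_numE// fin_num_measure.
Qed.

Lemma bmeas_cst r : bmeas (fun=> r).
Proof. by split; [exact: measurable_cst|exists `|r|]. Qed.

Lemma bmeasD f g : bmeas f -> bmeas g -> bmeas (fun x => f x + g x).
Proof.
move=> [mf [M fM]] [mg [N gN]]; split; first exact: measurable_funD.
by exists (M + N) => x; rewrite (le_trans (ler_normD _ _))// lerD.
Qed.

Lemma bmeasM f g : bmeas f -> bmeas g -> bmeas (fun x => f x * g x).
Proof.
move=> [mf [M fM]] [mg [N gN]]; split; first exact: measurable_funM.
by exists (M * N) => x; rewrite normrM ler_pM.
Qed.

Lemma bmeasZ r f : bmeas f -> bmeas (fun x => r * f x).
Proof. exact/bmeasM/bmeas_cst. Qed.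

Lemma bmeasN f : bmeas f -> bmeas (fun x => - f x).
Proof. by move=> /(bmeasZ (-1)); under eq_fun do rewrite mulN1r. Qed.

Lemma bmeasB f g : bmeas f -> bmeas g -> bmeas (fun x => f x - g x).
Proof. by move=> bf bg; apply: bmeasD => //; exact: bmeasN. Qed.

Lemma bmeas_sum I (r : seq I) (P : pred I) (f : I -> T -> R) :
  (forall i, P i -> bmeas (f i)) -> bmeas (fun x => \sum_(i <- r | P i) f i x).
Proof.
move=> bf; elim: r => [|i r IH].
  by under eq_fun do rewrite big_nil; exact: bmeas_cst.
have [Pi|nPi] := boolP (P i).
  by under eq_fun do rewrite big_cons Pi; exact: bmeasD (bf _ Pi) IH.
by under eq_fun do rewrite big_cons (negPf nPi).
Qed.

Lemma bmeasX n f : bmeas f -> bmeas (fun x => f x ^+ n).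
Proof.
move=> bf; elim: n => [|n IH]; first by under eq_fun do rewrite expr0; exact: bmeas_cst.
by under eq_fun do rewrite exprS; exact: bmeasM.
Qed.

Lemma bmeas_indic (A : set T) : measurable A -> bmeas \1_A.
Proof.
move=> mA; split; first exact: measurable_indic.
by exists 1 => x; exact: normr_indic_le1.
Qed.

Definition Ex m f := \int[m]_x f x.
Definition Pr m (A : set T) := fine (m A).

Lemma eq_Ex m f g : f =1 g -> Ex m f = Ex m g.
Proof. by move=> fg; congr Ex; apply/funext. Qed.

Lemma ExD m f g : bmeas f -> bmeas g -> Ex m (fun x => f x + g x) = Ex m f + Ex m g.
Proof. by move=> bf bg; rewrite /Ex RintegralD//; exact: bmeas_integrable. Qed.

Lemma ExB m f g : bmeas f -> bmeas g -> Ex m (fun x => f x - g x) = Ex m f - Ex m g.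
Proof. by move=> bf bg; rewrite /Ex RintegralB//; exact: bmeas_integrable. Qed.

Lemma ExZ m r f : bmeas f -> Ex m (fun x => r * f x) = r * Ex m f.
Proof. by move=> bf; rewrite /Ex RintegralZl//; exact: bmeas_integrable. Qed.

Lemma Ex_cst m r : Ex m (fun=> r) = r.
Proof.
rewrite /Ex Rintegral_cst//; have mT : m setT = 1%E := probability_setT m.
by rewrite [X in fine X]mT mulr1.
Qed.

Lemma Ex_sum m I (r : seq I) (P : pred I) (f : I -> T -> R) :
  (forall i, P i -> bmeas (f i)) ->
  Ex m (fun x => \sum_(i <- r | P i) f i x) = \sum_(i <- r | P i) Ex m (f i).
Proof.
move=> bf; elim: r => [|i r IH].
  by rewrite big_nil; under eq_Ex do rewrite big_nil; exact: Ex_cst.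
rewrite big_cons; have [Pi|nPi] := boolP (P i).
  under eq_Ex do rewrite big_cons Pi.
  by rewrite ExD ?IH//; [exact: bf|exact: bmeas_sum].
by under eq_Ex do rewrite big_cons (negPf nPi).
Qed.

Lemma le_Ex m f g : bmeas f -> bmeas g -> (forall x, f x <= g x) -> Ex m f <= Ex m g.
Proof.
by move=> bf bg fg; apply: le_Rintegral => //; exact: bmeas_integrable.
Qed.

Lemma Ex_ge0 m f : (forall x, 0 <= f x) -> 0 <= Ex m f.
Proof. by move=> f0; apply: Rintegral_ge0 => x _; exact: f0. Qed.

Lemma normr_Ex_le m f g : bmeas f -> bmeas g -> (forall x, `|f x| <= g x) ->
  `|Ex m f| <= Ex m g.
Proof.
move=> bf bg fg; rewrite ler_norml; apply/andP; split; last first.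
  by apply: le_Ex => // x; rewrite (le_trans (ler_norm _)).
rewrite -[X in X <= _]mulN1r -ExZ//; apply: le_Ex => //; first exact: bmeasZ.
by move=> x; rewrite mulN1r lerNl (le_trans _ (fg x))// -normrN ler_norm.
Qed.

Lemma normr_Ex_le_cst m f M : bmeas f -> (forall x, `|f x| <= M) -> `|Ex m f| <= M.
Proof. by move=> bf fM; rewrite -(Ex_cst m M); apply: normr_Ex_le => //; exact: bmeas_cst. Qed.

Lemma Ex_indic m (A : set T) : measurable A -> Ex m \1_A = Pr m A.
Proof. by move=> mA; rewrite /Ex /Pr /Rintegral integral_indic// setIT. Qed.

Lemma PrE m (A : set T) : measurable A -> m A = (Pr m A)%:E.
Proof. by move=> mA; rewrite /Pr fineK// fin_num_measure. Qed.

Lemma Pr_ge0 m (A : set T) : 0 <= Pr m A.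
Proof. exact: fine_ge0. Qed.

Lemma Pr_le1 m (A : set T) : measurable A -> Pr m A <= 1.
Proof. by move=> mA; rewrite -lee_fin -PrE// probability_le1. Qed.

Lemma PrT m : Pr m setT = 1.
Proof. by rewrite /Pr probability_setT. Qed.

Lemma le_Pr m (A B : set T) : measurable A -> measurable B -> A `<=` B ->
  Pr m A <= Pr m B.
Proof.
by move=> mA mB AB; rewrite -lee_fin -!PrE//; apply: le_measure => //; rewrite inE.
Qed.

Lemma PrU m (A B : set T) : measurable A -> measurable B -> A `&` B = set0 ->
  Pr m (A `|` B) = Pr m A + Pr m B.
Proof.
move=> mA mB AB; apply: EFin_inj; rewrite EFinD -!PrE//; last exact: measurableU.
exact: measureU.
Qed.

End BoundedMeasurable.

Section Pushforward.
Context d d' (T : measurableType d) (U : measurableType d') (R : realType).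

Lemma Ex_distribution (m : probability T R) (phi : {mfun T >-> U}) (f : U -> R) :
  bmeas f -> Ex (distribution m phi) f = Ex m (f \o phi).
Proof.
move=> bf; rewrite /Ex /Rintegral; congr fine.
rewrite /distribution integral_pushforward ?preimage_setT//.
  by apply/measurable_EFinP; case: bf.
apply: bmeas_integrable; split; last by case: bf => _ [M fM]; exists M => x; exact: fM.
by apply: measurableT_comp => //; case: bf.
Qed.

End Pushforward.

Section BorelSets.
Context {R : realType} {F : nonArchFieldType R}.

Lemma open_measurable_borel (T : ptopologicalType) (U : set T) :
  open U -> measurable (U : set (borel T)).
Proof. exact: sub_gen_smallest. Qed.

Lemma cyl_measurable (A : set (infmx F)) : cyl A -> measurable (A : set (borel (infmx F))).
Proof. by move=> /cyl_open; exact: open_measurable_borel. Qed.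

Lemma cyl_bmeas (f : infmx F -> R) M : cyl f -> (forall X, `|f X| <= M) ->
  bmeas (f : borel (infmx F) -> R).
Proof.
move=> cf fM; split; last by exists M.
by move=> _ B _; rewrite setTI; apply: cyl_measurable; exact: cyl_preimage.
Qed.

Section Initial.
Context (T : ptopologicalType) (phi : T -> infmx F).
Hypothesis phi_continuous : continuous phi.
Hypothesis phi_initial : forall U, open U -> exists2 V, open V & phi @^-1` V = U.

Lemma preimage_cyl_measurable (A : set (infmx F)) : cyl A ->
  measurable (phi @^-1` A : set (borel T)).
Proof.
move=> cA; apply: open_measurable_borel.
by move/continuousP: phi_continuous; apply; exact: cyl_open.
Qed.

Lemma probability_ext_cyl (m1 m2 : probability (borel T) R) :
  (forall A, cyl A -> m1 (phi @^-1` A) = m2 (phi @^-1` A)) ->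
  forall A, measurable A -> m1 A = m2 A.
Proof.
move=> m12; apply: (@g_sigma_algebra_measure_unique _ R (borel T) open _ (fun=> setT)).
- exact: open_measurable_borel.
- by move=> _; exact: openT.
- exact: bigcup_const.
- exact: openI.
- move=> U /phi_initial[V oV <-].
  have cvgV (m : probability (borel T) R) :
      m (phi @^-1` saturation n V) @[n --> \oo] --> m (phi @^-1` V).
    rewrite -{2}(bigcup_saturation oV) preimage_bigcup.
    apply: nondecreasing_cvg_mu.
    - by move=> n; apply: preimage_cyl_measurable; exact: cyl_saturation.
    - rewrite -preimage_bigcup bigcup_saturation//; apply: open_measurable_borel.
      by move/continuousP: phi_continuous; exact.
    - by move=> n k nk; apply/subsetPset => x /=; exact: saturation_homo.
  apply: (cvg_unique _ (cvgV m1)) => //.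
  rewrite (_ : (fun n => _) = (fun n => m2 (phi @^-1` saturation n V))).
    exact: cvgV.
  by apply/funext => n; rewrite m12//; exact: cyl_saturation.
- by move=> _; rewrite -ge0_fin_numE// fin_num_measure.
Qed.

End Initial.

Lemma probability_infmx_ext (m1 m2 : probability (borel (infmx F)) R) :
  (forall A, cyl A -> m1 A = m2 A) -> forall A, measurable A -> m1 A = m2 A.
Proof.
move=> m12; apply: (@probability_ext_cyl (infmx F) (fun X => X)).
- by move=> ?; exact: cvg_id.
- by move=> U oU; exists U.
- exact: m12.
Qed.

Definition skew_val : skew_infmx F -> infmx F := set_val.

Lemma skew_val_continuous : continuous skew_val.
Proof. exact: initial_continuous. Qed.

Lemma probability_skew_ext (m1 m2 : probability (borel (skew_infmx F)) R) :
  (forall A : set (infmx F), cyl A -> m1 (skew_val @^-1` A) = m2 (skew_val @^-1` A)) ->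
  forall A, measurable A -> m1 A = m2 A.
Proof.
move=> m12; apply: (@probability_ext_cyl (skew_infmx F) skew_val).
- exact: skew_val_continuous.
- by move=> U [V oV <-]; exists V.
- exact: m12.
Qed.

End BorelSets.

(** * Extension of contents *)

Record cyl_content (R : realType) (F : nonArchFieldType R) := {
  tc : set (infmx F) -> R ;
  tc_ge0 : forall A, 0 <= tc A ;
  tcT : tc setT = 1 ;
  tcU : forall A B, cyl A -> cyl B -> A `&` B = set0 -> tc (A `|` B) = tc A + tc B
}.

Record tight_content (R : realType) (F : nonArchFieldType R) := {
  tcc :> cyl_content F ;
  tc_tight : forall ij e, 0 < e -> exists2 r, 0 < r & tc tcc [set X | r < absv (X ij)] <= e
}.

Section TightContent.
Context {R : realType} {F : nonArchFieldType R} (m : cyl_content F).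
Implicit Types A B : set (infmx F).

Lemma tc0 : tc m set0 = 0.
Proof.
have := @tcU _ _ m set0 set0 (cyl_cst _) (cyl_cst _) (setI0 _).
by rewrite setU0 => /eqP; rewrite -[X in X == _]addr0 (inj_eq (addrI _)) => /eqP <-.
Qed.

Lemma tc_split A B : cyl A -> cyl B -> tc m A = tc m (A `&` B) + tc m (A `\` B).
Proof.
move=> cA cB; rewrite -[in LHS](setUIDK A B) tcU//.
- exact: cyl_setI.
- by rewrite setDE; apply: cyl_setI => //; exact: cyl_setC.
- by rewrite setDE setIACA setICr setI0.
Qed.

Lemma le_tc A B : cyl A -> cyl B -> A `<=` B -> tc m A <= tc m B.
Proof.
move=> cA cB AB; rewrite (tc_split cB cA) (setIidr AB).
by rewrite lerDl tc_ge0.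
Qed.

Lemma tc_leU A B : cyl A -> cyl B -> tc m (A `|` B) <= tc m A + tc m B.
Proof.
move=> cA cB; rewrite (tc_split (cyl_setU cA cB) cA) (setIidr (@subsetUl _ A B)) setDUl setDv set0U.
by rewrite lerD2l le_tc//; rewrite setDE; apply: cyl_setI => //; exact: cyl_setC.
Qed.

Lemma tc_le_bigsetU I (r : seq I) (G : I -> set (infmx F)) : (forall i, cyl (G i)) ->
  cyl (\big[setU/set0]_(i <- r) G i) /\
  tc m (\big[setU/set0]_(i <- r) G i) <= \sum_(i <- r) tc m (G i).
Proof.
move=> cG; elim: r => [|i r [cr le_r]].
  by rewrite !big_nil tc0; split => //; exact: cyl_cst.
rewrite !big_cons; split; first exact: cyl_setU.
by rewrite (le_trans (tc_leU _ _))// lerD2l.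
Qed.

End TightContent.

Section Caratheodory.
Context {R : realType} {F : nonArchFieldType R}
  (F_nondiscrete : ~ (forall A : set F, open A))
  (F_locally_compact : locally_compact [set: F]).
Implicit Types A B : set (infmx F).

Lemma box_compact (r : nat * nat -> R) :
  compact [set X : infmx F | forall ij, absv (X ij) <= r ij].
Proof.
have := @tychonoff (nat * nat)%type (fun=> F : topologicalType)
  (fun ij => [set x : F | absv x <= r ij])
  (fun ij => @ball_compact _ _ F_nondiscrete F_locally_compact (r ij)).
exact.
Qed.

Lemma compact_bigcup_cyl (K : set (infmx F)) (G : nat -> set (infmx F)) :
  compact K -> (forall i, cyl (G i)) -> K `<=` \bigcup_i G i ->
  exists n, K `<=` \big[setU/set0]_(i < n) G i.
Proof.
rewrite compact_cover => cK cG KG.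
have [D _ KD] := cK nat setT G (fun i _ => cyl_open (cG i)) KG.
exists (\max_(i <- finmap.enum_fset D) i).+1 => X /KD[i /= iD GX].
rewrite -bigcup_mkord; exists i => //=; rewrite ltnS.
exact: (@leq_bigmax_seq _ _ xpredT id i).
Qed.

Let tailset (r : nat * nat -> R) (i j : nat) : set (infmx F) :=
  [set X | r (i, j) < absv (X (i, j))].

Let tailrow r n i := \big[setU/set0]_(j < n) tailset r i j.

Lemma disjoint_box (r : nat * nat -> R) A : (forall ij, 0 < r ij) -> cyl A ->
  A `&` [set X | forall ij, absv (X ij) <= r ij] = set0 ->
  exists n, A `<=` \big[setU/set0]_(i < n) tailrow r n i.
Proof.
move=> r0 [n [e [e0 Ae]]] Ar0; exists n => X AX; apply: contrapT => nX.
pose Y : infmx F := fun ij => if (ij.1 < n)%N && (ij.2 < n)%N then X ij else 0.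
have XY : mxnear n e X Y by move=> i j ni nj; rewrite /Y/= ni nj subrr absv0 ltW.
suff : set0 Y by [].
rewrite -Ar0; split; first by rewrite -(Ae _ _ XY).
move=> [i j]; rewrite /Y/=; case: ifPn => [/andP[ni nj]|_]; last by rewrite absv0 ltW.
rewrite leNgt; apply/negP => rX; apply: nX; rewrite -bigcup_mkord; exists i => //.
by rewrite /tailrow -bigcup_mkord; exists j.
Qed.

Lemma sum_pow2_le1 n : \sum_(i < n) (2%:R^-1 : R) ^+ i.+1 <= 1.
Proof.
suff -> : \sum_(i < n) (2%:R^-1 : R) ^+ i.+1 = 1 - 2%:R^-1 ^+ n.
  by rewrite lerBlDr lerDl exprn_ge0.
elim: n => [|n IH]; first by rewrite big_ord0 expr0 subrr.
by rewrite big_ord_recr/= IH exprS; lra.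
Qed.

Lemma tc_small (m : tight_content F) (A : set (infmx F)) (G : nat -> set (infmx F)) e :
  0 < e -> cyl A -> (forall i, cyl (G i)) -> A `<=` \bigcup_i G i ->
  exists n, tc m A <= \sum_(i < n) tc m (G i) + e.
Proof.
move=> e0 cA cG AG; pose d (ij : nat * nat) : R := e * 2%:R^-1 ^+ ij.1.+1 * 2%:R^-1 ^+ ij.2.+1.
have d0 ij : 0 < d ij by rewrite !mulr_gt0// exprn_gt0.
have /choice[r rP] ij : exists r, 0 < r /\ tc m [set X | r < absv (X ij)] <= d ij.
  by have [r r0 rd] := tc_tight m ij (d0 ij); exists r.
pose H i := if i is i'.+1 then G i' else ~` A.
have [k kP] : exists n, [set X : infmx F | forall ij, absv (X ij) <= r ij] `<=`
    \big[setU/set0]_(i < n) H i.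
  apply: (compact_bigcup_cyl (@box_compact r)).
    by move=> [|i] /=; [exact: cyl_setC|exact: cG].
  move=> X _; have [/AG[i _ GX]|nAX] := pselect (A X); first by exists i.+1.
  by exists 0%N.
have cG' n : cyl (\big[setU/set0]_(i < n) G i).
  by have [] := tc_le_bigsetU m (index_enum 'I_n) (fun i : 'I_n => cG i).
exists k; rewrite (tc_split m cA (cG' k)) lerD//.
  apply: le_trans (proj2 (tc_le_bigsetU m (index_enum 'I_k) (fun i : 'I_k => cG i))).
  by apply: le_tc; [exact: cyl_setI|exact: cG'|exact: subIsetr].
have cD : cyl (A `\` \big[setU/set0]_(i < k) G i).
  by rewrite setDE; apply: cyl_setI => //; exact: cyl_setC.
have [n nP] : exists n, A `\` \big[setU/set0]_(i < k) G i `<=`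
    \big[setU/set0]_(i < n) tailrow r n i.
  apply: disjoint_box => //; first by move=> ij; have [] := rP ij.
  apply/seteqP; split=> X //= -[[AX nGX] rX]; apply: nGX.
  have := kP X rX; rewrite -!bigcup_mkord => -[[|i]/= ik] //= GX.
  by exists i => //; exact: ltnW.
have cT i j : cyl (tailset r i j) by apply: cyl_tail; have [] := rP (i, j).
have cTi i := tc_le_bigsetU m (index_enum 'I_n) (fun j : 'I_n => cT i j).
have cTr i : cyl (tailrow r n i) := proj1 (cTi i).
have [cTT le_TT] := tc_le_bigsetU m (index_enum 'I_n) (fun i : 'I_n => cTr i).
apply: le_trans (le_tc m cD cTT nP) _; apply: le_trans le_TT _.
apply: (@le_trans _ _ (\sum_(i < n) \sum_(j < n) d (i : nat, j : nat))).
  apply: ler_sum => i _; apply: le_trans (proj2 (cTi i)) _.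
  by apply: ler_sum => j _; have [] := rP (i : nat, j : nat).
rewrite /d/=; under eq_bigr do rewrite -mulr_sumr.
rewrite -mulr_suml -mulr_sumr -mulrA -[leRHS]mulr1 ler_pM2l//.
by rewrite mulr_ile1 ?sumr_ge0 ?sum_pow2_le1// => i _; rewrite exprn_ge0.
Qed.

End Caratheodory.

Definition cyl_algebra {R : realType} (F : nonArchFieldType R) : Type := infmx F.

Section CylAlgebra.
Context {R : realType} (F : nonArchFieldType R).

HB.instance Definition _ := Pointed.on (cyl_algebra F).
HB.instance Definition _ := @isAlgebraOfSets.Build default_measure_display
  (cyl_algebra F) (@cyl R F Prop : set (set (infmx F)))
  (cyl_cst False) (@cyl_setU R F) (@cyl_setC R F).

End CylAlgebra.

Lemma measure_probability d (T : measurableType d) (R : realType)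
    (E : {measure set T -> \bar R}) :
  E setT = 1%E -> exists P : probability T R, forall A, P A = E A.
Proof.
move=> ET; exists (mnormalize E (dirac point)) => A.
by rewrite /= /mnormalize; cbv zeta; rewrite [E [set: _]]ET onee_eq0/= invr1 mule1.
Qed.

Section Extension.
Context {R : realType} {F : nonArchFieldType R}
  (F_nondiscrete : ~ (forall A : set F, open A))
  (F_locally_compact : locally_compact [set: F]).

Section Measure.
Context (m : tight_content F).

Definition tc_ereal (A : set (cyl_algebra F)) : \bar R := (tc m A)%:E.

Let tc_ereal_ge0 A : (0 <= tc_ereal A)%E.
Proof. by rewrite lee_fin tc_ge0. Qed.

Let tc_ereal_semi_additive : measure_function.semi_additive tc_ereal.
Proof.
move=> G n mG tG _; elim: n => [|n IH].
  by rewrite !big_ord0 /tc_ereal tc0.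
rewrite !big_ord_recr/= /tc_ereal tcU ?EFinD.
- by rewrite -IH.
- by have [] := tc_le_bigsetU m (index_enum 'I_n) (fun i : 'I_n => mG i).
- exact: mG.
- rewrite -bigcup_mkord setI_bigcupl; apply: bigcup0 => i /= ni.
  by move/trivIsetP : tG; apply => //; rewrite ltn_eqF.
Qed.

HB.instance Definition _ := isContent.Build _ (cyl_algebra F) R tc_ereal
  tc_ereal_ge0 tc_ereal_semi_additive.

Let tc_ereal_sigma_subadditive : measurable_subset_sigma_subadditive tc_ereal.
Proof.
move=> A G mG mA AG; apply/lee_addgt0Pr => e e0.
have [n nP] := tc_small F_nondiscrete F_locally_compact m e0 mA mG AG.
rewrite (@le_trans _ _ (\sum_(i < n) tc m (G i) + e)%:E)// ?lee_fin// EFinD leeD2r//.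
rewrite -sumEFin -(big_mkord xpredT (fun i => tc_ereal (G i))).
exact: nneseries_lim_ge.
Qed.

HB.instance Definition _ := Content_SigmaSubAdditive_isMeasure.Build _ _
  (cyl_algebra F) tc_ereal tc_ereal_sigma_subadditive.

Lemma tight_content_extension :
  exists P : probability (borel (infmx F)) R, forall A, cyl A -> P A = (tc m A)%:E.
Proof.
pose S : measurableType _ := g_sigma_algebraType (@measurable _ (cyl_algebra F)).
pose E : {measure set S -> \bar R} := measure_extension tc_ereal.
have EE A : cyl A -> E A = (tc m A)%:E by move=> cA; exact: (@measurable_mu_extE _ _ _ tc_ereal).
have mid : measurable_fun [set: S] (fun X : S => X : borel (infmx F)).
  apply: (@measurability _ _ S (borel (infmx F)) _ _ open) => // _ [U oU <-].
  rewrite setTI preimage_id -(bigcup_saturation oU); apply: bigcupT_measurable => n.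
  by apply: sub_gen_smallest; exact: cyl_saturation.
have ET : E setT = 1%E by rewrite EE ?tcT//; exact: cyl_cst.
have [EP EPE] := measure_probability ET.
pose f : {mfun S >-> borel (infmx F)} := HB.pack (fun X : S => X : borel (infmx F))
  (isMeasurableFun.Build _ _ S (borel (infmx F)) _ mid).
by exists (distribution EP f) => A cA; rewrite -EE//; exact: EPE.
Qed.

End Measure.

End Extension.

(** * Weak convergence on cylinder sets *)

Section Portmanteau.
Context {R : realType} {F : nonArchFieldType R}.

Lemma sum_threshold_ge (t : R) K : t <= K%:R -> t <= \sum_(k < K) (k.+1%:R < t)%R%:R + 1.
Proof.
elim: K t => [|K IH] t tK; first by rewrite big_ord0 add0r (le_trans tK).
rewrite big_ord_recr/=; have [tK'|Kt] := leP t K%:R.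
  by rewrite (le_trans (IH _ tK'))// addrAC lerDl.
rewrite (eq_bigr (fun=> 1)) => [|k _]; last first.
  by rewrite (le_lt_trans _ Kt)// ler_nat.
rewrite sumr_const card_ord (le_trans tK)// -natr1 -addrA lerD2l.
by rewrite lerDr.
Qed.

Lemma sum_threshold_le (t : R) K : 0 <= t -> \sum_(k < K) (k.+1%:R < t)%R%:R <= t.
Proof.
move=> t0; elim: K => [|K IH]; first by rewrite big_ord0.
rewrite big_ord_recr/=; have [Kt|] := ltP K.+1%:R t; last by rewrite addr0.
rewrite -natr1 in Kt; rewrite (le_trans _ (ltW Kt))// lerD2r.
rewrite (@le_trans _ _ (\sum_(k < K) 1))//; last by rewrite sumr_const card_ord.
by apply: ler_sum => k _; rewrite lern1 leq_b1.
Qed.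

Lemma Pr_saturation_cvg (m : probability (borel (infmx F)) R) U : open U ->
  Pr m (saturation n U) @[n --> \oo] --> Pr m U.
Proof.
move=> oU; rewrite /Pr -{2}(bigcup_saturation oU).
have mS n : measurable (saturation n U : set (borel (infmx F))).
    by apply: cyl_measurable; exact: cyl_saturation.
apply: fine_cvg; rewrite fineK.
  apply: nondecreasing_cvg_mu; [exact: mS|exact: bigcupT_measurable|].
  by move=> n k nk; apply/subsetPset; exact: saturation_homo.
by rewrite fin_num_measure//; exact: bigcupT_measurable.
Qed.

Lemma continuous_bmeas (T : ptopologicalType) (f : T -> R) M : continuous f ->
  (forall x, `|f x| <= M) -> bmeas (f : borel T -> R).
Proof.
move=> cf fM; split; last by exists M.
move=> mT; apply: (measurability _ (RGenOpens.measurableE R)) => // _ [_ [a [b ->]] <-].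
rewrite setTI; apply: open_measurable_borel.
by move/continuousP: cf; apply; exact: interval_open.
Qed.

Context (I : Type) (G : set_system I) {FG : Filter G}.
Context (mu : I -> probability (borel (infmx F)) R) (m : probability (borel (infmx F)) R).
Hypothesis mu_cvg : forall A : set (infmx F), cyl A -> Pr (mu i) A @[i --> G] --> Pr m A.

Lemma portmanteau_lower (f : infmx F -> R) B e : continuous f ->
  (forall X, 0 <= f X <= B) -> 0 < e -> \forall i \near G, Ex m f - e <= Ex (mu i) f.
Proof.
move=> cf fB e0; pose d := e / 3%:R; have d0 : 0 < d by rewrite divr_gt0.
have bf : bmeas (f : borel (infmx F) -> R).
  apply: (@continuous_bmeas _ _ B) => // X; have /andP[f0 fB'] := fB X.
  by rewrite ger0_norm.
pose K := (Num.bound `|B / d|).+1.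
have BK : B / d <= K%:R.
  by rewrite (le_trans (ler_norm _))// ltW// (lt_trans (archi_boundP (normr_ge0 _)))// ltr_nat.
pose U (k : nat) : set (infmx F) := [set X | k.+1%:R < f X / d].
have oU k : open (U k).
  rewrite (_ : U k = f @^-1` [set x | k.+1%:R * d < x]).
    by move/continuousP : cf; apply; exact: open_gt.
  by apply/seteqP; split=> X /=; rewrite /U/= ltr_pdivlMr.
have /choice[n nP] k : exists n, Pr m (U k) - K%:R^-1 <= Pr m (saturation n (U k)).
  have /cvgrPdist_le/(_ K%:R^-1) := Pr_saturation_cvg (m := m) (oU k).
  rewrite invr_gt0 ltr0n => /(_ isT)[n _ /(_ n (leqnn n))] /=.
  by rewrite ler_distl => /andP[_ h]; exists n; rewrite lerBlDr.
pose S k : set (infmx F) := saturation (n k) (U k).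
have mS k : measurable (S k : set (borel (infmx F))) by apply: cyl_measurable; exact: cyl_saturation.
have mU k : measurable (U k : set (borel (infmx F))) by exact: open_measurable_borel.
pose g X := \sum_(k < K) d * \1_(U k) X; pose h X := \sum_(k < K) d * \1_(S k) X.
have bg : bmeas (g : borel (infmx F) -> R).
  by apply: bmeas_sum => k _; apply: bmeasZ; exact: bmeas_indic.
have bh : bmeas (h : borel (infmx F) -> R).
  by apply: bmeas_sum => k _; apply: bmeasZ; exact: bmeas_indic.
have gE X : g X = d * \sum_(k < K) (k.+1%:R < f X / d)%R%:R.
  rewrite /g mulr_sumr; apply: eq_bigr => k _; rewrite indicE; congr (_ * (nat_of_bool _)%:R).
  by apply/idP/idP; rewrite inE.
have ExgE (P : probability (borel (infmx F)) R) : Ex P g = \sum_(k < K) d * Pr P (U k).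
  rewrite Ex_sum; last by move=> k _; apply: bmeasZ; exact: bmeas_indic.
  by apply: eq_bigr => k _; rewrite ExZ ?Ex_indic//; exact: bmeas_indic.
have ExhE (P : probability (borel (infmx F)) R) : Ex P h = \sum_(k < K) d * Pr P (S k).
  rewrite Ex_sum; last by move=> k _; apply: bmeasZ; exact: bmeas_indic.
  by apply: eq_bigr => k _; rewrite ExZ ?Ex_indic//; exact: bmeas_indic.
have fg : Ex m f <= Ex m g + d.
  rewrite -[X in _ + X](Ex_cst m d) -ExD//; last exact: bmeas_cst.
  apply: le_Ex => //; first by apply: bmeasD => //; exact: bmeas_cst.
  move=> X; rewrite gE -[X in _ + X]mulr1 -mulrDr mulrC -ler_pdivrMr//.
  apply: sum_threshold_ge; apply: le_trans BK; rewrite ler_pM2r ?invr_gt0//.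
  by have /andP[] := fB X.
have hf (P : probability (borel (infmx F)) R) : Ex P h <= Ex P f.
  apply: le_Ex => // X; apply: (@le_trans _ _ (g X)).
    apply: ler_sum => k _; rewrite ler_pM2l// !indicE ler_nat.
    have [SX|] := boolP (X \in S k); last by [].
    by rewrite [X in (_ <= X)%N](_ : _ = 1%N)// mem_set//; apply: saturation_sub (set_mem SX).
  rewrite gE mulrC -ler_pdivlMr//; apply: sum_threshold_le.
  by rewrite divr_ge0 ?(ltW d0)//; have /andP[] := fB X.
have near_h : \forall i \near G, forall k : 'I_K, Pr m (S k) - K%:R^-1 <= Pr (mu i) (S k).
  apply: (filter_forall (F := G)) => k.
  have /cvgrPdist_le/(_ K%:R^-1) := mu_cvg (cyl_saturation (n k) (U k)).
  rewrite invr_gt0 ltr0n => /(_ isT); apply: filterS => i.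
  by rewrite ler_distl => /andP[_]; rewrite lerBlDr.
have Kd : \sum_(k < K) d * K%:R^-1 = d.
  by rewrite sumr_const card_ord -[LHS]mulr_natr -mulrA mulVf ?mulr1 ?pnatr_eq0.
apply: filterS near_h => i iS; apply: le_trans (hf (mu i)).
have -> : e = d + d + d by rewrite /d; lra.
have gh : Ex m g - d <= Ex m h.
  rewrite ExgE ExhE -[X in _ - X]Kd -sumrB; apply: ler_sum => k _.
  by rewrite -mulrBr ler_pM2l// nP.
have hh : Ex m h - d <= Ex (mu i) h.
  rewrite !ExhE -[X in _ - X]Kd -sumrB; apply: ler_sum => k _.
  by rewrite -mulrBr ler_pM2l// iS.
lra.
Qed.

Lemma portmanteau (f : infmx F -> R) M : continuous f -> (forall X, `|f X| <= M) ->
  Ex (mu i) f @[i --> G] --> Ex m f.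
Proof.
move=> cf fM; have bf : bmeas (f : borel (infmx F) -> R) by exact: continuous_bmeas fM.
have bM : bmeas ((fun=> M) : borel (infmx F) -> R) by exact: bmeas_cst.
apply/cvgrPdist_le => e e0.
have l1 : \forall i \near G, Ex m (fun X => f X + M) - e <= Ex (mu i) (fun X => f X + M).
  apply: (@portmanteau_lower _ (M + M)) => // [X|X].
    exact: (cvgD (cf X) (cvg_cst M)).
  by have := fM X; rewrite ler_norml; lra.
have l2 : \forall i \near G, Ex m (fun X => M - f X) - e <= Ex (mu i) (fun X => M - f X).
  apply: (@portmanteau_lower _ (M + M)) => // [X|X].
    exact: (cvgB (cvg_cst M) (cf X)).
  by have := fM X; rewrite ler_norml; lra.
apply: filterS2 l1 l2 => i; rewrite !ExB// !ExD// !Ex_cst => h1 h2.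
by rewrite ler_distlC; lra.
Qed.

End Portmanteau.

(** * Normal forms over the ring of integers *)

Section IntegralMatrices.
Context {R : realType} {F : nonArchFieldType R}.

Definition mxle m n (e : R) (A : 'M[F]_(m, n)) := forall i j, absv (A i j) <= e.

Lemma mxle0 m n e : 0 <= e -> mxle e (0 : 'M[F]_(m, n)).
Proof. by move=> e0 i j; rewrite mxE absv0. Qed.

Lemma mxleD m n e (A B : 'M[F]_(m, n)) : mxle e A -> mxle e B -> mxle e (A + B).
Proof. by move=> Ae Be i j; rewrite mxE absvD_le. Qed.

Lemma mxleN m n e (A : 'M[F]_(m, n)) : mxle e A -> mxle e (- A).
Proof. by move=> Ae i j; rewrite mxE absvN. Qed.

Lemma mxleB m n e (A B : 'M[F]_(m, n)) : mxle e A -> mxle e B -> mxle e (A - B).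
Proof. by move=> Ae Be; apply: mxleD => //; exact: mxleN. Qed.

Lemma mxle_tr m n e (A : 'M[F]_(m, n)) : mxle e A -> mxle e A^T.
Proof. by move=> Ae i j; rewrite mxE. Qed.

Lemma mxle_le m n a b (A : 'M[F]_(m, n)) : a <= b -> mxle a A -> mxle b A.
Proof. by move=> ab Aa i j; rewrite (le_trans (Aa i j)). Qed.

Lemma mxleM m n p a b (A : 'M[F]_(m, n)) (B : 'M[F]_(n, p)) : 0 <= a -> 0 <= b ->
  mxle a A -> mxle b B -> mxle (a * b) (A *m B).
Proof.
move=> a0 b0 Aa Bb i j; rewrite mxE; apply: absv_sum_le => [|k _]; first exact: mulr_ge0.
exact: absvM_le.
Qed.

Lemma mxleM1l m n p a (A : 'M[F]_(m, n)) (B : 'M[F]_(n, p)) : 0 <= a ->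
  mxle 1 A -> mxle a B -> mxle a (A *m B).
Proof. by move=> a0 A1 Ba; rewrite -[a]mul1r; exact: mxleM. Qed.

Lemma mxleM1r m n p a (A : 'M[F]_(m, n)) (B : 'M[F]_(n, p)) : 0 <= a ->
  mxle a A -> mxle 1 B -> mxle a (A *m B).
Proof. by move=> a0 Aa B1; rewrite -[a]mulr1; exact: mxleM. Qed.

Lemma mxle1 n : mxle 1 (1%:M : 'M[F]_n).
Proof. by move=> i j; rewrite mxE; case: eqP => _; rewrite ?absv1 ?absv0. Qed.

Lemma mxle_block m1 m2 n1 n2 e (A : 'M[F]_(m1, n1)) (B : 'M[F]_(m1, n2))
    (C : 'M[F]_(m2, n1)) (D : 'M[F]_(m2, n2)) :
  mxle e A -> mxle e B -> mxle e C -> mxle e D -> mxle e (block_mx A B C D).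
Proof.
move=> Ae Be Ce De i j; rewrite mxE; case: splitP => k _; rewrite mxE;
  by case: splitP => l _.
Qed.

Lemma absv_det_le1 n (A : 'M[F]_n) : mxle 1 A -> absv (\det A) <= 1.
Proof.
move=> A1; apply: absv_sum_le => // s _; apply: absvM_le1.
  by case: (s : bool); rewrite ?expr1 ?expr0 ?absvN absv1.
by apply: absv_prod_le1 => i _; exact: A1.
Qed.

Definition GLO n (G H : 'M[F]_n) :=
  [/\ mxle 1 G, mxle 1 H, G *m H = 1%:M & H *m G = 1%:M].

Lemma GLO1 n : GLO (1%:M : 'M[F]_n) 1%:M.
Proof. by split; rewrite ?mulmx1//; exact: mxle1. Qed.

Lemma GLO_sym n (G H : 'M[F]_n) : GLO G H -> GLO H G.
Proof. by case. Qed.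

Lemma GLO_tr n (G H : 'M[F]_n) : GLO G H -> GLO G^T H^T.
Proof.
move=> [G1 H1 GH HG]; split; try exact: mxle_tr; by rewrite -trmx_mul ?GH ?HG trmx1.
Qed.

Lemma GLO_mul n (G G' H H' : 'M[F]_n) : GLO G G' -> GLO H H' -> GLO (G *m H) (H' *m G').
Proof.
move=> [G1 G1' GG' G'G] [H1 H1' HH' H'H]; split.
- exact: mxleM1l.
- exact: mxleM1l.
- by rewrite mulmxA -(mulmxA G) HH' mulmx1.
- by rewrite mulmxA -(mulmxA H') G'G mulmx1.
Qed.

Lemma GLO_perm n (s : 'S_n) : GLO (perm_mx s : 'M[F]_n) (perm_mx s)^T.
Proof.
have p1 (t : 'S_n) : mxle 1 (perm_mx t : 'M[F]_n).
  by move=> i j; rewrite !mxE; case: eqP => _; rewrite ?absv1 ?absv0.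
split; [exact: p1|exact/mxle_tr/p1| |]; rewrite tr_perm_mx -perm_mxM ?mulgV ?mulVg;
  exact: perm_mx1.
Qed.

Lemma GLO_lower m n (C : 'M[F]_(n, m)) : mxle 1 C ->
  GLO (block_mx 1%:M 0 C 1%:M) (block_mx 1%:M 0 (- C) 1%:M).
Proof.
move=> C1; split.
- by apply: mxle_block => //; [exact: mxle1|exact: mxle0|exact: mxle1].
- by apply: mxle_block; [exact: mxle1|exact: mxle0|exact: mxleN|exact: mxle1].
- by rewrite mulmx_block !(mul1mx, mulmx1, mul0mx, mulmx0, addr0, add0r) subrr scalar_mx_block.
- by rewrite mulmx_block !(mul1mx, mulmx1, mul0mx, mulmx0, addr0, add0r) addNr scalar_mx_block.
Qed.

Lemma GLO_diag m n (G H : 'M[F]_n) : GLO G H ->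
  GLO (block_mx (1%:M : 'M[F]_m) 0 0 G) (block_mx 1%:M 0 0 H).
Proof.
move=> [G1 H1 GH HG]; split.
- by apply: mxle_block => //; [exact: mxle1|exact: mxle0|exact: mxle0].
- by apply: mxle_block => //; [exact: mxle1|exact: mxle0|exact: mxle0].
- by rewrite mulmx_block !(mul1mx, mulmx1, mul0mx, mulmx0, addr0, add0r) GH scalar_mx_block.
- by rewrite mulmx_block !(mul1mx, mulmx1, mul0mx, mulmx0, addr0, add0r) HG scalar_mx_block.
Qed.

Lemma GLO_det n (G : 'M[F]_n) : mxle 1 G -> absv (\det G) = 1 -> GLO G (invmx G).
Proof.
move=> G1 dG; have uG : G \in unitmx by rewrite unitmxE unitfE -absv_eq0 dG oner_eq0.
split; rewrite ?mulmxV ?mulVmx// => i j.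
rewrite /invmx uG !mxE absvM absvV dG invr1 mul1r; apply: absvM_le1.
  by rewrite -signr_odd; case: odd; rewrite ?expr1 ?expr0 ?absvN absv1.
by apply: absv_det_le1 => k l; rewrite !mxE.
Qed.

Lemma max_entry m n (A : 'M[F]_(m, n)) : A != 0 ->
  exists i j, A i j != 0 /\ mxle (absv (A i j)) A.
Proof.
move=> A0; have [[i0 j0] Aij0] : exists ij : 'I_m * 'I_n, A ij.1 ij.2 != 0.
  apply/existsP; apply: contra_neqT A0 => /existsPn h; apply/matrixP => i j.
  by have /negPn/eqP := h (i, j); rewrite mxE.
pose f (ij : 'I_m * 'I_n) := absv (A ij.1 ij.2).
have [[i j] _ ijmax] := @Order.TotalTheory.arg_maxP _ _ _ (i0, j0) xpredT f isT.
exists i, j; split; last by move=> k l; exact: (ijmax (k, l)).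
by rewrite -absv_gt0 (lt_le_trans _ (ijmax (i0, j0) isT))// absv_gt0.
Qed.

Lemma smith_step n (a : F) (u : 'rV[F]_n) (l : 'cV[F]_n) (D G H : 'M[F]_n) (d : 'rV_n) :
  a != 0 -> G *m (D - a^-1 *: l *m u) *m H = diag_mx d ->
  block_mx 1%:M 0 0 G *m (block_mx 1%:M 0 (- (a^-1 *: l)) 1%:M *m
    (block_mx a%:M u l D *m
      (block_mx 1%:M (- (a^-1 *: u)) 0 1%:M *m block_mx 1%:M 0 0 H))) =
  diag_mx (row_mx (a%:M : 'rV_1) d).
Proof.
move=> a0 GH; set r := a^-1 *: u; set c := a^-1 *: l in GH *.
rewrite (mulmxA (block_mx 1%:M 0 (- c) 1%:M)) (mulmx_block 1%:M 0 (- c)).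
rewrite !(mul1mx, mulmx1, mul0mx, mulmx0, addr0, add0r).
have -> : - c *m a%:M + l = 0.
  by rewrite mulNmx mul_mx_scalar scalerA mulfV// scale1r addNr.
rewrite (mulmxA _ _ (block_mx 1%:M 0 0 H)) (mulmx_block _ _ _ _ 1%:M (- r)).
rewrite !(mul1mx, mulmx1, mul0mx, mulmx0, addr0, add0r).
have -> : a%:M *m - r + u = 0.
  by rewrite mulmxN mul_scalar_mx scalerA mulfV// scale1r addNr.
rewrite !mulmx_block !(mul1mx, mulmx1, mul0mx, mulmx0, addr0, add0r).
rewrite mulNmx addrC mulmxA GH diag_mx_row; congr (block_mx _ 0 0 _).
by apply/matrixP => k k'; rewrite !ord1 !mxE eqxx.
Qed.

Lemma smith_normal_form n (Y : 'M[F]_n) : exists G G' H H' (d : 'rV[F]_n),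
  [/\ GLO G G', GLO H H' & G *m Y *m H = diag_mx d].
Proof.
elim: n Y => [|n IH] Y.
  by exists 1%:M, 1%:M, 1%:M, 1%:M, 0; split; [exact: GLO1|exact: GLO1|apply/matrixP => -[]].
have [->|/max_entry[i [j [a0 Yij]]]] := eqVneq Y 0.
  exists 1%:M, 1%:M, 1%:M, 1%:M, 0; split; [exact: GLO1|exact: GLO1|].
  by rewrite mulmx0 mul0mx; apply/matrixP => i j; rewrite !mxE mul0rn.
set a := Y i j in a0 Yij.
pose P : 'M[F]_(1 + n) := perm_mx (tperm ord0 i).
pose Q : 'M[F]_(1 + n) := perm_mx (tperm ord0 j).
pose Z : 'M[F]_(1 + n, 1 + n) := P *m Y *m Q.
have ZE k l : Z k l = Y (tperm ord0 i k) (tperm ord0 j l).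
  rewrite /Z /P /Q -row_permE -[tperm ord0 j]invgK -col_permE !mxE.
  by rewrite !tpermV.
have ZD : P *m Y *m Q = Z by [].
clearbody Z.
have Za : ulsubmx Z = a%:M.
  apply/matrixP => k l; rewrite !ord1 [RHS]mxE eqxx mulr1n !mxE ZE.
  by rewrite !lshift0 !tpermL.
pose c := a^-1 *: dlsubmx Z; pose r := a^-1 *: ursubmx Z.
have c1 : mxle 1 (- c).
  apply: mxleN => k l; rewrite !mxE ZE absvM absvV mulrC ler_pdivrMr ?mul1r ?absv_gt0//.
have r1 : mxle 1 (- r).
  apply: mxleN => k l; rewrite !mxE ZE absvM absvV mulrC ler_pdivrMr ?mul1r ?absv_gt0//.
have [G [G' [H [H' [d [GG HH GH]]]]]] := IH (drsubmx Z - c *m ursubmx Z).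
have r1' : GLO (block_mx 1%:M (- r) 0 1%:M) (block_mx 1%:M (- - r) 0 1%:M).
  by have := GLO_tr (GLO_lower (mxle_tr r1)); rewrite !tr_block_mx !trmx1 !trmx0 !linearN/= !trmxK.
do 4 eexists; exists (row_mx (a%:M : 'rV_1) d); split.
- exact: (GLO_mul (GLO_mul (GLO_diag 1 GG) (GLO_lower c1)) (GLO_perm (tperm ord0 i))).
- exact: (GLO_mul (GLO_perm (tperm ord0 j)) (GLO_mul r1' (GLO_diag 1 HH))).
rewrite -!mulmxA [X in _ *m (_ *m X)]mulmxA [X in _ *m (_ *m X)]mulmxA -/P -/Q.
rewrite ZD -[Z]submxK Za.
exact: smith_step.
Qed.

Definition bipartite n (I : pred 'I_n) (S : 'M[F]_n) :=
  forall i j, ~~ (I i && ~~ I j) -> S i j = 0.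

Lemma bipartite_mxle n (I : pred 'I_n) (S : 'M[F]_n) e : 0 <= e ->
  bipartite I S -> mxle e (S - S^T) -> mxle e S.
Proof.
move=> e0 IS Se i j; have [/andP[Ii Ij]|nIij] := boolP (I i && ~~ I j).
  by have := Se i j; rewrite !mxE (IS j i) ?subr0// negb_and Ij.
by rewrite IS// absv0.
Qed.

Let J : 'M[F]_2 := \matrix_(i, j) (i < j)%N%:R.

Let JJ : (J - J^T) *m (J - J^T) = - 1%:M.
Proof.
apply/matrixP => i j; rewrite !mxE !big_ord_recl big_ord0 !mxE.
case: i => -[|[|//]] ? /=; case: j => -[|[|//]] ? /=;
  by rewrite ?(mulr0n, mulr1n, subr0, sub0r, mulr0, mul0r, mulr1, mul1r, addr0,
    add0r, mulrN, mulNr, opprK, oppr0).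
Qed.

Let K : 'M[F]_2 := J - J^T.

Let trK : K^T = - K.
Proof. by rewrite /K linearB/= trmxK opprB. Qed.

Lemma skew_step n (a : F) (l : 'M[F]_(n, 2)) (D : 'M[F]_n) : a != 0 -> D^T = - D ->
  let c := l *m (- a^-1 *: K) in
  block_mx 1%:M 0 (- c) 1%:M *m block_mx (a *: K) (- l^T) l D *m
    (block_mx 1%:M 0 (- c) 1%:M)^T = block_mx (a *: K) 0 0 (D + c *m l^T) /\
  (D + c *m l^T)^T = - (D + c *m l^T).
Proof.
move=> a0 sD c; have aK : (- a^-1 *: K) *m (a *: K) = 1%:M.
  by rewrite -scalemxAl -scalemxAr JJ scalerA mulNr mulVf// scaleN1r opprK.
have Ka : (a *: K) *m (- a^-1 *: K) = 1%:M.
  by rewrite -scalemxAl -scalemxAr JJ scalerA mulrN mulfV// scaleN1r opprK.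
have trc : c^T = - ((- a^-1 *: K) *m l^T).
  by rewrite /c trmx_mul linearZ/= trK scalerN mulNmx.
split; last by rewrite [LHS]linearD/= trmx_mul trmxK trc sD opprD mulmxN mulmxA.
rewrite tr_block_mx !trmx1 trmx0 linearN/= trc !mulmx_block.
rewrite !(mul1mx, mulmx1, mul0mx, mulmx0, addr0, add0r) opprK.
have -> : - c *m (a *: K) + l = 0 by rewrite /c mulNmx -mulmxA aK mulmx1 addNr.
by rewrite mul0mx add0r mulmxA Ka mul1mx subrr mulNmx mulmxN opprK addrC.
Qed.

Lemma conj_mulmx n (X Y A : 'M[F]_n) :
  X *m Y *m A *m (X *m Y)^T = X *m (Y *m A *m Y^T) *m X^T.
Proof. by rewrite trmx_mul !mulmxA. Qed.

Lemma block_conj_skew n (a : F) (l : 'M[F]_(n, 2)) (D H S : 'M[F]_n) :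
  a != 0 -> D^T = - D ->
  let c := l *m (- a^-1 *: K) in
  H *m (D + c *m l^T) *m H^T = S - S^T ->
  block_mx 1%:M 0 0 H *m
    (block_mx 1%:M 0 (- c) 1%:M *m block_mx (a *: K) (- l^T) l D *m
      (block_mx 1%:M 0 (- c) 1%:M)^T) *m (block_mx 1%:M 0 0 H)^T =
  block_mx (a *: J) 0 0 S - (block_mx (a *: J) 0 0 S)^T.
Proof.
move=> a0 sD c HS; have [-> _] := skew_step l a0 sD.
rewrite !tr_block_mx !mulmx_block !(trmx1, trmx0) opp_block_mx add_block_mx.
rewrite !(mul1mx, mulmx1, mul0mx, mulmx0, addr0, add0r) HS ?oppr0 ?addr0 ?trmx0 ?subr0.
by rewrite linearZ/= -?scalerBr -?scalerN -?scalerDr ?subrr ?addr0.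
Qed.

Lemma skew_bipartite (two_neq0 : (2%:R : F) != 0) n (A : 'M[F]_n) : A^T = - A ->
  exists H H' S I, [/\ GLO H H', H *m A *m H^T = S - S^T & bipartite I S].
Proof.
elim: n {-2}n (leqnn n) A => [|N IH] n nN A sA.
  move: nN A sA; rewrite leqn0 => /eqP -> A sA; exists 1%:M, 1%:M, 0, xpred0.
  by split; [exact: GLO1|apply/matrixP => -[]|move=> []].
have [->|/max_entry[i [j [a0 Aij]]]] := eqVneq A 0.
  exists 1%:M, 1%:M, 0, xpred0; split; [exact: GLO1| |by move=> i j; rewrite mxE].
  by rewrite mulmx0 mul0mx trmx0 subr0.
have Askew k l : A k l = - A l k.
  by have /matrixP/(_ l k) := sA; rewrite !mxE => ->.
have Adiag k : A k k = 0.
  have /eqP := Askew k k.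
  by rewrite -addr_eq0 -mulr2n -mulr_natr mulf_eq0 (negPf two_neq0) orbF => /eqP.
have ij : i != j by apply: contraNneq a0 => <-; rewrite Adiag.
case: n => [|[|n]] in nN A sA i j a0 Aij Askew Adiag ij *; [by case: i a0 Aij ij|
  by move: ij; rewrite !ord1|].
pose o1 : 'I_n.+2 := lift ord0 ord0.
pose t1 := tperm ord0 i; pose t2 := tperm o1 (t1 j); pose s := (t2 * t1)%g.
have t1j : t1 j != ord0.
  by apply: contraNneq ij => /(congr1 t1); rewrite tpermK tpermL => ->.
have s0 : s ord0 = i.
  by rewrite permM [t2 _]tpermD ?tpermL// eq_sym.
have s1 : s o1 = j by rewrite permM tpermL tpermK.
clearbody s; clear t1 t2 t1j.
pose P : 'M[F]_(2 + n) := perm_mx s.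
pose Z : 'M[F]_(2 + n, 2 + n) := P *m A *m P^T.
have ZE k l : Z k l = A (s k) (s l).
  by rewrite /Z /P tr_perm_mx -row_permE -col_permE !mxE.
have ZD : P *m A *m P^T = Z by [].
clearbody Z; set a := A i j in a0 Aij.
have Zul : ulsubmx Z = a *: K.
  apply/matrixP => k l; rewrite !mxE ZE.
  have e0 : lshift n (ord0 : 'I_2) = ord0 by apply: val_inj.
  have e1 : lshift n (ord_max : 'I_2) = o1 by apply: val_inj.
  have o01 (x : 'I_2) : x = ord0 \/ x = ord_max.
    by case: x => -[|[|//]] ?; [left|right]; apply: val_inj.
  by case: (o01 k) => ->; case: (o01 l) => ->; rewrite ?(e0, e1, s0, s1, Adiag)/=
    ?mulr0n ?mulr1n ?subr0 ?sub0r ?oppr0 ?mulr0 ?mulr1 ?mulrN1 -?Askew.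
have Zur : ursubmx Z = - (dlsubmx Z)^T.
  by apply/matrixP => k l; rewrite !mxE !ZE Askew.
have Zdr : (drsubmx Z)^T = - drsubmx Z.
  by apply/matrixP => k l; rewrite !mxE !ZE Askew.
have [_] := skew_step (dlsubmx Z) a0 Zdr; set c := _ *m (_ *: K) => sD.
have c1 : mxle 1 (- c).
  rewrite /c -scalemxAr; apply: mxleN => k l; rewrite mxE absvM absvN absvV mulrC.
  rewrite ler_pdivrMr ?absv_gt0// mul1r mxE; apply: absv_sum_le => [|h _].
    exact: absv_ge0.
  rewrite mulrC; apply: absvM_le1; last by rewrite !mxE ZE.
  by rewrite !mxE; case: ltngtP => _;
    rewrite ?mulr0n ?mulr1n ?subr0 ?sub0r ?absvN ?absv0 ?absv1.
have nN' : (n <= N)%N by rewrite -ltnS; exact: ltnW.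
have [H [H' [S [I [HH HS IS]]]]] := IH n nN' _ sD.
do 2 eexists; exists (block_mx (a *: J) 0 0 S : 'M[F]_(2 + n)).
exists (fun k : 'I_(2 + n) => match fintype.split k with inl x => x == ord0 | inr y => I y end).
split.
- exact: (GLO_mul (GLO_mul (GLO_diag 2 HH) (GLO_lower c1)) (GLO_perm s)).
- rewrite conj_mulmx ZD conj_mulmx -[Z]submxK Zul Zur.
  exact: block_conj_skew.
- move=> k l; rewrite mxE; case: splitP => k' _; rewrite mxE; case: splitP => l' _ Ikl.
  + rewrite !mxE; case: ltnP => [kl|_]; last by rewrite mulr0.
    case/negP: Ikl; case: k' l' kl => -[|[|//]] ? [] [|[|//]] ? //=.
  + by rewrite mxE.
  + by rewrite mxE.
  + exact: IS.
Qed.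

End IntegralMatrices.

Section Corners.
Context {R : realType} {F : nonArchFieldType R}.

Definition corner n (X : infmx F) : 'M[F]_n := \matrix_(i, j) X (i : nat, j : nat).

Definition extmx n (G : 'M[F]_n) : infmx F := fun ij =>
  if (insub ij.1 : option 'I_n, insub ij.2 : option 'I_n) is (Some i, Some j)
  then G i j else (ij.1 == ij.2)%:R.

Lemma extmx_in n (G : 'M[F]_n) (i j : 'I_n) : extmx G (i : nat, j : nat) = G i j.
Proof. by rewrite /extmx/= !valK. Qed.

Lemma extmx_outl n (G : 'M[F]_n) i j : (n <= i)%N -> extmx G (i, j) = (i == j)%:R.
Proof. by move=> ni; rewrite /extmx/= insubN// -leqNgt. Qed.

Lemma extmx_outr n (G : 'M[F]_n) i j : (n <= j)%N -> extmx G (i, j) = (i == j)%:R.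
Proof. by move=> nj; rewrite /extmx/=; case: insub => // k; rewrite insubN// -leqNgt. Qed.

Lemma extmx_row0 n (G : 'M[F]_n) i j : (i < n)%N -> (n <= j)%N -> extmx G (i, j) = 0.
Proof.
move=> ni nj; rewrite extmx_outr//; case: eqP => // ij.
by move: nj; rewrite -ij leqNgt ni.
Qed.

Lemma extmx_col0 n (G : 'M[F]_n) i j : (n <= i)%N -> (j < n)%N -> extmx G (i, j) = 0.
Proof.
move=> ni nj; rewrite extmx_outl//; case: eqP => // ij.
by move: ni; rewrite ij leqNgt nj.
Qed.

Lemma extmx_id n (G : 'M[F]_n) : eventually_id (extmx G).
Proof.
exists n.*2 => i j nij; have [ni|ni] := leqP n i; first exact: extmx_outl.
by apply: extmx_outr; lia.
Qed.

Lemma extmx_int n (G : 'M[F]_n) : mxle 1 G -> forall ij, ring_of_integers (extmx G ij).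
Proof.
move=> G1 [i j]; rewrite /extmx/ring_of_integers/=.
case: insub => [k|]; last by case: eqP => _; rewrite ?absv1 ?absv0.
by case: insub => [l|]; [exact: G1|case: eqP => _; rewrite ?absv1 ?absv0].
Qed.

Lemma extmx_mul n (G H : 'M[F]_n) : G *m H = 1%:M ->
  infmx_mul (extmx G) (extmx H) = infmx1.
Proof.
move=> GH; apply/funext => -[i j]; rewrite /infmx_mul/=.
have [ni|ni] := leqP n i.
  rewrite (@fsum_ord _ _ _ i.+1); last first.
    by move=> k ik; rewrite extmx_outl// ltn_eqF// mul0r.
  rewrite big_ord_recr/= big1 ?add0r => [|k _]; last first.
    by rewrite extmx_outl// gtn_eqF// mul0r.
  by rewrite extmx_outl// eqxx mul1r extmx_outl.
rewrite (@fsum_ord _ _ _ n); last by move=> k nk; rewrite extmx_row0// mul0r.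
have [nj|nj] := leqP n j.
  rewrite big1 => [|k _]; last by rewrite (@extmx_row0 _ _ k)// mulr0.
  by rewrite /infmx1/= ltn_eqF// (leq_trans ni).
have := congr1 (fun A : 'M[F]_n => A (Ordinal ni) (Ordinal nj)) GH.
rewrite !mxE /infmx1/= => <-; apply: eq_bigr => k _.
by rewrite -(extmx_in G) -(extmx_in H).
Qed.

Lemma exists_GLinfty n (G H : 'M[F]_n) : GLO G H ->
  exists g : GLinfty F, gl_mx g = extmx G /\ gl_inv g = extmx H.
Proof.
move=> [G1 H1 GH HG]; exists (Build_GLinfty (extmx_id G) (extmx_id H)
  (extmx_int G1) (extmx_int H1) (extmx_mul GH) (extmx_mul HG)).
by [].
Qed.

Lemma corner_mul2 n (G H : 'M[F]_n) X :
  corner n (infmx_mul (infmx_mul (extmx G) X) (extmx H)) = G *m corner n X *m H.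
Proof.
apply/matrixP => i j; rewrite mxE (@infmx_mul2E _ _ _ _ _ _ _ n n).
- rewrite mxE; apply: eq_bigr => k _; rewrite mxE mulr_suml; apply: eq_bigr => l _.
  by rewrite !extmx_in !mxE mulrC.
- by move=> k; exact: extmx_row0.
- by move=> k nk; exact: extmx_col0.
Qed.

Lemma mat_act_corner n (G G' H H' : 'M[F]_n) : GLO G G' -> GLO H H' ->
  exists g, forall X, corner n (mat_act F g X) = G *m corner n X *m H.
Proof.
move=> /exists_GLinfty[g [gE _]] /GLO_sym/exists_GLinfty[h [_ hE]].
by exists (g, h) => X; rewrite -corner_mul2 -gE -hE.
Qed.

Lemma extmx_tr n (G : 'M[F]_n) : infmx_tr (extmx G) = extmx G^T.
Proof.
apply/funext => -[i j]; rewrite /infmx_tr /extmx/=.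
by case: insub => [k|]; case: insub => [l|] /=; rewrite ?mxE// eq_sym.
Qed.

Lemma skew_act_corner n (G G' : 'M[F]_n) : GLO G G' ->
  exists g, forall A, corner n (skew_val (skew_act F g A)) = G *m corner n (skew_val A) *m G^T.
Proof.
move=> /exists_GLinfty[g [gE _]]; exists g => A /=.
by rewrite -[RHS]corner_mul2 -extmx_tr -gE.
Qed.

Lemma mxnear_corner n e X Y : mxnear n e X Y <-> mxle e (corner n X - corner n Y).
Proof.
split=> [XY i j|XY i j ni nj]; first by rewrite !mxE XY.
by have := XY (Ordinal ni) (Ordinal nj); rewrite !mxE.
Qed.

Lemma cyl_corner (A : Type) n (h : 'M[F]_n -> A) e : 0 < e ->
  (forall M N, mxle e (M - N) -> h M = h N) -> cyl (h \o corner n).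
Proof. by move=> e0 he; exists n, e; split=> // X Y /mxnear_corner; exact: he. Qed.

Lemma mxnear_mul2 (g h : infmx F) n : eventually_id g -> eventually_id h ->
  (forall ij, ring_of_integers (g ij)) -> (forall ij, ring_of_integers (h ij)) ->
  exists k, forall e (X Y : infmx F), 0 <= e -> mxnear k e X Y ->
    mxnear n e (infmx_mul (infmx_mul g X) h) (infmx_mul (infmx_mul g Y) h).
Proof.
move=> [N gN] [M hM] g1 h1; pose k := maxn n (maxn N M); exists k => e X Y e0 XY i j ni nj.
have g0 l : (k <= l)%N -> g (i, l) = 0.
  rewrite !geq_max => /and3P[nl Nl Ml]; rewrite gN ?(leq_trans Nl) ?leq_addl//.
  by rewrite ltn_eqF// (leq_trans ni).
have h0 l : (k <= l)%N -> h (l, j) = 0.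
  rewrite !geq_max => /and3P[nl Nl Ml]; rewrite hM ?(leq_trans Ml) ?leq_addr//.
  by rewrite gtn_eqF// (leq_trans nj).
rewrite !(infmx_mul2E _ g0 h0) -sumrB; apply: absv_sum_le => // p _.
rewrite -sumrB; apply: absv_sum_le => // q _.
by rewrite -!mulrBr absvM_le1 ?h1// absvM_le1 ?g1// XY.
Qed.

Lemma cyl_mat_act (A : Type) (f : infmx F -> A) g : cyl f -> cyl (f \o mat_act F g).
Proof.
move=> [n [e [e0 fe]]].
have [k kP] := mxnear_mul2 n (gl_mx_id g.1) (gl_inv_id g.2) (gl_mx_int g.1) (gl_inv_int g.2).
by exists k, e; split=> // X Y XY; apply: fe; apply: kP => //; exact: ltW.
Qed.

Definition infmx_tau (X : infmx F) : infmx F := infmx_sub X (infmx_tr X).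

Lemma cyl_tau (A : Type) (f : infmx F -> A) : cyl f -> cyl (f \o infmx_tau).
Proof.
move=> [n [e [e0 fe]]]; exists n, e; split=> // X Y XY; apply: fe => i j ni nj.
rewrite /infmx_tau /infmx_sub /infmx_tr/=.
have -> : X (i, j) - X (j, i) - (Y (i, j) - Y (j, i)) =
  (X (i, j) - Y (i, j)) - (X (j, i) - Y (j, i)) by ring.
by rewrite absvB_le ?XY.
Qed.

Lemma corner_tau n X : corner n (infmx_tau X) = corner n X - (corner n X)^T.
Proof. by apply/matrixP => i j; rewrite !mxE. Qed.

Definition bi_invariant (P : probability (borel (infmx F)) R) :=
  forall g (A : set (infmx F)), cyl A -> P (mat_act F g @^-1` A) = P A.

Lemma mat_act_measurable g (A : set (borel (infmx F))) : measurable A ->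
  measurable (mat_act F g @^-1` A : set (borel (infmx F))).
Proof. exact: measurable_preimage_act. Qed.

Lemma bi_invariant_measurable P g (A : set (borel (infmx F))) : bi_invariant P ->
  measurable A -> P (mat_act F g @^-1` A) = P A.
Proof.
move=> Pinv; move: A.
have := @probability_infmx_ext _ F
  (distribution P (borel_fun (act_continuous (mat_act F) g))) P.
by apply => A cA; exact: Pinv.
Qed.

Lemma Ex_eq_prob d (T : measurableType d) (P Q : probability T R) f :
  (forall A, measurable A -> P A = Q A) -> Ex P f = Ex Q f.
Proof.
move=> PQ; rewrite /Ex /Rintegral; congr fine.
by apply: eq_measure_integral => A mA _; exact: PQ.
Qed.

Lemma Ex_mat_act P g f : bi_invariant P -> bmeas (f : borel (infmx F) -> R) ->
  Ex P (f \o mat_act F g) = Ex P f.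
Proof.
move=> Pinv bf.
rewrite -(@Ex_distribution _ _ _ _ _ P (borel_fun (act_continuous (mat_act F) g)) f)//.
by apply: Ex_eq_prob => A mA; exact: (bi_invariant_measurable g Pinv mA).
Qed.

Lemma Ex_corner P n (h : 'M[F]_n -> R) M G G' H H' : bi_invariant P ->
  cyl (h \o corner n) -> (forall Y, `|h Y| <= M) -> GLO G G' -> GLO H H' ->
  Ex P (fun X => h (G *m corner n X *m H)) = Ex P (h \o corner n).
Proof.
move=> Pinv ch hM GG HH; have [g gE] := mat_act_corner GG HH.
have bh : bmeas (h \o corner n : borel (infmx F) -> R).
  exact: (@cyl_bmeas R F (h \o corner n) M ch (fun X => hM (corner n X))).
rewrite -(Ex_mat_act g Pinv bh).
by apply: eq_Ex => X /=; rewrite -gE.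
Qed.

End Corners.

Section Tails.
Context d (T : measurableType d) (R : realType) (P : probability T R).

Lemma Pr_tail_small (f : T -> R) e : (forall r, 0 < r -> measurable [set x | r < f x]) ->
  0 < e -> exists2 r, 0 < r & Pr P [set x | r < f x] <= e.
Proof.
move=> mf e0; pose A n := [set x | n.+1%:R < f x].
have A0 : \bigcap_n A n = set0.
  apply/seteqP; split=> // x /= Ax; have := Ax (Num.bound `|f x|) I.
  rewrite /A/= ltNge => /negP; apply; apply: (le_trans (ler_norm _)).
  by rewrite ltW// (lt_trans (archi_boundP (normr_ge0 _)))// ltr_nat.
have cA : P (A n) @[n --> \oo] --> 0%E.
  rewrite -(measure0 P) -A0; apply: nonincreasing_cvg_mu => //.
  - by rewrite -ge0_fin_numE// fin_num_measure//; exact: mf.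
  - by move=> n; exact: mf.
  - by apply: bigcapT_measurable => n; exact: mf.
  - by move=> n k nk; apply/subsetPset => x /=; apply: le_lt_trans; rewrite ler_nat.
have /(@fine_cvg _ _ _ _ _ 0)/cvgrPdist_le/(_ e e0)[n _ /(_ n (leqnn n))] := cA.
rewrite sub0r normrN ger0_norm ?fine_ge0// => h.
by exists n.+1%:R.
Qed.

End Tails.

Section Shear.
Context {R : realType} {F : nonArchFieldType R}.

Definition shear n (p q : 'I_n) (t : F) : 'M[F]_n := 1%:M + t *: delta_mx p q.

Lemma GLO_shear n (p q : 'I_n) t : p != q -> absv t <= 1 ->
  GLO (shear p q t) (shear p q (- t)).
Proof.
move=> pq t1; have sh1 s : absv s <= 1 -> mxle 1 (shear p q s).
  move=> s1; apply: mxleD; first exact: mxle1.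
  move=> i j; rewrite !mxE absvM mulr_ile1 ?absv_ge0//.
  by case: (_ && _); rewrite ?absv1 ?absv0.
have shM s s' : shear p q s *m shear p q s' = shear p q (s + s').
  rewrite /shear mulmxDl mul1mx mulmxDr mulmx1 -scalemxAl -scalemxAr mul_delta_mx_0 1?eq_sym//.
  by rewrite !scaler0 addr0 scalerDl addrA addrAC.
split; [exact: sh1|by apply: sh1; rewrite absvN| |]; rewrite shM ?subrr ?addNr /shear;
  by rewrite scale0r addr0.
Qed.

Lemma shear_mull n (p q : 'I_n) t m (Y : 'M[F]_(n, m)) i j :
  (shear p q t *m Y) i j = Y i j + (i == p)%:R * t * Y q j.
Proof.
rewrite /shear mulmxDl mul1mx mxE -scalemxAl mxE; congr (_ + _).
rewrite mxE (bigD1 q)//= big1 ?addr0 => [|k kq]; last first.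
  by rewrite mxE (negPf kq) andbF mul0r.
by rewrite mxE eqxx andbT mulrA [t * _]mulrC.
Qed.

Lemma shear_mulr n (p q : 'I_n) t m (Y : 'M[F]_(m, n)) i j :
  (Y *m shear p q t) i j = Y i j + (j == q)%:R * t * Y i p.
Proof.
rewrite /shear mulmxDr mulmx1 mxE -scalemxAr mxE; congr (_ + _).
rewrite mxE (bigD1 p)//= big1 ?addr0 => [|k kp]; last first.
  by rewrite mxE (negPf kp) mulr0.
by rewrite mxE eqxx/= mulrA mulrC mulrA mulrC [_ * t]mulrC mulrA.
Qed.

End Shear.

Section ExtensionInvariant.
Context {R : realType} {F : nonArchFieldType R}
  (F_nondiscrete : ~ (forall A : set F, open A))
  (F_locally_compact : locally_compact [set: F]).
Context (nu : Pinv R (skew_act F)) (m : cyl_content F).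
Hypothesis m_inv : forall g A, cyl A -> tc m (mat_act F g @^-1` A) = tc m A.
Hypothesis m_tau : forall A : set (infmx F), cyl A ->
  tc m (infmx_tau @^-1` A) = Pr (repr_prob (set_val nu)) (skew_val @^-1` A).

Lemma skew_coord_measurable ij r : 0 < r ->
  measurable ([set A | r < absv (skew_val A ij)] : set (borel (skew_infmx F))).
Proof.
move=> r0; exact: (preimage_cyl_measurable skew_val_continuous (cyl_tail ij r0)).
Qed.

(* Adding row [i] to the large row [a] changes the entry [(a, j)] of
   [X - X^T] by [X i j]. *)
Lemma tau_content_tight ij e : 0 < e ->
  exists2 r, 0 < r & tc m [set X | r < absv (X ij)] <= e.
Proof.
case: ij => i j e0; pose a := (maxn i j).+1; pose n := a.+1.
have ia : (i < a)%N by rewrite ltnS leq_maxl.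
have ja : (j < a)%N by rewrite ltnS leq_maxr.
have [r r0 rP] := @Pr_tail_small _ _ _ (repr_prob (set_val nu))
  (fun A => absv (skew_val A (a, j))) _ (skew_coord_measurable (a, j))
  (divr_gt0 e0 (ltr0n _ 2)).
exists r => //; pose B := [set X : infmx F | r < absv (X (a, j))].
have cB : cyl B by exact: cyl_tail.
have cT : cyl (infmx_tau @^-1` B) := cyl_tau cB.
have in' : (i < n)%N := ltnW ia.
have jn' : (j < n)%N := ltnW ja.
pose oa : 'I_n := Ordinal (ltnSn a); pose oi := Ordinal in'; pose oj := Ordinal jn'.
have oai : oa != oi by rewrite -val_eqE/= gtn_eqF.
have a1 : absv (1 : F) <= 1 by rewrite absv1.
have [g gE] := mat_act_corner (GLO_shear oai a1) (GLO1 n).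
have gX (k l : 'I_n) X : mat_act F g X (k : nat, l : nat) =
    X (k : nat, l : nat) + (k == oa)%:R * X (i, l : nat).
  have := congr1 (fun M : 'M[F]_n => M k l) (gE X).
  by rewrite mulmx1 mxE => ->; rewrite shear_mull !mxE mulr1.
have mB : tc m (infmx_tau @^-1` B) <= e / 2%:R by rewrite m_tau.
have cS : cyl (mat_act F g @^-1` (infmx_tau @^-1` B)) := cyl_mat_act g cT.
have mS : tc m (mat_act F g @^-1` (infmx_tau @^-1` B)) <= e / 2%:R by rewrite m_inv.
have -> : e = e / 2%:R + e / 2%:R by lra.
apply: le_trans (lerD mB mS); apply: le_trans (tc_leU m cT cS).
apply: le_tc; [exact: cyl_tail|exact: cyl_setU|].
have ga X : mat_act F g X (a, j) = X (a, j) + X (i, j).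
  by have := gX oa oj X; rewrite eqxx mul1r.
have gj X : mat_act F g X (j, a) = X (j, a).
  by have := gX oj oa X; rewrite -val_eqE/= ltn_eqF// mul0r addr0.
move=> X rX; apply: contrapT => /not_orP[h1 h2].
have {}h1 : absv (X (a, j) - X (j, a)) <= r by rewrite leNgt; exact/negP.
have {}h2 : absv (X (a, j) + X (i, j) - X (j, a)) <= r.
  by rewrite leNgt -ga -gj; exact/negP.
have : absv (X (i, j)) <= r.
  by have := absvB_le h2 h1; rewrite (_ : _ - _ = X (i, j))//; ring.
by rewrite leNgt; move/negP.
Qed.

Lemma extension_Pinv : exists2 mu : Pinv R (mat_act F), tau_star mu = nu &
  forall A, cyl A -> Pr (repr_prob (set_val mu)) A = tc m A.
Proof.
have [P PE] := tight_content_extension F_nondiscrete F_locally_compact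
  (Build_tight_content tau_content_tight).
have Pbi : bi_invariant P.
  by move=> g A cA; rewrite !PE ?m_inv//; exact: cyl_mat_act.
have imu : Defs.invariant (mat_act F) (borel_class P).
  apply/invariantP => g A mA; rewrite !borel_classK//.
    exact: bi_invariant_measurable.
  exact: mat_act_measurable.
exists (exist _ (borel_class P) (mem_set imu) : Pinv R (mat_act F)).
  apply: val_inj; apply: borel_prob_ext; apply: probability_skew_ext => A cA.
  have mA : measurable (skew_val @^-1` A : set (borel (skew_infmx F))).
    exact: (preimage_cyl_measurable skew_val_continuous cA).
  rewrite borel_pushE// borel_classK; last first.
    by apply: cyl_measurable; exact: (cyl_tau cA).
  by rewrite (PE _ (cyl_tau cA))/= m_tau// -PrE.
by move=> A cA; rewrite /Pr/= borel_classK ?PE//; exact: cyl_measurable.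
Qed.

End ExtensionInvariant.

(** * Characters *)

Section PartialCharacters.
Context {R : realType} {F : nonArchFieldType R}.
Implicit Types G : set (F * R).

(* The graph, modulo the integers, of a homomorphism from a subgroup of [F]
   containing the ring of integers to [R / Z], trivial on the ring of integers. *)
Definition partial_character G := [/\
  forall y, absv y <= 1 -> G (y, 0),
  forall k : int, G (0, k%:~R),
  forall x y r s, G (x, r) -> G (y, s) -> G (x - y, r - s) &
  forall r, G (0, r) -> exists k : int, r = k%:~R].

Lemma partial_characterD G x y r s : partial_character G ->
  G (x, r) -> G (y, s) -> G (x + y, r + s).
Proof.
move=> [_ Gz GB _] Gx Gy; have G0 := Gz 0; rewrite mulr0z in G0.
by have := GB _ _ _ _ Gx (GB _ _ _ _ G0 Gy); rewrite !sub0r !opprK.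
Qed.

Lemma partial_characterMz G x r (k : int) : partial_character G ->
  G (x, r) -> G (x *~ k, r *~ k).
Proof.
move=> vG Gx; have [_ Gz GB _] := vG; have G0 := Gz 0; rewrite mulr0z in G0.
have Gn (n : nat) : G (x *+ n, r *+ n).
  elim: n => [|n IH]; first by rewrite !mulr0n.
  by rewrite !mulrS; exact: partial_characterD.
case: k => n; first exact: Gn.
by have := GB _ _ _ _ G0 (Gn n.+1); rewrite !sub0r NegzE !mulrNz.
Qed.

Lemma partial_character_extend G x : partial_character G -> (forall r, ~ G (x, r)) ->
  exists G' r, [/\ partial_character G', G `<=` G', G' (x, r) &
    forall k : int, r != k%:~R].
Proof.
move=> vG nGx; have [Go Gz GB G0] := vG.
suff [r rZ rP] : exists2 r, (forall k : int, r != k%:~R) &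
    forall (k : int) t, G (- (x *~ k), t) -> exists l : int, t + r *~ k = l%:~R.
  exists [set p | exists y t (k : int), G (y, t) /\ p = (y + x *~ k, t + r *~ k)], r.
  split=> //.
  - split.
    + by move=> y y1; exists y, 0, 0; rewrite !mulr0z !addr0; split=> //; exact: Go.
    + by move=> k; exists 0, k%:~R, 0; rewrite !mulr0z !addr0; split=> //; exact: Gz.
    + move=> _ _ _ _ [y [t [k [Gy [-> ->]]]]] [z [u [l [Gzu [-> ->]]]]].
      exists (y - z), (t - u), (k - l); split; first exact: GB.
      by rewrite !mulrzBr !opprD addrACA [t + _ + _]addrACA.
    + move=> s [y [t [k [Gy [/eqP]]]]]; rewrite eq_sym addr_eq0 => /eqP yE ->.
      by apply: rP; rewrite -yE.
  - by move=> [y t] Gy; exists y, t, 0; rewrite !mulr0z !addr0.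
  - by exists 0, 0, 1; rewrite !mulr1z !add0r; split=> //; exact: (Gz 0).
pose P n := (0 < n)%N && `[< exists s, G (x *+ n, s) >].
have [exP|nP] := pselect (exists n, P n); last first.
  have half (k : int) : (2%:R^-1 : R) != k%:~R.
    apply/eqP => /(congr1 ( *%R 2%:R)); rewrite mulfV ?pnatr_eq0// => h.
    have : (1%:~R : R) = (2 * k)%:~R by rewrite intrM -h.
    by move/eqP; rewrite eqr_int; lia.
  exists 2%:R^-1 => // k t Gt; suff k0 : k = 0.
    by move: Gt; rewrite k0 !mulr0z oppr0 addr0 => /G0.
  apply: contrapT => k0; apply: nP; exists `|k|%N; rewrite /P absz_gt0; apply/andP.
  split; first exact/eqP.
  apply/asboolP; have Gk := partial_characterMz (- Num.sg k) vG Gt.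
  exists (t *~ - Num.sg k); move: Gk; congr (G (_, _)).
  by rewrite mulNrz mulrNz opprK -mulrzA mulrC -normrEsg -abszE -pmulrn.
have [n /andP[n0 /asboolP[s Gs]] nmin] := ex_minnP exP.
have n1 : (1 < n)%N.
  rewrite ltn_neqAle n0 andbT; apply/eqP => n1; apply: (nGx s).
  by rewrite -n1 mulr1n in Gs.
have nR : (n%:R : R) != 0 by rewrite pnatr_eq0 -lt0n.
have [r [s' [Gs' rs']] rZ] : exists2 r, (exists s', G (x *+ n, s') /\ r *+ n = s') &
    forall k : int, r != k%:~R.
  have [nint|] := pselect (forall k : int, s / n%:R != k%:~R).
    exists (s / n%:R) => //; exists s; split=> //.
    by rewrite -[LHS]mulr_natr mulfVK.
  move=> /existsNP[k /negP/negPn/eqP sk].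
  exists ((s + 1) / n%:R).
    exists (s + 1); split; last by rewrite -[LHS]mulr_natr mulfVK.
    by have := partial_characterD vG Gs (Gz 1); rewrite addr0.
  move=> l; apply/eqP; rewrite mulrDl sk mul1r => /eqP; rewrite -subr_eq0.
  rewrite addrAC -intrB addr_eq0 => /eqP/(congr1 ( *%R n%:R)).
  rewrite mulrN mulfV// => h.
  have : ((n%:Z * (k - l))%:~R : R) = (-1)%:~R by rewrite intrM h mulrN1z.
  move/eqP; rewrite eqr_int => /eqP/(congr1 absz)/eqP.
  by rewrite abszM muln_eq1 => /andP[/eqP n1' _]; move: n1; rewrite -[n]/(absz n) n1'.
exists r => // k t Gt.
have kE := divz_eq k n; set q := (k %/ n)%Z in kE; set k' := (k %% n)%Z in kE.
have n0z : n%:Z != 0 by rewrite eqz_nat -lt0n.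
have k'0 : 0 <= k' by exact: modz_ge0.
have k'n : k' < n by rewrite -[ltRHS]ger0_norm// ltz_mod.
have Gk' : G (- (x *~ k'), t + s' *~ q).
  have := partial_characterD vG Gt (partial_characterMz q vG Gs'); congr (G (_, _)).
  by rewrite {1}kE [x *+ n]pmulrn -mulrzA mulrzDr opprD [q * _]mulrC addrAC addNr add0r.
have k'E : k' = 0.
  apply/eqP/negPn/negP => k'0'; have : P `|k'|%N.
    rewrite /P absz_gt0 k'0'; apply/asboolP; exists (- (t + s' *~ q)).
    have := partial_characterMz (-1) vG Gk'; rewrite !mulrN1z opprK; congr (G (_, _)).
    by rewrite pmulrn abszE ger0_norm.
  by move=> /nmin; lia.
move: Gk'; rewrite k'E mulr0z oppr0 => /G0[l lE]; exists l.
by rewrite -lE {1}kE k'E addr0 -rs' pmulrn -mulrzA mulrC.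
Qed.

Lemma partial_character_int : partial_character
  [set p : F * R | absv p.1 <= 1 /\ exists k : int, p.2 = k%:~R].
Proof.
split.
- by move=> y y1; split=> //; exists 0.
- by move=> k; rewrite /= absv0 ler01; split=> //; exists k.
- move=> x y r s [/= x1 [k ->]] [/= y1 [l ->]]; split; first exact: absvB_le.
  by exists (k - l); rewrite intrB.
- by move=> r [_ []]//= k ->; exists k.
Qed.

Lemma partial_character_total G1 : partial_character G1 ->
  exists G, [/\ partial_character G, G1 `<=` G & forall x, exists r, G (x, r)].
Proof.
move=> vG1; have [] := @Zorn_bigcup _ [set G | partial_character (G1 `|` G)].
  move=> C CP totC; set U := \bigcup_(X in C) X.
  have common p q : (G1 `|` U) p -> (G1 `|` U) q -> exists X,
      [/\ partial_character (G1 `|` X), X `<=` U, (G1 `|` X) p & (G1 `|` X) q].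
    move=> [Gp|[X CX Xp]] [Gq|[Y CY Yq]].
    - by exists set0; rewrite setU0; split.
    - by exists Y; split; [exact: CP|move=> z Yz; exists Y|left|right].
    - by exists X; split; [exact: CP|move=> z Xz; exists X|right|left].
    - have [XY|YX] := totC _ _ CX CY.
        exists Y; split; [exact: CP|move=> z Yz; exists Y|right; exact: XY|right]; exact.
      exists X; split; [exact: CP|move=> z Xz; exists X|right|right; exact: YX]; exact.
  have [Go Gz _ _] := vG1; split.
  - by move=> y y1; left; exact: Go.
  - by move=> k; left; exact: Gz.
  - move=> x y r s Gx Gy; have [X [[_ _ XB _] XU Xx Xy]] := common _ _ Gx Gy.
    by have [|/XU] := XB _ _ _ _ Xx Xy; [left|right].
  - by move=> r Gr; have [X [[_ _ _ X0] _ Xr _]] := common _ _ Gr Gr; exact: X0.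
move=> G [vG Gmax]; exists (G1 `|` G); split; [exact: vG|exact: subsetUl|].
move=> x; apply: contrapT => /forallNP nGx.
have [G' [r [vG' GG' G'x _]]] := partial_character_extend vG nGx.
have G1G' : G1 `<=` G' by move=> p G1p; apply: GG'; left.
apply: (Gmax G'); last by rewrite /= (setUidr G1G').
split; first by move=> p Gp; apply: GG'; right.
by move=> /(_ _ G'x) Gx; apply: (nGx r); right.
Qed.

End PartialCharacters.

(* The real part of an additive character of [F] whose kernel contains the ring
   of integers, but no larger fractional ideal. *)
Definition cosine (R : realType) (F : nonArchFieldType R) (c : F -> R) := [/\
  forall x y, c (x + y) + c (x - y) = 2%:R * c x * c y,
  forall x, `|c x| <= 1,
  forall x y, absv y <= 1 -> c (x + y) = c x,
  c 0 = 1 &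
  forall b, 1 < absv b -> exists2 t, absv t <= 1 & c (t * b) != 1].

Section Cosine.
Context {R : realType} {F : nonArchFieldType R}
  (F_nondiscrete : ~ (forall A : set F, open A))
  (F_locally_compact : locally_compact [set: F]).

Lemma cos2pi_int (r : R) (k : int) : cos ((r + k%:~R) * (pi *+ 2)) = cos (r * (pi *+ 2)).
Proof.
have cosn (s : R) n : cos ((s + n%:R) * (pi *+ 2)) = cos (s * (pi *+ 2)).
  by rewrite mulrDl [n%:R * _]mulr_natl periodicn//; exact: cosD2pi.
case: k => n; first exact: cosn.
by rewrite NegzE -(cosn _ n.+1) mulrNz subrK.
Qed.

Lemma cos2pi_neq1 (r : R) : (forall k : int, r != k%:~R) -> cos (r * (pi *+ 2)) != 1.
Proof.
move=> rZ; pose s := r - (Num.floor r)%:~R.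
have s01 : 0 < s < 1.
  rewrite subr_gt0 lt_neqAle eq_sym rZ Num.Theory.floor_le/= ltrBlDl.
  by have := Num.Theory.floorD1_gt r; rewrite intrD.
have -> : r = s + (Num.floor r)%:~R by rewrite subrK.
rewrite cos2pi_int mulrnAr cos_mulr2n cos2sin2.
have : 0 < sin (s * pi).
  have /andP[s0 s1] := s01; apply: sin_gt0_pi.
  by rewrite mulr_gt0 ?pi_gt0//= -[ltRHS]mul1r ltr_pM2r ?pi_gt0.
move=> s0; have : 0 < sin (s * pi) ^+ 2 by rewrite exprn_gt0.
by move=> h; apply/eqP; lra.
Qed.

Lemma exists_cosine : exists c : F -> R, cosine c.
Proof.
have [p [p0 p1] pmax] := exists_uniformizer F_nondiscrete F_locally_compact.
have Gp r : ~ [set p : F * R | absv p.1 <= 1 /\ exists k : int, p.2 = k%:~R] (p^-1, r).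
  by rewrite /= => -[+ _]; rewrite absvV invf_le1 ?absv_gt0// leNgt p1.
have [G1 [r [vG1 _ G1r rZ]]] := partial_character_extend partial_character_int Gp.
have [G [vG G1G /choice[th thG]]] := partial_character_total vG1.
have [Go Gz GB G0] := vG.
have th_eq x s : G (x, s) -> cos (th x * (pi *+ 2)) = cos (s * (pi *+ 2)).
  move=> Gxs; have := GB _ _ _ _ (thG x) Gxs; rewrite subrr => /G0[k].
  by move=> /eqP; rewrite subr_eq addrC => /eqP ->; exact: cos2pi_int.
exists (fun x => cos (th x * (pi *+ 2))); split.
- move=> x y; rewrite (th_eq _ _ (partial_characterD vG (thG x) (thG y))).
  rewrite (th_eq _ _ (GB _ _ _ _ (thG x) (thG y))) mulrDl mulrBl cosD cosB; ring.
- by move=> x; rewrite ler_norml cos_geN1 cos_le1.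
- move=> x y y1; rewrite (th_eq _ _ (partial_characterD vG (thG x) (Go _ y1))).
  by rewrite addr0.
- by rewrite (th_eq _ _ (Gz 0)) mulr0z mul0r cos0.
- move=> b b1; exists (p^-1 / b).
    rewrite absvM !absvV -invfM invf_le1; last by rewrite mulr_gt0 ?absv_gt0// -absv_gt0 (lt_trans _ b1).
    have b0 : 0 < absv b by rewrite (lt_trans _ b1).
    have := pmax b^-1; rewrite absvV invf_lt1// => /(_ b1).
    by rewrite -ler_pdivrMr// div1r.
  rewrite mulfVK; last by rewrite -absv_gt0 (lt_trans _ b1).
  by rewrite (th_eq _ _ (G1G _ G1r)); exact: cos2pi_neq1.
Qed.

End Cosine.

(** * Injectivity *)

Section ResidueSums.
Context {R : realType} {F : nonArchFieldType R} (e : R) (E : residue_system F e).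

Lemma res_shift (f : F -> R) t0 : e <= 1 -> absv t0 <= 1 ->
  (forall x y, absv x <= 1 -> absv y <= 1 -> absv (x - y) <= e -> f x = f y) ->
  \sum_(t : E) f (res_val t + t0) = \sum_(t : E) f (res_val t).
Proof.
move=> e1 t01 fe; pose s (t : E) := res_cls E (res_val t + t0).
have int t : absv (res_val (t : E) + t0) <= 1 by rewrite absvD_le// res_val_int.
rewrite [RHS](reindex_inj (h := s)) /=.
  by apply: eq_bigr => t _; apply: fe; rewrite ?res_val_int//; exact: res_valP.
move=> t t' st; rewrite -(res_valK t) -(res_valK t'); apply: res_cls_eq.
- exact: res_val_int.
- exact: res_val_int.
- have := absvB_le (res_valP E (int t)) (res_valP E (int t')).
  by rewrite -/(s t) -/(s t') st opprB addrA subrK opprD addrACA subrr addr0.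
Qed.

Lemma cosine_sum (c : F -> R) b : cosine c -> e <= 1 -> absv b * e <= 1 ->
  \sum_(t : E) c (res_val t * b) = if absv b <= 1 then #|E|%:R else 0.
Proof.
move=> [cD c1 cO c0 cN] e1 be; case: ifPn => [b1|].
  rewrite (eq_bigr (fun=> 1)) ?sumr_const// => t _.
  by rewrite -[_ * _]add0r cO ?c0// absvM_le1 ?res_val_int.
rewrite -ltNge => /cN[t0 t01 ct0].
have inv s : absv s <= 1 ->
    \sum_(t : E) c (res_val t * b) = \sum_(t : E) c (res_val t * b + s * b).
  move=> s1; rewrite -(@res_shift (fun x => c (x * b)) s)//.
    by apply: eq_bigr => t _; rewrite mulrDl.
  move=> x y _ _ xy; rewrite -[x](subrK y) mulrDl addrC cO//.
  by rewrite absvM mulrC (le_trans _ be)// ler_wpM2l ?absv_ge0.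
set S := \sum_t _ in inv *.
have : S + S = 2%:R * c (t0 * b) * S.
  rewrite {1}(inv t0)// {1}(inv (- t0)) ?absvN// -big_split/= mulr_sumr.
  by apply: eq_bigr => t _; rewrite mulNr cD mulrAC.
move=> /eqP; rewrite -subr_eq0 (_ : S + S - _ = 2%:R * S * (1 - c (t0 * b))); last by ring.
by rewrite !mulf_eq0 pnatr_eq0/= subr_eq0 [1 == _]eq_sym (negPf ct0) orbF => /eqP.
Qed.

End ResidueSums.

Section CosineKernel.
Context {R : realType} {F : nonArchFieldType R}
  (F_nondiscrete : ~ (forall A : set F, open A))
  (F_locally_compact : locally_compact [set: F]).
Context (c : F -> R) (c_cosine : cosine c).
Context d (T : measurableType d).
Implicit Types (P Q : probability T R) (f g : T -> R) (b : T -> F).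

Definition cosine_measurable b :=
  (forall t, bmeas (fun x => c (t * b x))) /\
  forall r, 0 < r -> measurable [set x | r < absv (b x)].

Lemma bmeas_unit_ball b : cosine_measurable b -> bmeas (fun x => (absv (b x) <= 1)%R%:R : R).
Proof.
move=> [_ mb]; rewrite (_ : (fun x => _) = \1_(~` [set x | 1 < absv (b x)])).
  by apply: bmeas_indic; apply: measurableC; exact: mb.
apply/funext => x; rewrite indicE; congr (nat_of_bool _)%:R.
apply/idP/idP; first by rewrite leNgt => h; rewrite inE /=; exact/negP.
by rewrite inE/= leNgt => /negP.
Qed.

Lemma Ex_cosine_kernel P f b e : cosine_measurable b -> bmeas f ->
  (forall x, `|f x| <= 1) -> 0 < e -> exists2 r0, 0 < r0 &
  forall eta (E : residue_system F eta), 0 < eta <= 1 -> r0 * eta <= 1 ->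
  `|#|E|%:R^-1 * (\sum_(t : E) Ex P (fun x => f x * c (res_val t * b x))) -
    Ex P (fun x => f x * (absv (b x) <= 1)%R%:R)| <= e.
Proof.
move=> cb bf f1 e0; have [cD c1 cO c0 cN] := c_cosine; have [bc mb] := cb.
have [r r0 rP] : exists2 r, 0 < r & Pr P [set x | r < absv (b x)] <= e / 2%:R.
  exact: Pr_tail_small mb (divr_gt0 e0 (ltr0n _ 2)).
exists r => // eta E /andP[eta0 eta1] reta.
have E0 : (#|E|%:R : R) != 0.
  by rewrite pnatr_eq0 -lt0n; apply/card_gt0P; exists (res_cls E 0).
pose K x := #|E|%:R^-1 * \sum_(t : E) c (res_val t * b x).
pose g x : R := (absv (b x) <= 1)%R%:R.
have bg : bmeas g := bmeas_unit_ball cb.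
have K1 x : `|K x| <= 1.
  rewrite normrM ger0_norm ?invr_ge0// ler_pdivrMl; last by rewrite lt_neqAle eq_sym E0 ler0n.
  rewrite mulr1 (le_trans (ler_norm_sum _ _ _))// -[leRHS]mulr1 mulr_natl -sumr_const.
  by apply: ler_sum => t _; exact: c1.
have bK : bmeas K by apply: bmeasZ; apply: bmeas_sum => t _; exact: bc.
have bt (t : E) : bmeas (fun x => f x * c (res_val t * b x)) by apply: bmeasM.
have -> : #|E|%:R^-1 * (\sum_(t : E) Ex P (fun x => f x * c (res_val t * b x))) =
    Ex P (fun x => f x * K x).
  rewrite -Ex_sum => [|t _]; last exact: bt.
  rewrite -ExZ; last by apply: bmeas_sum => t _; exact: bt.
  by apply: eq_Ex => x; rewrite /K [RHS]mulrCA; congr (_ * _); rewrite mulr_sumr.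
rewrite -ExB; [|exact: bmeasM|exact: bmeasM].
pose A : set T := [set x | r < absv (b x)].
have mA : measurable A by exact: mb.
apply: (@le_trans _ _ (Ex P (fun x => 2%:R * \1_A x))).
  apply: normr_Ex_le.
  - by apply: bmeasB; exact: bmeasM.
  - by apply: bmeasZ; exact: bmeas_indic.
  move=> x /=; rewrite -mulrBr normrM indicE.
  have g1 : `|g x| <= 1 by rewrite ger0_norm// lern1 leq_b1.
  have [xA|] := boolP (x \in A).
    rewrite mulr1 (le_trans (ler_wpM2r (normr_ge0 _) (f1 x)))// mul1r.
    by rewrite (le_trans (ler_normB _ _))//; have := lerD (K1 x) g1; lra.
  rewrite notin_setE /A/= => /negP; rewrite -leNgt => br.
  rewrite mulr0 /K /g (cosine_sum E c_cosine)//; last first.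
    by rewrite (le_trans _ reta)// ler_wpM2r// ltW.
  by case: ifPn => _; rewrite ?mulVf// ?mulr0 ?subrr ?normr0 ?mulr0.
rewrite ExZ ?Ex_indic//; last exact: bmeas_indic.
by rewrite -ler_pdivlMl// mulrC.
Qed.

Lemma Ex_unit_ball_eq P Q f g b b' :
  cosine_measurable b -> cosine_measurable b' -> bmeas f -> bmeas g ->
  (forall x, `|f x| <= 1) -> (forall x, `|g x| <= 1) ->
  (forall t, absv t <= 1 ->
    Ex P (fun x => f x * c (t * b x)) = Ex Q (fun x => g x * c (t * b' x))) ->
  Ex P (fun x => f x * (absv (b x) <= 1)%R%:R) =
  Ex Q (fun x => g x * (absv (b' x) <= 1)%R%:R).
Proof.
move=> cb cb' bf bg f1 g1 PQ.
apply/eqP; rewrite -subr_eq0 -normr_le0; apply/ler_addgt0Pr => e e0; rewrite add0r.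
have e2 : 0 < e / 2%:R by rewrite divr_gt0.
have [r r0 rP] := Ex_cosine_kernel P cb bf f1 e2.
have [s s0 sP] := Ex_cosine_kernel Q cb' bg g1 e2.
pose eta := Num.min 1 (Num.min r^-1 s^-1).
have eta0 : 0 < eta by rewrite !lt_min ltr01 !invr_gt0 r0.
have eta1 : eta <= 1 by rewrite ge_min lexx.
have [E] := exists_residue_system F_nondiscrete F_locally_compact eta0 eta1.
have etaI : 0 < eta <= 1 by rewrite eta0.
have re : r * eta <= 1.
  by rewrite -[leRHS](@mulfV _ r) ?gt_eqF// ler_pM2l// !ge_min lexx orbT.
have se : s * eta <= 1.
  by rewrite -[leRHS](@mulfV _ s) ?gt_eqF// ler_pM2l// !ge_min lexx !orbT.
have := rP _ E etaI re; have := sP _ E etaI se.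
rewrite (eq_bigr (fun t : E => Ex P (fun x => f x * c (res_val t * b x)))); last first.
  by move=> t _; rewrite PQ// res_val_int.
set S := _ * _; rewrite !ler_norml => /andP[h1 h2] /andP[h3 h4].
by apply/andP; split; lra.
Qed.

End CosineKernel.

Section CharacteristicFunction.
Context {R : realType} {F : nonArchFieldType R}
  (F_nondiscrete : ~ (forall A : set F, open A))
  (F_locally_compact : locally_compact [set: F]).
Context (c : F -> R) (c_cosine : cosine c).
Context (P : probability (borel (infmx F)) R) (P_inv : bi_invariant P).
Context (n : nat).

Definition test (h : 'M[F]_n -> R) := cyl (h \o corner n) /\ forall Y, `|h Y| <= 1.

Lemma test_bmeas h : test h -> bmeas (h \o corner n : borel (infmx F) -> R).
Proof. by move=> [ch h1]; exact: (@cyl_bmeas R F (h \o corner n) 1 ch (fun X => h1 (corner n X))). Qed.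

Lemma testM h k : test h -> test k -> test (fun Y => h Y * k Y).
Proof.
move=> [ch h1] [ck k1]; split; first exact: (cyl_comp2 *%R ch ck).
by move=> Y; rewrite normrM mulr_ile1.
Qed.

Lemma test1 : test (fun=> 1).
Proof. by split; [exact: cyl_cst|move=> Y; rewrite normr1]. Qed.

Lemma test_prod I (r : seq I) (h : I -> 'M[F]_n -> R) : (forall i, test (h i)) ->
  test (fun Y => \prod_(i <- r) h i Y).
Proof.
move=> th; elim: r => [|i r IH]; first by under eq_fun do rewrite big_nil; exact: test1.
by under eq_fun do rewrite big_cons; exact: testM.
Qed.

Lemma cyl_event y (k l : 'I_n) : cyl (fun X : infmx F => absv (y * corner n X k l) <= 1).
Proof.
have := cyl_affine_le (k : nat, l : nat) y 0 (@ltr01 R).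
by congr cyl; apply/funext => X; rewrite mxE addr0.
Qed.

Lemma cyl_forallb (I : finType) (q : I -> infmx F -> bool) : (forall i, cyl (q i)) ->
  cyl (fun X => [forall i, q i X]).
Proof.
move=> cq; rewrite (_ : (fun X => _) = (fun X => \big[andb/true]_i q i X)).
  by apply: cyl_big => i _; exact: cq.
by apply/funext => X; rewrite big_andE; apply: eq_forallb => i.
Qed.

Lemma test_bool (q : 'M[F]_n -> bool) : cyl (q \o corner n) -> test (fun Y => (q Y)%:R).
Proof.
move=> cq; split; first exact: (cyl_comp (fun b : bool => b%:R) cq).
by move=> Y; case: (q Y); rewrite ?normr1 ?normr0.
Qed.

Definition lin (J : finType) (y : J -> F) (rho kap : J -> 'I_n) (Y : 'M[F]_n) : F :=
  \sum_i y i * Y (rho i) (kap i).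

Lemma test_lin_shift (J : finType) (y : J -> F) rho kap a : test (fun Y => c (lin y rho kap Y + a)).
Proof.
have [_ c1 cO _ _] := c_cosine; split=> [|Y]; last exact: c1.
pose M := \sum_i absv (y i) + 1.
have M0 : 0 < M by rewrite ltr_pwDr// sumr_ge0// => i _; exact: absv_ge0.
have M1 : 0 < M^-1 by rewrite invr_gt0.
apply: (@cyl_corner _ _ _ n (fun Y => c (lin y rho kap Y + a)) M^-1 M1) => A B AB.
have -> : lin y rho kap A + a = lin y rho kap B + a + (lin y rho kap A - lin y rho kap B) by ring.
rewrite cO// /lin -sumrB; apply: absv_sum_le => // i _.
rewrite -mulrBr absvM; have := AB (rho i) (kap i); rewrite !mxE => ABi.
rewrite (le_trans (ler_wpM2l (absv_ge0 _) ABi))// ler_pdivrMr// mul1r.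
rewrite /M (bigD1 i)//= -addrA lerDl addr_ge0// sumr_ge0// => k _; exact: absv_ge0.
Qed.

Lemma test_lin (J : finType) (y : J -> F) rho kap : test (c \o lin y rho kap).
Proof. by have := test_lin_shift y rho kap 0; under eq_fun do rewrite addr0. Qed.

Lemma test_coord t y (k l : 'I_n) : test (fun Y => c (t * (y * Y k l))).
Proof.
rewrite (_ : (fun Y => _) = c \o lin (fun _ : unit => t * y) (fun=> k) (fun=> l)).
  exact: test_lin.
by apply/funext => Y; rewrite /= /lin (big_pred1 tt) ?mulrA// => -[].
Qed.

Lemma coord_tail_measurable y (k l : 'I_n) r : 0 < r ->
  cyl [set X : infmx F | r < absv (y * corner n X k l)].
Proof.
move=> /(cyl_affine_gt (k : nat, l : nat) y 0).
by congr cyl; apply/funext => X /=; rewrite mxE addr0.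
Qed.

Lemma Ex_test_shear h p q t : test h -> p != q -> absv t <= 1 ->
  Ex P ((fun Y => h (Y *m shear p q t)) \o corner n) = Ex P (h \o corner n).
Proof.
move=> [ch h1] pq t1; rewrite -(Ex_corner P_inv ch h1 (GLO1 n) (GLO_shear pq t1)).
by apply: eq_Ex => X /=; rewrite mul1mx.
Qed.

Lemma test_shear h p q t : test h -> p != q -> absv t <= 1 ->
  test (fun Y => h (Y *m shear p q t)).
Proof.
move=> [ch h1] pq t1; split=> [|Y]; last exact: h1.
have [g gE] := mat_act_corner (GLO1 n) (GLO_shear pq t1).
rewrite (_ : _ \o _ = (h \o corner n) \o mat_act F g); first exact: cyl_mat_act.
by apply/funext => X /=; rewrite gE mul1mx.
Qed.

Context (J : finType) (y : J -> F) (rho kap : J -> 'I_n).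
Context (L : {set 'I_n}) (kap_inj : injective kap) (kapL : forall i, kap i \notin L).

Definition on_columns (h : 'M[F]_n -> R) :=
  forall Y Z : 'M[F]_n, (forall k l, l \in L -> Y k l = Z k l) -> h Y = h Z.

Lemma lin_shear i l t Y : l \in L ->
  lin y rho kap (Y *m shear l (kap i) t) = lin y rho kap Y + t * (y i * Y (rho i) l).
Proof.
move=> lL; rewrite /lin; under eq_bigr do rewrite shear_mulr mulrDr.
rewrite big_split/=; congr (_ + _); rewrite (bigD1 i)//= big1 ?addr0 => [|k ki].
  by rewrite eqxx mul1r mulrCA.
by rewrite (inj_eq kap_inj) (negPf ki) !mul0r mulr0.
Qed.

(* Adding [t] times column [l] to column [kap i] adds [t * (y i * Y (rho i) l)] to
   [lin Y]; averaging over the integral [t] kills the characters for which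
   [y i * Y (rho i) l] is not integral. *)
Lemma Ex_column_event h i l : test h -> on_columns h -> l \in L ->
  Ex P ((fun Y => c (lin y rho kap Y) * h Y) \o corner n) =
  Ex P ((fun Y => c (lin y rho kap Y) * (h Y * (absv (y i * Y (rho i) l) <= 1)%R%:R)) \o corner n).
Proof.
move=> th hL lL; have [cD c1 cO c0 cN] := c_cosine.
have pq : l != kap i by apply: contraTneq lL => ->; exact: kapL.
pose b (Y : 'M[F]_n) := y i * Y (rho i) l.
pose f (Y : 'M[F]_n) := c (lin y rho kap Y) * h Y.
have tf : test f by apply: testM => //; exact: test_lin.
have tb t : test (fun Y => c (t * b Y)) by exact: test_coord.
have bT h' : test h' -> bmeas (h' \o corner n : borel (infmx F) -> R) := @test_bmeas h'.
have shf t Y : f (Y *m shear l (kap i) t) = c (lin y rho kap Y + t * b Y) * h Y.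
  rewrite /f lin_shear//; congr (_ * _); apply: hL => k l' l'L.
  rewrite shear_mulr (_ : l' == _ = false) ?mul0r ?addr0//.
  by apply: contraTF l'L => /eqP ->; exact: kapL.
have Ecos t : absv t <= 1 ->
    Ex P ((fun Y => f Y * c (t * b Y)) \o corner n) = Ex P (f \o corner n).
  move=> t1; have t1' : absv (- t) <= 1 by rewrite absvN.
  have : Ex P ((fun Y => f (Y *m shear l (kap i) t)) \o corner n) +
      Ex P ((fun Y => f (Y *m shear l (kap i) (- t))) \o corner n) =
      2%:R * Ex P (f \o corner n).
    by rewrite !Ex_test_shear// mulr_natl.
  rewrite -ExD; [|exact/bT/test_shear|exact/bT/test_shear].
  rewrite (@eq_Ex _ _ _ _ _ (fun X : borel (infmx F) => 2%:R * ((fun Y => f Y * c (t * b Y)) \o corner n) X)).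
    rewrite ExZ; last exact/bT/testM.
    by apply: mulfI; rewrite pnatr_eq0.
  by move=> X /=; rewrite !shf mulNr -mulrDl cD /f; ring.
pose g (Y : 'M[F]_n) : R := (absv (b Y) <= 1)%R%:R.
have tg : test g by apply: test_bool; exact: cyl_event.
rewrite [RHS](_ : _ = Ex P ((fun Y => f Y * g Y) \o corner n)); last first.
  by apply: eq_Ex => X; rewrite /= /f mulrA.
have cb : cosine_measurable c (fun X : borel (infmx F) => b (corner n X)).
  by split=> [t|r r0]; [exact: bT _ (tb t)|apply: cyl_measurable; exact: coord_tail_measurable].
have c00 : cosine_measurable c (fun _ : borel (infmx F) => 0).
  split=> [t|r r0]; first by under eq_fun do rewrite mulr0; exact: bmeas_cst.
  rewrite (_ : [set _ | _] = set0)//; apply/seteqP; split=> // X /=.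
  by rewrite absv0 ltNge ltW.
have := Ex_unit_ball_eq F_nondiscrete F_locally_compact c_cosine cb c00 (bT _ tf) (bT _ tf)
  (fun X => tf.2 (corner n X)) (fun X => tf.2 (corner n X)).
move=> /(_ P P) ->; last first.
  by move=> t t1; rewrite (Ecos t t1); apply: eq_Ex => X; rewrite mulr0 c0 mulr1.
by apply: eq_Ex => X; rewrite absv0 ler01 mulr1.
Qed.

Definition evt (Y : 'M[F]_n) : bool :=
  [forall i, forall l in L, absv (y i * Y (rho i) l) <= 1].

Lemma cyl_evt : cyl (evt \o corner n).
Proof.
apply: (@cyl_forallb J (fun i X => [forall l in L, absv (y i * corner n X (rho i) l) <= 1])) => i.
apply: (@cyl_forallb 'I_n (fun l X => (l \in L) ==> (absv (y i * corner n X (rho i) l) <= 1))) => l.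
exact: (cyl_comp (fun b => (l \in L) ==> b) (cyl_event _ _ _)).
Qed.

Let clin : 'M[F]_n -> R := c \o lin y rho kap.

Lemma Ex_lin_evt :
  Ex P (clin \o corner n) = Ex P ((fun Y => clin Y * (evt Y)%:R) \o corner n).
Proof.
pose ev (p : J * 'I_n) (Y : 'M[F]_n) : R := (absv (y p.1 * Y (rho p.1) p.2) <= 1)%R%:R.
pose s := [seq p <- enum {: J * 'I_n} | p.2 \in L].
have sE Y : (evt Y)%:R = \prod_(p <- s) ev p Y.
  have [/forallP h|/forallPn[i /forallPn[l]]] := boolP (evt Y).
    rewrite big_seq big1// => -[i l]; rewrite mem_filter /= => /andP[lL _].
    by have /forallP/(_ l) := h i; rewrite lL /ev/= => ->.
  rewrite negb_imply => /andP[lL nil].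
  have ils : (i, l) \in s by rewrite mem_filter/= lL mem_enum.
  by rewrite (big_rem _ ils)/= /ev/= (negPf nil) mul0r.
have sL : all (fun p => p.2 \in L) s by exact: filter_all.
rewrite [RHS](@eq_Ex _ _ _ _ _
  (fun X : borel (infmx F) => clin (corner n X) * \prod_(p <- s) ev p (corner n X))); last first.
  by move=> X /=; rewrite sE.
elim: s sL {sE} => [_|[i l] s IH /andP[/= lL sL]].
  by apply: eq_Ex => X; rewrite big_nil mulr1.
rewrite (IH sL).
have th : test (fun Y => \prod_(p <- s) ev p Y).
  by apply: test_prod => p; apply: test_bool; exact: cyl_event.
have hL : on_columns (fun Y => \prod_(p <- s) ev p Y).
  move=> Y Z YZ; rewrite !big_seq; apply: eq_bigr => p ps.
  by rewrite /ev YZ//; exact: (allP sL).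
rewrite [LHS](Ex_column_event i th hL lL); apply: eq_Ex => X /=.
by rewrite big_cons [X in _ * X]mulrC.
Qed.

Hypothesis L0 : (0 < #|L|)%N.

Let good i l (Y : 'M[F]_n) := absv (y i * Y (rho i) l) <= 1.
Let bad i (Y : 'M[F]_n) := [forall l in L, good i l Y] && ~~ good i (kap i) Y.

Let cyl_bad i : cyl (bad i \o corner n).
Proof.
apply: (cyl_comp2 andb); last exact: (cyl_comp negb (cyl_event _ _ _)).
apply: (@cyl_forallb 'I_n (fun l X => (l \in L) ==> good i l (corner n X))) => l.
exact: (cyl_comp (fun b => (l \in L) ==> b) (cyl_event _ _ _)).
Qed.

(* If column [kap i] violated a bound satisfied by all columns of [L], adding it
   to each of the columns of [L] in turn would produce #|L| disjoint events of
   the same probability. *)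
Lemma Ex_bad_le i : Ex P ((fun Y => (bad i Y)%:R) \o corner n) <= #|L|%:R^-1 :> R.
Proof.
pose one l0 (Y : 'M[F]_n) := [forall l in L, (l != l0) ==> good i l Y] && ~~ good i l0 Y.
have cyl_one l0 : cyl (one l0 \o corner n).
  apply: (cyl_comp2 andb); last exact: (cyl_comp negb (cyl_event _ _ _)).
  apply: (@cyl_forallb 'I_n (fun l X => (l \in L) ==> ((l != l0) ==> good i l (corner n X)))) => l.
  exact: (cyl_comp (fun b => (l \in L) ==> ((l != l0) ==> b)) (cyl_event _ _ _)).
have tb : test (fun Y => (bad i Y)%:R) by exact: test_bool.
have to l : test (fun Y => (one l Y)%:R) by exact: test_bool.
have le_one l0 : l0 \in L -> Ex P ((fun Y => (bad i Y)%:R) \o corner n) <=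
    Ex P ((fun Y => (one l0 Y)%:R) \o corner n).
  move=> l0L; have kl0 : kap i != l0 by apply: contraTneq l0L => <-; exact: kapL.
  have a1 : absv (1 : F) <= 1 by rewrite absv1.
  rewrite -(Ex_test_shear tb kl0 a1); apply: le_Ex.
  - exact: (test_bmeas (test_shear tb kl0 a1)).
  - exact: test_bmeas.
  move=> X /=; set Y := corner n X; rewrite ler_nat.
  have [/andP[/forallP hb nk]|//] := boolP (bad i (Y *m _)).
  rewrite lt0n eqb0 negbK; apply/andP; split.
    apply/forallP => l; apply/implyP => lL; apply/implyP => ll0.
    by have := hb l; rewrite lL/= /good shear_mulr (negPf ll0) !mul0r addr0.
  apply: contra nk => gl0; have := hb l0; rewrite l0L/= /good !shear_mulr eqxx.
  rewrite (negPf kl0) !mul0r !mul1r addr0 mulrDr => h.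
  by rewrite -[y i * _](addKr (y i * Y (rho i) l0)) addrC absvB_le.
rewrite -[leRHS]mul1r ler_pdivlMr ?ltr0n// mulr_natr -sumr_const.
apply: le_trans (_ : \sum_(l in L) Ex P ((fun Y => (one l Y)%:R) \o corner n) <= _).
  by apply: ler_sum => l lL; exact: le_one.
rewrite -Ex_sum => [|l _]; last exact: test_bmeas.
rewrite -[leRHS](Ex_cst P 1); apply: le_Ex; [|exact: bmeas_cst|].
  by apply: bmeas_sum => l _; exact: (test_bmeas (to l)).
move=> X /=; set Y := corner n X.
have [/existsP[l1 /andP[l1L o1]]|] := boolP [exists l in L, one l Y].
  rewrite (bigD1 l1)//= o1 big1 ?addr0// => l /andP[lL ll1].
  suff -> : one l Y = false by [].
  apply/negP => /andP[/forallP/(_ l1)]; rewrite l1L eq_sym ll1/= => g1 _.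
  by have /andP[_] := o1; rewrite g1.
rewrite negb_exists => /forallP no; rewrite big1 ?ler01// => l lL.
by have := no l; rewrite lL/= => /negPf ->.
Qed.

Lemma Ex_lin_approx :
  `|Ex P (clin \o corner n) - Ex P ((fun Y => (evt Y)%:R) \o corner n)| <=
  2%:R * #|J|%:R / #|L|%:R.
Proof.
have [_ c1 cO c0 _] := c_cosine.
have te : test (fun Y => (evt Y)%:R) by apply: test_bool; exact: cyl_evt.
have tl : test clin by exact: test_lin.
have tb i : test (fun Y => (bad i Y)%:R) by exact: test_bool.
rewrite Ex_lin_evt -ExB; [|exact/test_bmeas/testM|exact: test_bmeas].
apply: (@le_trans _ _ (Ex P (fun X : borel (infmx F) =>
    \sum_i 2%:R * ((fun Y => (bad i Y)%:R) \o corner n) X))).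
  apply: normr_Ex_le.
  - by apply: bmeasB; [exact/test_bmeas/testM|exact: test_bmeas].
  - by apply: bmeas_sum => i _; apply: bmeasZ; exact: test_bmeas.
  move=> X /=; set Y := corner n X; rewrite -[X in _ - X]mul1r -mulrBl.
  have [eY|_] := boolP (evt Y); last first.
    by rewrite mulr0 normr0 sumr_ge0// => i _; rewrite mulr_ge0.
  rewrite mulr1; have [/forallP gk|/forallPn[i nk]] := boolP [forall i, good i (kap i) Y].
    rewrite /clin/= -[lin _ _ _ _]add0r cO ?c0 ?subrr ?normr0.
      by rewrite sumr_ge0// => i _; rewrite mulr_ge0.
    by apply: absv_sum_le => // i _; exact: gk.
  rewrite (bigD1 i)//= (_ : bad i Y = true); last first.
    by rewrite /bad nk andbT; have /forallP := eY; exact.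
  rewrite mulr1 (le_trans (ler_normB _ _))// normr1.
  apply: (@le_trans _ _ 2%:R); first by have := c1 (lin y rho kap Y); rewrite /clin/=; lra.
  by rewrite lerDl sumr_ge0// => k _; rewrite mulr_ge0.
rewrite Ex_sum => [|i _]; last by apply: bmeasZ; exact: test_bmeas.
apply: (@le_trans _ _ (\sum_(i : J) 2%:R * #|L|%:R^-1)).
  apply: ler_sum => i _; rewrite ExZ; last exact: test_bmeas.
  by rewrite ler_pM2l ?ltr0n// Ex_bad_le.
by rewrite sumr_const -[leLHS]mulr_natl mulrA [_ * 2%:R]mulrC.
Qed.

End CharacteristicFunction.

Lemma perm_extend (J T : finType) (f g : J -> T) : injective f -> injective g ->
  exists s : {perm T}, forall i, s (f i) = g i.
Proof.
move=> fi gi; suff [s sP] : exists s : {perm T}, forall i, i \in enum J -> s (f i) = g i.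
  by exists s => i; rewrite sP// mem_enum.
elim: (enum J) (enum_uniq J) => [_|i r IH /= /andP[ir ur]]; first by exists 1%g.
have [s sP] := IH ur; exists (s * tperm (s (f i)) (g i))%g => j.
rewrite inE permM => /predU1P[->|jr]; first by rewrite tpermL.
have ij : j != i by apply: contraNneq ir => <-.
rewrite (sP _ jr) tpermD//; last by rewrite (inj_eq gi) eq_sym.
by rewrite -(sP _ jr) (inj_eq perm_inj) (inj_eq fi) eq_sym.
Qed.

Section SqrtApproximation.
Context {R : realType}.

Fixpoint sqrt_poly (n : nat) : {poly R} :=
  if n is m.+1 then sqrt_poly m + 2%:R^-1 *: ('X - sqrt_poly m ^+ 2) else 0.

Lemma bernoulli_inv (x : R) n : 0 <= x <= 1 -> (1 - x) ^+ n * (1 + n%:R * x) <= 1.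
Proof.
move=> /andP[x0 x1]; elim: n => [|n IH]; first by rewrite expr0 mul0r addr0 mulr1.
apply: le_trans IH; rewrite exprSr -mulrA ler_wpM2l ?exprn_ge0 ?subr_ge0//.
by rewrite -natr1; have : 0 <= n%:R * x * x; [rewrite !mulr_ge0|nra].
Qed.

Lemma sqrt_polyP (t : R) n : 0 <= t <= 1 ->
  0 <= (sqrt_poly n).[t ^+ 2] <= t /\ t - (sqrt_poly n).[t ^+ 2] <= (1 - t / 2%:R) ^+ n * t.
Proof.
move=> /andP[t0 t1]; elim: n => [|n [/andP[q0 qt] qn]].
  by rewrite /= horner0 lexx t0 subr0 expr0 mul1r.
rewrite /= !hornerE; set q := (sqrt_poly n).[t ^+ 2] in q0 qt qn *.
have E : t - (q + 2%:R^-1 * (t ^+ 2 - q ^+ 2)) = (t - q) * (1 - (t + q) / 2%:R) by field.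
have f0 : 0 <= 1 - (t + q) / 2%:R by lra.
split; last first.
  rewrite E exprSr mulrAC; apply: ler_pM => //; first by rewrite subr_ge0.
  by lra.
apply/andP; split.
  by rewrite addr_ge0// mulr_ge0// ?invr_ge0// subr_ge0 lerXn2r.
by rewrite -subr_ge0 E mulr_ge0// subr_ge0.
Qed.

Lemma even_polynomial_approx (e : R) : 0 < e ->
  exists q : {poly R}, forall t, 0 <= t <= 1 -> `|t - q.[t ^+ 2]| <= e.
Proof.
move=> e0; pose n := Num.bound (2%:R / e).
have ne : 2%:R <= n%:R * e.
  by rewrite -ler_pdivrMr// ltW// archi_boundP// divr_ge0// ltW.
exists (sqrt_poly n) => t t01; have [/andP[q0 qt] qn] := sqrt_polyP n t01.
have /andP[t0 t1] := t01; rewrite ger0_norm ?subr_ge0// (le_trans qn)//.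
have h : 0 <= t / 2%:R <= 1 by lra.
have := bernoulli_inv n h; set a := (1 - _) ^+ n => an.
have a0 : 0 <= a by rewrite exprn_ge0//; lra.
have n0 : 0 < n%:R :> R.
  by rewrite ltr0n lt0n; apply/eqP => n0; move: ne; rewrite n0 mul0r; lra.
rewrite -(ler_pM2l n0); apply: le_trans ne.
by move: an; rewrite mulrDr mulr1; nra.
Qed.

End SqrtApproximation.

Lemma ffact_ratio (R : realType) k N : (0 < N)%N ->
  1 - k%:R ^+ 2 / N%:R <= (N ^_ k)%:R / N%:R ^+ k :> R /\
  (N ^_ k)%:R / N%:R ^+ k <= 1 :> R.
Proof.
move=> N0; have N0' : 0 < N%:R :> R by rewrite ltr0n.
elim: k => [|k [IH1 IH2]]; first by rewrite ffactn0 expr0 expr0n mul0r subr0 divr1.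
have -> : (N ^_ k.+1)%:R / N%:R ^+ k.+1 = (N ^_ k)%:R / N%:R ^+ k * ((N - k)%:R / N%:R) :> R.
  by rewrite ffactnSr natrM exprSr invfM mulrACA.
set a := _ / _ ^+ k in IH1 IH2 *; have a0 : 0 <= a by rewrite divr_ge0 ?exprn_ge0.
have r1 : (N - k)%:R / N%:R <= 1 :> R by rewrite ler_pdivrMr// mul1r ler_nat leq_subr.
have r0 : 0 <= (N - k)%:R / N%:R :> R by rewrite divr_ge0.
have rk : 1 - k%:R / N%:R <= (N - k)%:R / N%:R :> R.
  have [kN|Nk] := leqP k N; first by rewrite natrB// mulrBl divff ?gt_eqF.
  by rewrite (le_trans _ r0)// subr_le0 ler_pdivlMr// mul1r ler_nat ltnW.
split; last by rewrite mulr_ile1.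
have k0 : 0 <= k%:R / N%:R :> R by rewrite divr_ge0.
have kk : k%:R / N%:R + k%:R ^+ 2 / N%:R <= k.+1%:R ^+ 2 / N%:R :> R.
  rewrite -mulrDl ler_pM2r ?invr_gt0// -natr1 sqrrD1.
  by rewrite addrC -addrA lerD2l; have : 0 <= k%:R :> R by []; lra.
by nra.
Qed.

Section CornerCharacter.
Context {R : realType} {F : nonArchFieldType R}
  (F_nondiscrete : ~ (forall A : set F, open A))
  (F_locally_compact : locally_compact [set: F]).
Context (c : F -> R) (c_cosine : cosine c).
Implicit Types P : probability (borel (infmx F)) R.

Definition chi (J : finType) (y : J -> F) (rho kap : J -> nat) (X : infmx F) : R :=
  c (\sum_i y i * X (rho i, kap i)).

Definition rank (J : finType) (i : J) : nat := enum_rank i.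

Lemma rank_inj (J : finType) : injective (@rank J).
Proof. by move=> i j /val_inj/enum_rank_inj. Qed.

Definition phi P (J : finType) (y : J -> F) := Ex P (chi y (@rank J) (@rank J)).

Lemma chi_corner (J : finType) (y : J -> F) (rho kap : J -> nat) n (rho' kap' : J -> 'I_n) :
  (forall i, rho i = rho' i) -> (forall i, kap i = kap' i) ->
  chi y rho kap = (c \o lin y rho' kap') \o corner n.
Proof.
move=> rE kE; apply/funext => X; rewrite /chi /lin/=; congr c.
by apply: eq_bigr => i _; rewrite mxE rE kE.
Qed.

Lemma ord_lift (J : finType) (f : J -> nat) n : injective f -> (forall i, (f i < n)%N) ->
  exists2 g : J -> 'I_n, injective g & forall i, f i = g i.
Proof.
move=> fi fn; exists (fun i => Ordinal (fn i)) => // i j /(congr1 val)/=.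
exact: fi.
Qed.

Lemma Ex_chi P (J : finType) (y : J -> F) (rho kap : J -> nat) : bi_invariant P ->
  injective rho -> injective kap -> Ex P (chi y rho kap) = phi P y.
Proof.
move=> Pinv ri ki; pose f i := maxn (maxn (rho i) (kap i)) (rank i).
pose n := (\max_i f i).+1.
have fn i : (f i < n)%N by rewrite ltnS leq_bigmax.
have [r rinj rE] : exists2 g : J -> 'I_n, injective g & forall i, rho i = g i.
  by apply: ord_lift => // i; rewrite (leq_ltn_trans _ (fn i))// /f -maxnA leq_maxl.
have [k kinj kE] : exists2 g : J -> 'I_n, injective g & forall i, kap i = g i.
  by apply: ord_lift => // i; rewrite (leq_ltn_trans _ (fn i))// /f (maxnC (rho i)) -maxnA leq_maxl.
have [e einj eE] : exists2 g : J -> 'I_n, injective g & forall i, rank i = g i.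
  by apply: ord_lift => [|i]; [exact: rank_inj|rewrite (leq_ltn_trans _ (fn i))// leq_maxr].
rewrite /phi (chi_corner y rE kE) (chi_corner y eE eE).
have [s sE] := perm_extend einj rinj; have [t tE] := perm_extend einj kinj.
have [ct1 ct2] := test_lin c_cosine y e e.
rewrite -(Ex_corner Pinv ct1 ct2 (GLO_perm s) (GLO_sym (GLO_perm t))).
apply: eq_Ex => X /=; congr c; rewrite /lin; apply: eq_bigr => i _; congr (_ * _).
by rewrite -row_permE tr_perm_mx -col_permE !mxE sE tE.
Qed.

Definition col_event (J : finType) (y : J -> F) (rho : J -> nat) a L (X : infmx F) : bool :=
  [forall i, forall l : 'I_L, absv (y i * X (rho i, (a + l)%N)) <= 1].

Lemma cyl_col_event (J : finType) (y : J -> F) (rho : J -> nat) a L : cyl (col_event y rho a L).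
Proof.
apply: cyl_forallb => i; apply: cyl_forallb => l.
have := cyl_affine_le (rho i, a + l)%N (y i) 0 (@ltr01 R).
by under eq_fun do rewrite addr0.
Qed.

Lemma bmeas_bool (q : infmx F -> bool) : cyl q ->
  bmeas ((fun X => (q X)%:R) : borel (infmx F) -> R).
Proof.
move=> cq; apply: (@cyl_bmeas _ _ _ 1); first exact: (cyl_comp (fun b : bool => b%:R) cq).
by move=> X; case: (q X); rewrite ?normr1 ?normr0.
Qed.

Lemma phi_col_event P (J : finType) (y : J -> F) (rho : J -> nat) a L : bi_invariant P ->
  injective rho -> (forall i, (rho i < a)%N) -> (0 < L)%N ->
  `|phi P y - Ex P (fun X => (col_event y rho a L X)%:R)| <= 2%:R * #|J|%:R / L%:R.
Proof.
move=> Pinv ri ra L0; pose n := (a + L + #|J|)%N.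
have [r rinj rE] : exists2 g : J -> 'I_n, injective g & forall i, rho i = g i.
  by apply: ord_lift => // i; rewrite /n -addnA (leq_trans (ra i))// leq_addr.
pose kap (i : J) := (a + L + rank i)%N.
have kapi : injective kap by move=> i j /addnI/rank_inj.
have [k kinj kE] : exists2 g : J -> 'I_n, injective g & forall i, kap i = g i.
  by apply: ord_lift => // i; rewrite /n ltn_add2l /rank ltn_ord.
pose LL := [set l : 'I_n | (a <= l < a + L)%N]%SET.
have kL i : k i \notin LL.
  by rewrite inE -kE /kap negb_and -!ltnNge ltnS leq_addr orbT.
have lt_n (l : 'I_L) : (a + l < n)%N by rewrite /n -addnA ltn_add2l ltn_addr.
have cL : #|LL| = L.
  rewrite -[RHS]card_ord -(card_imset _ (f := fun l => Ordinal (lt_n l))).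
    apply: eq_card => l; rewrite inE; apply/idP/imsetP => [/andP[al lL]|[l' _ ->]/=].
      have lL' : (l - a < L)%N by rewrite ltn_subLR.
      by exists (Ordinal lL') => //; apply: val_inj; rewrite /= subnKC.
    by rewrite leq_addr ltn_add2l ltn_ord.
  by move=> l l' /(congr1 val)/= /addnI/val_inj.
have LL0 : (0 < #|LL|)%N by rewrite cL.
rewrite -(Ex_chi y Pinv ri kapi) (chi_corner y rE kE).
have := Ex_lin_approx F_nondiscrete F_locally_compact c_cosine Pinv y r kinj kL LL0.
rewrite cL; congr (`|_ - _| <= _); apply: eq_Ex => X /=; congr (nat_of_bool _)%:R.
rewrite /evt /col_event; apply: eq_forallb => i; apply/forallP/forallP => h l.
  have := h (Ordinal (lt_n l)); rewrite inE/= leq_addr ltn_add2l ltn_ord/= mxE/=.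
  by rewrite -rE.
apply/implyP; rewrite inE => /andP[al lL].
have lL' : (l - a < L)%N by rewrite ltn_subLR.
by have := h (Ordinal lL'); rewrite /= subnKC// mxE -rE.
Qed.

Lemma bmeas_chi (J : finType) (y : J -> F) (rho kap : J -> nat) :
  bmeas (chi y rho kap : borel (infmx F) -> R).
Proof.
have [_ c1 _ _ _] := c_cosine.
pose n := (\max_i maxn (rho i) (kap i)).+1.
have lt_n i : (maxn (rho i) (kap i) < n)%N by rewrite ltnS (leq_bigmax i).
pose r i : 'I_n := Ordinal (leq_ltn_trans (leq_maxl _ _) (lt_n i)).
pose k i : 'I_n := Ordinal (leq_ltn_trans (leq_maxr _ _) (lt_n i)).
rewrite (@chi_corner _ _ _ _ n r k)//.
exact: (test_bmeas (test_lin c_cosine y r k)).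
Qed.

Lemma normr_Ex_bool P (q : infmx F -> bool) : cyl q -> 0 <= Ex P (fun X => (q X)%:R : R) <= 1.
Proof.
move=> cq; apply/andP; split; first by apply: Ex_ge0 => X; exact: ler0n.
rewrite -[leRHS](Ex_cst P 1); apply: le_Ex; [exact: (bmeas_bool cq)|exact: bmeas_cst|].
by move=> X; rewrite lern1 leq_b1.
Qed.

Lemma normr_phi_le1 P (J : finType) (y : J -> F) : `|phi P y| <= 1.
Proof.
have [_ c1 _ _ _] := c_cosine.
by apply: normr_Ex_le_cst; [exact: bmeas_chi|move=> X; exact: c1].
Qed.

Section Blocks.
Context (m : nat) (d : 'I_m -> F).

Definition block_row (b : nat) (j : 'I_m) : nat := (b * m + j)%N.

Lemma block_row_inj b b' j j' : block_row b j = block_row b' j' -> b = b' /\ j = j'.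
Proof.
rewrite /block_row => E; have m0 : (0 < m)%N by exact: leq_ltn_trans (ltn_ord j).
have bb : b = b'.
  by have := congr1 (divn^~ m) E; rewrite !divnMDl// !divn_small// !addn0.
by split=> //; apply: val_inj; move: E; rewrite bb => /addnI.
Qed.

Lemma block_row_lt b j N : (b < N)%N -> (block_row b j < N * m)%N.
Proof.
move=> bN; rewrite (@leq_trans (b.+1 * m))//; last by rewrite leq_mul2r bN orbT.
by rewrite /block_row mulSnr ltn_add2l.
Qed.

Definition block_event N b := col_event d (block_row b) (N * m) N.

Definition block_freq N (X : infmx F) : R :=
  N%:R^-1 * \sum_(b < N) (block_event N b X)%:R.

Definition beta P k := phi P (fun p : 'I_k * 'I_m => d p.2).

Lemma block_freq01 N X : 0 <= block_freq N X <= 1.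
Proof.
apply/andP; split; first by rewrite mulr_ge0 ?invr_ge0// sumr_ge0.
have [->|N0] := eqVneq N 0%N; first by rewrite /block_freq invr0 mul0r.
rewrite /block_freq ler_pdivrMl ?ltr0n ?lt0n// mulr1.
apply: (@le_trans _ _ (\sum_(b < N) 1)); last by rewrite sumr_const card_ord.
by apply: ler_sum => b _; rewrite lern1 leq_b1.
Qed.

Lemma bmeas_block_freq N k : bmeas ((fun X => block_freq N X ^+ k) : borel (infmx F) -> R).
Proof.
apply: bmeasX; apply: bmeasZ; apply: bmeas_sum => b _.
by apply: bmeas_bool; exact: cyl_col_event.
Qed.

Lemma block_freq_exp N k X : block_freq N X ^+ k = N%:R^-1 ^+ k *
  \sum_(f : {ffun 'I_k -> 'I_N})
    (col_event (fun p : 'I_k * 'I_m => d p.2) (fun p => block_row (f p.1) p.2) (N * m) N X)%:R.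
Proof.
rewrite /block_freq exprMn; congr (_ * _).
rewrite -{1}[k]card_ord -prodr_const bigA_distr_bigA; apply: eq_bigr => f _.
have [/forallP h|/forallPn[[i j] /forallPn[l hl]]] := boolP (col_event _ _ _ _ _).
  rewrite big1// => i _; rewrite (_ : block_event _ _ _ = true)//.
  by apply/forallP => j; exact: (h (i, j)).
rewrite (bigD1 i)//= (_ : block_event _ _ _ = false) ?mul0r//.
by apply/negbTE/forallPn; exists j; apply/forallPn; exists l.
Qed.

(* Up to the collisions between the [k] sampled blocks, the [k]-th power of the
   frequency samples the event of [k] disjoint copies of [d]. *)
Lemma block_freq_moment P N k : bi_invariant P -> (0 < N)%N ->
  `|Ex P (fun X => block_freq N X ^+ k) - beta P k| <= (2%:R * (k * m)%:R + 2%:R * k%:R ^+ 2) / N%:R.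
Proof.
move=> Pinv N0; have N0' : 0 < N%:R :> R by rewrite ltr0n.
pose ev (f : {ffun 'I_k -> 'I_N}) :=
  col_event (fun p : 'I_k * 'I_m => d p.2) (fun p => block_row (f p.1) p.2) (N * m) N.
have cev f : cyl (ev f) by exact: cyl_col_event.
have -> : Ex P (fun X => block_freq N X ^+ k) =
    N%:R^-1 ^+ k * \sum_(f : {ffun 'I_k -> 'I_N}) Ex P (fun X => (ev f X)%:R).
  rewrite -Ex_sum => [|f _]; last exact: bmeas_bool.
  rewrite -ExZ; last by apply: bmeas_sum => f _; exact: bmeas_bool.
  by apply: eq_Ex => X; rewrite block_freq_exp.
have cardN : #|{ffun 'I_k -> 'I_N}| = (N ^ k)%N by rewrite card_ffun !card_ord.
have -> : beta P k = N%:R^-1 ^+ k * \sum_(f : {ffun 'I_k -> 'I_N}) beta P k.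
  by rewrite sumr_const cardN -[X in _ * X]mulr_natl natrX exprVn mulKf// expf_neq0// gt_eqF.
rewrite -mulrBr -sumrB normrM ger0_norm ?exprn_ge0 ?invr_ge0//.
have bound f : `|Ex P (fun X => (ev f X)%:R) - beta P k| <=
    2%:R * (k * m)%:R / N%:R + 2%:R * (~~ injectiveb f)%:R.
  have [/injectiveP fi|_] := boolP (injectiveb f).
    rewrite mulr0 addr0 distrC.
    have := @phi_col_event P _ (fun p : 'I_k * 'I_m => d p.2) (fun p => block_row (f p.1) p.2)
      (N * m) N Pinv _ _ N0.
    rewrite card_prod !card_ord; apply.
      by move=> [i j] [i' j'] /block_row_inj/= [/val_inj/fi -> ->].
    by move=> [i j]; exact: block_row_lt.
  have /andP[e0 e1] := normr_Ex_bool P (cev f); have := normr_phi_le1 P (fun p : 'I_k * 'I_m => d p.2).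
  rewrite -/(beta P k) => b1; rewrite (le_trans (ler_normB _ _))// ger0_norm//.
  have : 0 <= 2%:R * (k * m)%:R / N%:R :> R by rewrite divr_ge0 ?mulr_ge0.
  by rewrite /= mulr1; lra.
apply: (@le_trans _ _ (N%:R^-1 ^+ k * \sum_(f : {ffun 'I_k -> 'I_N})
    (2%:R * (k * m)%:R / N%:R + 2%:R * (~~ injectiveb f)%:R))).
  rewrite ler_wpM2l ?exprn_ge0 ?invr_ge0// (le_trans (ler_norm_sum _ _ _))//.
  by apply: ler_sum => f _; exact: bound.
rewrite big_split/= sumr_const cardN -mulr_sumr.
have -> : \sum_(f : {ffun 'I_k -> 'I_N}) (~~ injectiveb f)%:R = (N ^ k)%:R - (N ^_ k)%:R :> R.
  have <- : #|[set f : {ffun 'I_k -> 'I_N} | injectiveb f]%SET| = (N ^_ k)%N.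
    by rewrite card_inj_ffuns !card_ord.
  rewrite -cardN -!sum1_card !natr_sum [X in _ - X]big_mkcond [X in X - _]big_mkcond/=.
  rewrite -sumrB; apply: eq_bigr => f _; rewrite inE.
  by case: (injectiveb f); rewrite /= ?subrr ?subr0.
rewrite -[X in X + _]mulr_natl mulrDr exprVn natrX mulKf ?expf_neq0 ?gt_eqF//.
have [] := ffact_ratio R k N0; set r := _ / _ ^+ k => r1 _.
have -> : N%:R ^- k * (2%:R * (N%:R ^+ k - (N ^_ k)%:R)) = 2%:R * (1 - r) :> R.
  by rewrite mulrCA mulrBr mulVf ?expf_neq0 ?gt_eqF// [_ ^- k * _]mulrC.
rewrite [leRHS]mulrDl -[X in _ <= _ + X]mulrA; lra.
Qed.

End Blocks.


End CornerCharacter.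

Lemma le_add_div_nat (R : realType) (x e C : R) :
  (forall N, (0 < N)%N -> x <= e + C / N%:R) -> x <= e.
Proof.
move=> h; apply/ler_addgt0Pr => d d0.
pose N := (Num.bound (C / d)).+1; have N0 : 0 < N%:R :> R by rewrite ltr0n.
apply: le_trans (h N isT) _; rewrite lerD2l ler_pdivrMr// mulrC -ler_pdivrMr//.
rewrite (le_trans (ler_norm _))// ltW// (lt_le_trans (archi_boundP (normr_ge0 _)))//.
rewrite (_ : Num.bound `|C / d| = Num.bound (C / d)) ?ler_nat//.
by rewrite /Num.bound /= normr_id.
Qed.

Section Moments.
Context {R : realType} {F : nonArchFieldType R}
  (F_nondiscrete : ~ (forall A : set F, open A))
  (F_locally_compact : locally_compact [set: F]).
Context (c : F -> R) (c_cosine : cosine c).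
Implicit Types P Q : probability (borel (infmx F)) R.

Lemma phi_reindex_absv P (J K : finType) (f : J -> K) (y : J -> F) (z : K -> F) :
  bi_invariant P -> bijective f -> (forall i, absv (y i) = absv (z (f i))) ->
  phi c P y = phi c P z.
Proof.
move=> Pinv bf yz; apply/eqP; rewrite -subr_eq0 -normr_le0.
apply: (@le_add_div_nat _ _ _ (2%:R * #|J|%:R + 2%:R * #|K|%:R)) => L L0; rewrite add0r.
pose rho (i : J) := rank (f i).
have fi : injective f := bij_inj bf.
have h1 := @phi_col_event R F F_nondiscrete F_locally_compact c c_cosine
  P J y rho #|K| L Pinv (inj_comp (@rank_inj K) fi) (fun i => ltn_ord _) L0.
have h2 := @phi_col_event R F F_nondiscrete F_locally_compact c c_cosine
  P K z (@rank K) #|K| L Pinv (@rank_inj K) (fun i => ltn_ord _) L0.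
have [g gf fg] := bf.
have E X : col_event y rho #|K| L X = col_event z (@rank K) #|K| L X.
  apply/forallP/forallP => h k; apply/forallP => l.
    by have /forallP/(_ l) := h (g k); rewrite !absvM yz /rho fg.
  by have /forallP/(_ l) := h (f k); rewrite !absvM yz.
have eE : Ex P (fun X => (col_event y rho #|K| L X)%:R : R) =
    Ex P (fun X => (col_event z (@rank K) #|K| L X)%:R) by apply: eq_Ex => X; rewrite E.
rewrite eE in h1.
by rewrite mulrDl (le_trans _ (lerD h1 h2))// [X in _ <= _ + X]distrC ler_distD.
Qed.

Lemma beta1E P m (d : 'I_m -> F) : bi_invariant P -> beta c d P 1 = phi c P d.
Proof.
move=> Pinv; apply: (@phi_reindex_absv _ _ _ snd) => //.
by exists (fun j => (ord0, j)) => // -[i j]; rewrite /= (ord1 i).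
Qed.

Lemma beta_even_approx m (d : 'I_m -> F) e : 0 < e -> exists q : {poly R},
  forall P, bi_invariant P ->
  `|beta c d P 1 - \sum_(i < size q) q`_i * beta c d P (i + i)%N| <= e.
Proof.
move=> e0; have [q qP] := even_polynomial_approx e0; exists q => P Pinv.
pose b k : R := 2%:R * (k * m)%:R + 2%:R * k%:R ^+ 2.
apply: (@le_add_div_nat _ _ _ (b 1 + \sum_(i < size q) `|q`_i| * b (i + i)%N)) => N N0.
pose M k := Ex P (fun X => block_freq d N X ^+ k).
have MP k : `|M k - beta c d P k| <= b k / N%:R.
  exact: (block_freq_moment F_nondiscrete F_locally_compact c_cosine d k Pinv N0).
have bf k : bmeas ((fun X => block_freq d N X ^+ k) : borel (infmx F) -> R).
  exact: bmeas_block_freq.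
have M1 : `|M 1 - \sum_(i < size q) q`_i * M (i + i)%N| <= e.
  have -> : \sum_(i < size q) q`_i * M (i + i)%N =
      Ex P (fun X => \sum_(i < size q) q`_i * block_freq d N X ^+ (i + i)%N).
    rewrite Ex_sum => [|i _]; last exact: bmeasZ.
    by apply: eq_bigr => i _; rewrite ExZ.
  have bs : bmeas ((fun X => \sum_(i < size q) q`_i * block_freq d N X ^+ (i + i)%N)
      : borel (infmx F) -> R) by apply: bmeas_sum => i _; exact: bmeasZ.
  rewrite -ExB//; apply: normr_Ex_le_cst; first exact: bmeasB.
  move=> X; rewrite (_ : \sum_(i < size q) _ = q.[block_freq d N X ^+ 2]).
    by rewrite expr1 qP// block_freq01.
  by rewrite horner_coef; apply: eq_bigr => i _; rewrite -exprM addnn mul2n.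
have -> : beta c d P 1 - \sum_(i < size q) q`_i * beta c d P (i + i)%N =
  (M 1 - \sum_(i < size q) q`_i * M (i + i)%N) + ((beta c d P 1 - M 1) +
   \sum_(i < size q) q`_i * (M (i + i)%N - beta c d P (i + i)%N)).
  rewrite [X in _ = _ + (_ + X)](_ : _ = \sum_(i < size q) q`_i * M (i + i)%N -
    \sum_(i < size q) q`_i * beta c d P (i + i)%N); first by ring.
  by rewrite -sumrB; apply: eq_bigr => i _; rewrite mulrBr.
rewrite (le_trans (ler_normD _ _))// lerD// (le_trans (ler_normD _ _))// mulrDl lerD//.
  by rewrite distrC.
rewrite mulr_suml (le_trans (ler_norm_sum _ _ _))//; apply: ler_sum => i _.
by rewrite normrM -mulrA ler_wpM2l.
Qed.

Lemma infmx_tau_continuous : continuous (@infmx_tau R F).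
Proof.
apply: continuous_to_infmx => -[i j].
by apply: na_continuousB; exact: Defs.coord_continuous.
Qed.

Definition same_tau P Q := forall A, cyl A ->
  P ((@infmx_tau R F) @^-1` A) = Q ((@infmx_tau R F) @^-1` A).

Lemma same_tau_Ex P Q f : same_tau P Q -> bmeas (f : borel (infmx F) -> R) ->
  Ex P (f \o @infmx_tau R F) = Ex Q (f \o @infmx_tau R F).
Proof.
move=> PQ bf; rewrite -!(@Ex_distribution _ _ _ _ _ _ (borel_fun infmx_tau_continuous) f)//.
by apply: Ex_eq_prob; apply: probability_infmx_ext => A cA; exact: PQ.
Qed.

(* The character of [k] copies of [d] at [X - X^T] is the character of [2 k] copies
   of [d] at [X], half of them with the opposite sign, which does not affect the
   integrality events. *)
Lemma beta_even P Q m (d : 'I_m -> F) k : bi_invariant P -> bi_invariant Q ->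
  same_tau P Q -> beta c d P (k + k)%N = beta c d Q (k + k)%N.
Proof.
move=> Pinv Qinv PQ; pose J : finType := ('I_k * 'I_m)%type.
pose y (p : J * bool) := if p.2 then d p.1.2 else - d p.1.2.
pose r (p : J) b := (rank p + if b then 0 else #|J|)%N.
pose rho (p : J * bool) := r p.1 p.2; pose kap (p : J * bool) := r p.1 (~~ p.2).
have rinj p p' b b' : r p b = r p' b' -> p = p' /\ b = b'.
  have pJ : (rank p < #|J|)%N := ltn_ord _; have pJ' : (rank p' < #|J|)%N := ltn_ord _.
  move=> E; have bb : b = b' by case: b b' E => -[] //; rewrite /r; lia.
  by split=> //; apply: rank_inj; move: E; rewrite bb => /addIn.
have rhoi : injective rho by move=> [p b] [p' b'] /rinj[/= -> ->].
have kapi : injective kap by move=> [p b] [p' b'] /rinj[/= -> /(can_inj negbK) ->].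
have yP P' : bi_invariant P' -> phi c P' y = beta c d P' (k + k)%N.
  move=> P'inv; pose f (p : J * bool) : 'I_(k + k) * 'I_m :=
    (if p.2 then lshift k p.1.1 else rshift k p.1.1, p.1.2).
  have fi : injective f.
    move=> [[i j] b] [[i' j'] b'] [/= + ->].
    case: b b' => -[] // => [/lshift_inj->//|/eqP|/eqP|/rshift_inj->//].
      by rewrite eq_lrshift.
    by rewrite eq_rlshift.
  apply: (@phi_reindex_absv _ _ _ f) => //.
    apply: inj_card_bij => //; rewrite !card_prod !card_ord card_bool; lia.
  by move=> [[i j] b]; rewrite /y /f/=; case: b; rewrite ?absvN.
rewrite -!yP// -(Ex_chi c_cosine y Pinv rhoi kapi) -(Ex_chi c_cosine y Qinv rhoi kapi).
pose D (p : J) := d p.2.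
have tE : chi c y rho kap = chi c D (r^~ true) (r^~ false) \o @infmx_tau R F.
  apply/funext => X; rewrite /chi/=; congr c.
  rewrite -(pair_bigA _ (fun p b => y (p, b) * X (rho (p, b), kap (p, b))))/=.
  apply: eq_bigr => p _; rewrite big_bool /= /y/= /infmx_tau /infmx_sub /infmx_tr/=.
  by rewrite mulNr mulrBr.
by rewrite tE; apply: same_tau_Ex => //; exact: bmeas_chi.
Qed.

Lemma same_tau_phi P Q m (d : 'I_m -> F) : bi_invariant P -> bi_invariant Q ->
  same_tau P Q -> phi c P d = phi c Q d.
Proof.
move=> Pinv Qinv PQ; rewrite -!beta1E//.
apply/eqP; rewrite -subr_eq0 -normr_le0; apply/ler_addgt0Pr => e e0; rewrite add0r.
have [q qP] := beta_even_approx d (divr_gt0 e0 (ltr0n _ 2)).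
have := qP _ Pinv; have := qP _ Qinv.
under eq_bigr do rewrite -(beta_even d _ Pinv Qinv PQ).
set S := \sum_(i < _) _; rewrite !ler_norml => /andP[h1 h2] /andP[h3 h4].
by apply/andP; split; lra.
Qed.

End Moments.

Section FourierInversion.
Context {R : realType} {F : nonArchFieldType R}
  (F_nondiscrete : ~ (forall A : set F, open A))
  (F_locally_compact : locally_compact [set: F]).
Context (c : F -> R) (c_cosine : cosine c).
Context (P Q : probability (borel (infmx F)) R).
Hypotheses (P_inv : bi_invariant P) (Q_inv : bi_invariant Q) (PQ : same_tau P Q).

Section Corner.
Context (m : nat).
Implicit Types (y : 'I_m * 'I_m -> F) (Z : 'M[F]_m).

Definition entries y Z : F := lin y fst snd Z.

Lemma entries_trace y Z : entries y Z = \tr ((\matrix_(j, i) y (i, j)) *m Z).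
Proof.
rewrite /entries /lin /mxtrace (eq_bigr (fun p => y (p.1, p.2) * Z p.1 p.2)); last by case.
rewrite -(pair_bigA _ (fun i j => y (i, j) * Z i j))/=.
rewrite exchange_big/=; apply: eq_bigr => j _; rewrite mxE.
by apply: eq_bigr => i _; rewrite mxE.
Qed.

Lemma entriesD y z Z : entries (fun p => y p + z p) Z = entries y Z + entries z Z.
Proof. by rewrite /entries /lin -big_split; apply: eq_bigr => p _; rewrite mulrDl. Qed.

Lemma entriesN y Z : entries (fun p => - y p) Z = - entries y Z.
Proof. by rewrite /entries /lin -sumrN; apply: eq_bigr => p _; rewrite mulNr. Qed.

Lemma test_entries y a : test (fun Z => c (entries y Z + a)).
Proof. exact: test_lin_shift. Qed.

Lemma Ex_entries y : Ex P (fun X => c (entries y (corner m X))) =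
  Ex Q (fun X => c (entries y (corner m X))).
Proof.
have [G [G' [H [H' [d [GG HH GYH]]]]]] := smith_normal_form (\matrix_(j, i) y (i, j)).
suff E P' : bi_invariant P' -> Ex P' (fun X => c (entries y (corner m X))) = phi c P' (d ord0).
  by rewrite !E//; apply: same_tau_phi.
move=> P'inv; have ci : injective (fun i : 'I_m => i : nat) := val_inj.
rewrite -(Ex_chi c_cosine (d ord0) P'inv ci ci).
have [ct1 ct2] := test_lin c_cosine y fst snd.
rewrite -(Ex_corner P'inv ct1 ct2 HH GG); apply: eq_Ex => X.
rewrite /chi /= -/(entries _ _) entries_trace; congr c.
rewrite mulmxA mxtrace_mulC !mulmxA GYH /mxtrace; apply: eq_bigr => i _.
by rewrite mul_diag_mx !mxE.
Qed.

Lemma Ex_entries_shift y a : Ex P (fun X => c (entries y (corner m X) + a)) =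
  Ex Q (fun X => c (entries y (corner m X) + a)).
Proof.
have [cD _ _ c0 _] := c_cosine.
have cN x : c (- x) = c x.
  by have := cD 0 x; rewrite c0 add0r sub0r; lra.
suff E P' : bi_invariant P' -> Ex P' (fun X => c (entries y (corner m X) + a)) =
    c a * Ex P' (fun X => c (entries y (corner m X))).
  by rewrite !E// Ex_entries.
move=> P'inv.
have N1 : GLO (- 1%:M : 'M[F]_m) (- 1%:M).
  by split; try exact/mxleN/mxle1; rewrite mulmxN mulNmx opprK mulmx1.
have [ct1 ct2] := test_entries y a.
have symm : Ex P' (fun X => c (entries y (corner m X) - a)) =
    Ex P' (fun X => c (entries y (corner m X) + a)).
  rewrite -[RHS](Ex_corner P'inv ct1 ct2 N1 (GLO1 m)); apply: eq_Ex => X.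
  by rewrite mulmx1 mulNmx mul1mx -cN opprB addrC /entries /lin -sumrN; congr (c (_ + a));
    apply: eq_bigr => p _; rewrite [in RHS]mxE mulrN.
have bT b : bmeas ((fun X => c (entries y (corner m X) + b)) : borel (infmx F) -> R).
  exact: (test_bmeas (test_entries y b)).
have b0 : bmeas ((fun X => c (entries y (corner m X))) : borel (infmx F) -> R).
  by have := bT 0; under eq_fun do rewrite addr0.
apply: (@mulfI _ 2%:R); first by rewrite pnatr_eq0.
rewrite [LHS]mulr_natl mulr2n -{2}symm -ExD// mulrA -ExZ//.
by apply: eq_Ex => X; rewrite cD mulrAC.
Qed.

Context (X0 : 'M[F]_m) (q : F) (q0 : q != 0).

Let z (p : 'I_m * 'I_m) (Z : 'M[F]_m) : F := (Z p.1 p.2 - X0 p.1 p.2) / q.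
Let inball p Z : R := (absv (z p Z) <= 1)%R%:R.

Let zE p t Z : t * z p Z = entries (fun k => if k == p then t / q else 0) Z - t / q * X0 p.1 p.2.
Proof.
rewrite /entries /lin (bigD1 p)//= eqxx big1 => [|k /negPf->]; last by rewrite mul0r.
by rewrite addr0 /z; field.
Qed.

Let zE' p X : z p (corner m X) = q^-1 * X (p.1 : nat, p.2 : nat) + - (X0 p.1 p.2 / q).
Proof. by rewrite /z mxE mulrBl mulrC. Qed.

Let test_inball p : test (inball p).
Proof.
apply: test_bool; have := cyl_affine_le (p.1 : nat, p.2 : nat) q^-1 (- (X0 p.1 p.2 / q)) (@ltr01 R).
by congr cyl; apply/funext => X; rewrite /= zE'.
Qed.

Lemma Ex_entries_inball (s : seq ('I_m * 'I_m)) y a :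
  Ex P (fun X => c (entries y (corner m X) + a) * \prod_(p <- s) inball p (corner m X)) =
  Ex Q (fun X => c (entries y (corner m X) + a) * \prod_(p <- s) inball p (corner m X)).
Proof.
have [cD c1 _ c0 _] := c_cosine.
elim: s y a => [|p s IH] y a.
  rewrite (@eq_Ex _ _ _ P _ (fun X => c (entries y (corner m X) + a))); last first.
    by move=> X; rewrite big_nil mulr1.
  rewrite (@eq_Ex _ _ _ Q _ (fun X => c (entries y (corner m X) + a))); last first.
    by move=> X; rewrite big_nil mulr1.
  exact: Ex_entries_shift.
pose f (Z : 'M[F]_m) := \prod_(p <- s) inball p Z.
pose g y a (Z : 'M[F]_m) := c (entries y Z + a) * f Z.
have tg y' a' : test (g y' a') by apply: testM; [exact: test_entries|exact: test_prod].
have tc t : test (fun Z => c (t * z p Z)).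
  by under eq_fun do rewrite zE; exact: test_entries.
have cb : cosine_measurable c (fun X : borel (infmx F) => z p (corner m X)).
  split=> [t|r r0]; first exact: (test_bmeas (tc t)).
  apply: cyl_measurable.
  have := cyl_affine_gt (p.1 : nat, p.2 : nat) q^-1 (- (X0 p.1 p.2 / q)) r0.
  by congr cyl; apply/funext => X; rewrite /= zE'.
have E (P' : probability (borel (infmx F)) R) : Ex P' (fun X => c (entries y (corner m X) + a) *
    \prod_(p <- p :: s) inball p (corner m X)) =
    Ex P' (fun X => g y a (corner m X) * (absv (z p (corner m X)) <= 1)%R%:R).
  by apply: eq_Ex => X; rewrite /g /f big_cons -mulrA; congr (_ * _); rewrite mulrC.
rewrite !E; apply: (Ex_unit_ball_eq F_nondiscrete F_locally_compact c_cosine cb cb).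
- exact: (test_bmeas (tg y a)).
- exact: (test_bmeas (tg y a)).
- by move=> X; exact: (tg y a).2.
- by move=> X; exact: (tg y a).2.
move=> t _; pose w k := if k == p then t / q else 0; pose b := t / q * X0 p.1 p.2.
have S (P' : probability (borel (infmx F)) R) : 2%:R * Ex P' (fun X => g y a (corner m X) * c (t * z p (corner m X))) =
    Ex P' (fun X => g (fun k => y k + w k) (a - b) (corner m X)) +
    Ex P' (fun X => g (fun k => y k - w k) (a + b) (corner m X)).
  rewrite -ExZ; last exact: (test_bmeas (testM (tg y a) (tc t))).
  rewrite -ExD; try exact: (test_bmeas (tg _ _)).
  apply: eq_Ex => X; rewrite /g entriesD.
  rewrite (entriesD y (fun k => - w k)) entriesN zE -/w -/b -mulrDl.
  set e := entries y _; set v := entries w _.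
  rewrite (_ : e + v + (a - b) = e + a + (v - b)); last by ring.
  rewrite (_ : e - v + (a + b) = e + a - (v - b)); last by ring.
  by rewrite cD; ring.
apply: (@mulfI _ 2%:R); first by rewrite pnatr_eq0.
by rewrite !S; congr (_ + _); exact: IH.
Qed.

Definition mxball (Z : 'M[F]_m) : bool :=
  [forall p : 'I_m * 'I_m, absv (Z p.1 p.2 - X0 p.1 p.2) <= absv q].

Lemma Ex_mxball : Ex P (fun X => (mxball (corner m X))%:R : R) =
  Ex Q (fun X => (mxball (corner m X))%:R).
Proof.
have [_ _ _ c0 _] := c_cosine.
have q1 : 0 < absv q by rewrite absv_gt0.
have E X : (mxball (corner m X))%:R = c (entries (fun=> 0) (corner m X) + 0) *
    \prod_(p <- index_enum _) inball p (corner m X).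
  rewrite addr0 /entries /lin big1 => [|p _]; last by rewrite mul0r.
  have inE' p : inball p (corner m X) = (absv (corner m X p.1 p.2 - X0 p.1 p.2) <= absv q)%R%:R.
    by rewrite /inball /z absvM absvV ler_pdivrMr// mul1r.
  rewrite c0 mul1r; have [/forallP h|/forallPn[p /negPf hp]] := boolP (mxball _).
    by rewrite big1// => p _; rewrite inE' h.
  by rewrite (bigD1 p)//= inE' hp mul0r.
under [LHS]eq_Ex do rewrite E; under [RHS]eq_Ex do rewrite E.
exact: Ex_entries_inball.
Qed.

End Corner.

End FourierInversion.

Section CornerTails.
Context {R : realType} {F : nonArchFieldType R}.

Definition corner_tail n (r : R) : set (infmx F) :=
  [set X | exists p : 'I_n * 'I_n, r < absv (X (p.1 : nat, p.2 : nat))].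

Lemma cyl_corner_tail n r : 0 < r -> cyl (corner_tail n r).
Proof.
move=> r0; rewrite (_ : corner_tail n r =
    ~` [set X | forall p : 'I_n * 'I_n, ~ r < absv (X (p.1 : nat, p.2 : nat))]).
  by apply: cyl_setC; apply: cyl_forall => p; exact: (cyl_setC (cyl_tail _ r0)).
apply/seteqP; split=> X /=; last by move=> /existsNP[p rp]; exists p; exact: contrapT.
by move=> [p rp] /(_ p); apply.
Qed.

Lemma Pr_corner_tail_small (P' : probability (borel (infmx F)) R) n e : 0 < e ->
  exists2 r, 0 < r & Pr P' (corner_tail n r) <= e.
Proof.
move=> e0.
pose f (X : borel (infmx F)) := \big[Num.max/0]_(p : 'I_n * 'I_n) absv (X (p.1 : nat, p.2 : nat)).
have fE r : 0 < r -> [set X | r < f X] = corner_tail n r.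
  move=> r0; apply/seteqP; split=> X /=; last first.
    by case=> p rp; rewrite (lt_le_trans rp)// /f (bigD1 p)//= le_max lexx.
  rewrite ltNge => /negP h; apply: contrapT => no; apply: h; apply/bigmax_leP.
  split=> [|p _]; first exact: ltW.
  by rewrite leNgt; apply/negP => rp; apply: no; exists p.
have [r r0 rP] : exists2 r, 0 < r & Pr P' [set X | r < f X] <= e.
  by apply: Pr_tail_small => // r r0; rewrite fE//; apply: cyl_measurable; exact: cyl_corner_tail.
by exists r => //; rewrite -fE.
Qed.

End CornerTails.

Section Injectivity.
Context {R : realType} {F : nonArchFieldType R}
  (F_nondiscrete : ~ (forall A : set F, open A))
  (F_locally_compact : locally_compact [set: F]).

Section BallDecomposition.
Context (n : nat) (u q : F) (u0 : u != 0) (uq1 : absv (u * q) <= 1).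
Context (E : residue_system F (absv (u * q))) (A : set (infmx F)).
Hypothesis An : forall X Y, mxnear n (absv q) X Y -> A X = A Y.

Definition center (f : {ffun 'I_n * 'I_n -> E}) : 'M[F]_n :=
  \matrix_(i, j) (res_val (f (i, j)) / u).

Definition inbox (X : infmx F) :=
  [forall p : 'I_n * 'I_n, absv (u * X (p.1 : nat, p.2 : nat)) <= 1].

Lemma indic_ball_sum X : \1_A X * (inbox X)%:R =
  \sum_f \1_A (extmx (center f)) * (mxball (center f) q (corner n X))%:R :> R.
Proof.
have ballE f : mxball (center f) q (corner n X) = [forall p : 'I_n * 'I_n,
    absv (u * X (p.1 : nat, p.2 : nat) - res_val (f p)) <= absv (u * q)].
  apply: eq_forallb => -[i j] /=; rewrite !mxE/=.
  rewrite -(ler_pM2l (x := absv u)) ?absv_gt0// -!absvM mulrBr.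
  by rewrite [u * (_ / u)]mulrC divfK.
have [/forallP KX|/forallPn[p]] := boolP (inbox X); last first.
  rewrite -ltNge => np; rewrite mulr0 big1// => f _; rewrite ballE.
  rewrite (_ : [forall _, _] = false) ?mulr0//; apply/negbTE/forallPn; exists p.
  apply: contraTN np => h; rewrite -leNgt.
  by rewrite -(@absv_near_le _ _ (res_val (f p))) ?res_val_int// absvB (le_trans h).
pose f0 := [ffun p : 'I_n * 'I_n => res_cls E (u * X (p.1 : nat, p.2 : nat))].
have bf0 : mxball (center f0) q (corner n X).
  by rewrite ballE; apply/forallP => p; rewrite ffunE; apply: res_valP.
rewrite mulr1 (bigD1 f0)//= bf0 mulr1 big1 ?addr0 => [|f ff0].
  rewrite !indicE; congr (nat_of_bool _)%:R.
  have EA : A X = A (extmx (center f0)).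
    apply: An; apply/mxnear_corner => i j; have := forallP bf0 (i, j).
    by rewrite !mxE extmx_in !mxE.
  by apply/idP/idP => /set_mem h; apply: mem_set; rewrite ?EA// -EA.
rewrite ballE (_ : [forall _, _] = false) ?mulr0//.
apply: contraNF ff0 => /forallP h; apply/eqP/ffunP => p; rewrite ffunE.
by rewrite -(res_valK (f p)); apply/esym/res_cls_eq; rewrite ?res_val_int.
Qed.

End BallDecomposition.

Lemma same_tau_eq (P Q : probability (borel (infmx F)) R) :
  bi_invariant P -> bi_invariant Q -> same_tau P Q -> forall A, cyl A -> P A = Q A.
Proof.
move=> Pinv Qinv PQ A cA; have mA := cyl_measurable cA.
have [c c_cosine] := exists_cosine F_nondiscrete F_locally_compact.
rewrite !PrE//; congr EFin; apply/eqP; rewrite -subr_eq0 -normr_le0.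
apply/ler_addgt0Pr => d d0; rewrite add0r.
have [n [e [e0 Ae]]] := cA.
have [q q0 qe] := exists_absv_small F_nondiscrete e0.
have q1 : 0 < absv q by rewrite absv_gt0.
have [r r0 rP] := Pr_corner_tail_small P n (divr_gt0 d0 (ltr0n _ 2)).
have [s s0 sQ] := Pr_corner_tail_small Q n (divr_gt0 d0 (ltr0n _ 2)).
have b0 : 0 < Num.min (absv q)^-1 (Num.min r^-1 s^-1) by rewrite !lt_min !invr_gt0 q1 r0.
have [u u0 ub] := exists_absv_small F_nondiscrete b0.
have u1 : 0 < absv u by rewrite absv_gt0.
have [uq ur us] : [/\ absv u <= (absv q)^-1, absv u <= r^-1 & absv u <= s^-1].
  by move: ub; rewrite !lt_min => /and3P[/ltW ? /ltW ? /ltW ?].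
have uq1 : absv (u * q) <= 1 by rewrite absvM -ler_pdivlMr// div1r.
have uq0 : 0 < absv (u * q) by rewrite absvM mulr_gt0.
have [E] := exists_residue_system F_nondiscrete F_locally_compact uq0 uq1.
have An X Y : mxnear n (absv q) X Y -> A X = A Y.
  by move=> XY; apply: Ae; apply: mxnear_le XY => //; exact: ltW.
pose g (X : borel (infmx F)) : R := \1_A X * (inbox n u X)%:R.
have gE P' : Ex P' g = \sum_(f : {ffun 'I_n * 'I_n -> E}) \1_A (extmx (center f)) *
    Ex P' (fun X : borel (infmx F) => (mxball (center f) q (corner n X))%:R).
  have bm (f : {ffun 'I_n * 'I_n -> E}) :
      bmeas (fun X : borel (infmx F) => (mxball (center f) q (corner n X))%:R : R).
    apply: bmeas_bool; apply: (@cyl_corner _ _ _ n (mxball (center f) q) (absv q) q1) => M N MN.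
    apply: eq_forallb => p; apply: absv_near_le; rewrite opprB addrA subrK.
    by have := MN p.1 p.2; rewrite !mxE.
  under eq_Ex do rewrite /g (indic_ball_sum u0 uq1 E An).
  rewrite Ex_sum => [|f _]; last exact: bmeasZ.
  by apply: eq_bigr => f _; rewrite ExZ.
have close (P' : probability (borel (infmx F)) R) t : 0 < t -> absv u <= t^-1 ->
    Pr P' (corner_tail n t) <= d / 2%:R ->
    `|Pr P' A - Ex P' g| <= d / 2%:R.
  move=> t0 ut; apply: le_trans.
  have cT : cyl (corner_tail n t : set (infmx F)) := cyl_corner_tail n t0.
  have bg : bmeas g.
    apply: bmeasM; first exact: bmeas_indic.
    apply: bmeas_bool; apply: cyl_forallb => p.
    have := cyl_affine_le (p.1 : nat, p.2 : nat) u 0 (@ltr01 R).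
    by under eq_fun do rewrite addr0.
  rewrite -!Ex_indic//; last exact: cyl_measurable.
  rewrite -ExB//; last exact: bmeas_indic.
  apply: normr_Ex_le; [by apply: bmeasB => //; exact: bmeas_indic|apply: bmeas_indic; exact: cyl_measurable|].
  move=> X; rewrite /g; have [_|/forallPn[p]] := boolP (inbox n u X).
    by rewrite mulr1 subrr normr0 indicE.
  rewrite -ltNge => np; rewrite mulr0 subr0 [X in _ <= X]indicE mem_set.
    by rewrite indicE ger0_norm// lern1 leq_b1.
  exists p; rewrite -(ltr_pM2l u1) -absvM (le_lt_trans _ np)//.
  by rewrite -ler_pdivlMr// div1r.
have := close P r r0 ur rP; have := close Q s s0 us sQ.
have -> : Ex P g = Ex Q g.
  rewrite !gE; apply: eq_bigr => f _; congr (_ * _).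
  exact: (Ex_mxball F_nondiscrete F_locally_compact c_cosine Pinv Qinv PQ _ q0).
rewrite !ler_norml => /andP[h1 h2] /andP[h3 h4].
by apply/andP; split; lra.
Qed.

Lemma Pinv_bi_invariant (mu : Pinv R (mat_act F)) : bi_invariant (repr_prob (set_val mu)).
Proof.
move=> g A cA; have /invariantP := set_valP mu; apply; exact: cyl_measurable.
Qed.

Lemma tau_star_inj : injective (@tau_star R F).
Proof.
move=> mu mu' tmu; apply: val_inj; apply: borel_prob_ext; apply: probability_infmx_ext.
apply: same_tau_eq; [exact: Pinv_bi_invariant|exact: Pinv_bi_invariant|].
move=> A cA; have mA : measurable (skew_val @^-1` A : set (borel (skew_infmx F))).
  exact: (preimage_cyl_measurable skew_val_continuous cA).
have := congr1 (fun nu => repr_prob (set_val nu) (skew_val @^-1` A)) tmu.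
by rewrite /= !borel_pushE.
Qed.

End Injectivity.

(** * Surjectivity *)

Section ExtendRows.
Context {R : realType} {F : nonArchFieldType R}.

Lemma absv_prod_near1 (I : finType) (f : I -> F) v : 0 <= v -> v <= 1 ->
  (forall i, absv (f i - 1) <= v) -> absv (\prod_i f i - 1) <= v.
Proof.
move=> v0 v1 fv; elim/big_rec: _ => [|i x _ xv]; first by rewrite subrr absv0.
have -> : f i * x - 1 = (f i - 1) * x + (x - 1) by ring.
apply: absvD_le => //; rewrite absvM -[v]mulr1 ler_pM ?absv_ge0//.
by rewrite (@absv_near_le _ _ _ 1) ?absv1// (le_trans xv).
Qed.

Lemma absv_det_near1 n (A : 'M[F]_n) v : 0 <= v -> v < 1 -> mxle v (A - 1%:M) ->
  absv (\det A) = 1.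
Proof.
move=> v0 v1 Av; have A1 : mxle 1 A.
  rewrite -[A](subrK 1%:M); apply: mxleD; last exact: mxle1.
  by apply: mxle_le Av; exact: ltW.
have h : absv (\det A - 1) <= v.
  rewrite /determinant (bigD1 1%g)//= odd_perm1 expr0 mul1r addrAC.
  apply: absvD_le.
    apply: absv_prod_near1 => // [|i]; first exact: ltW.
    by have := Av i i; rewrite !mxE perm1 eqxx.
  apply: absv_sum_le => // s s1.
  have [i si] : exists i, s i != i.
    apply/existsP; apply: contra_neqT s1 => /existsPn h; apply/permP => i.
    by rewrite perm1; have := h i; rewrite negbK => /eqP.
  rewrite absvM (bigD1 i)//= absvM mulrCA -[v]mulr1 ler_pM ?absv_ge0 ?mulr_ge0 ?absv_ge0//.
    by have := Av i (s i); rewrite !mxE eq_sym (negPf si) subr0.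
  rewrite -absvM absvM_le1//; last by apply: absv_prod_le1 => k _; exact: A1.
  by case: (odd_perm s); rewrite ?expr1 ?expr0 ?absvN absv1.
apply/eqP; rewrite eq_le (absv_det_le1 A1)/= leNgt; apply/negP => dA.
have m1 : Num.max v (absv (\det A)) < 1 by rewrite gt_max v1.
suff : absv (1 : F) < 1 by rewrite absv1 ltxx.
apply: le_lt_trans m1; rewrite -[X in absv X](subKr (\det A)) addrC.
by rewrite (le_trans (absvD _ _))// absvN ge_max !le_max h lexx orbT.
Qed.

Lemma GLO_extend_rows k l (M : 'M[F]_(k, k + l)) v : 0 <= v -> v < 1 -> mxle 1 M ->
  (forall j : 'I_k, exists c, forall i, absv (M i c - (i == j)%:R) <= v) ->
  exists G G', GLO G G' /\ usubmx (G : 'M[F]_(k + l)) = M.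
Proof.
move=> v0 v1 M1 /choice[c cP].
have ci : injective c.
  move=> i j cij; apply/eqP; apply: contraT => ij.
  have := absvB_le (cP i i) (cP j i); rewrite eqxx (negPf ij) cij.
  by rewrite subr0 addrAC subrr add0r absvN absv1 leNgt v1.
have [s sP] := perm_extend (@lshift_inj k l) ci.
pose W := col_perm s M; pose G : 'M[F]_(k + l) := block_mx (lsubmx W) (rsubmx W) 0 1%:M.
have W1 : mxle 1 W by move=> i j; rewrite mxE.
have GG : GLO G (invmx G).
  apply: GLO_det.
    by apply: mxle_block => [i j|i j||]; rewrite ?mxE; [exact: M1|exact: M1|exact: mxle0|exact: mxle1].
  rewrite det_ublock det1 mulr1; apply: (absv_det_near1 v0 v1) => i j.
  by rewrite !mxE sP.
exists (G *m perm_mx s), ((perm_mx s)^T *m invmx G); split.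
  exact: GLO_mul GG (GLO_perm s).
rewrite -mul_usub_mx /G /block_mx col_mxKu hsubmxK /W col_permE -mulmxA -perm_mxM.
by rewrite mulVg perm_mx1 mulmx1.
Qed.

End ExtendRows.

Section HaarSums.
Context {R : realType} {F : nonArchFieldType R} (e : R) (E : residue_system F e).
Context (e1 : e <= 1) (k n : nat).

Definition intmx := {ffun 'I_n -> {ffun 'I_k -> E}}.

Definition mxval (w : intmx) : 'M[F]_(k, n) := \matrix_(i, j) res_val (w j i).

Definition mxcls (M : 'M[F]_(k, n)) : intmx := [ffun j => [ffun i => res_cls E (M i j)]].

Lemma mxval_int w : mxle 1 (mxval w).
Proof. by move=> i j; rewrite mxE res_val_int. Qed.

Lemma mxval_cls M : mxle 1 M -> mxle e (M - mxval (mxcls M)).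
Proof. by move=> M1 i j; rewrite !mxE !ffunE; exact: res_valP. Qed.

Lemma mxvalK : cancel mxval mxcls.
Proof. by move=> w; apply/ffunP => j; apply/ffunP => i; rewrite !ffunE mxE res_valK. Qed.

Lemma mxcls_eq M N : mxle 1 M -> mxle 1 N -> mxle e (M - N) -> mxcls M = mxcls N.
Proof.
move=> M1 N1 MN; apply/ffunP => j; apply/ffunP => i; rewrite !ffunE.
by apply: res_cls_eq => //; have := MN i j; rewrite !mxE.
Qed.

Definition near_invariant (A : Type) (f : 'M[F]_(k, n) -> A) :=
  forall M N, mxle 1 M -> mxle 1 N -> mxle e (M - N) -> f M = f N.

Lemma sum_mxval_reindex (f : 'M[F]_(k, n) -> R) (T T' : 'M[F]_(k, n) -> 'M[F]_(k, n)) :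
  near_invariant f -> (forall M, mxle 1 M -> mxle 1 (T M)) ->
  (forall M N, mxle e (M - N) -> mxle e (T' M - T' N)) -> cancel T T' ->
  \sum_w f (T (mxval w)) = \sum_w f (mxval w).
Proof.
move=> fe T1 T'e TK; rewrite [RHS](reindex_inj (h := fun w => mxcls (T (mxval w))))/=.
  by apply: eq_bigr => w _; apply: fe; [exact/T1/mxval_int|exact: mxval_int|exact/mxval_cls/T1/mxval_int].
move=> w w' ww; rewrite -(mxvalK w) -(mxvalK w'); apply: mxcls_eq; try exact: mxval_int.
rewrite -(TK (mxval w)) -(TK (mxval w')); apply: T'e.
have h x := mxval_cls (T1 _ (mxval_int x)).
have := mxleB (h w) (h w'); rewrite ww.
by rewrite opprB addrA subrK.
Qed.

Hypothesis e0 : 0 <= e.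

Lemma sum_mxval_mull (f : 'M[F]_(k, n) -> R) G G' : near_invariant f -> GLO G G' ->
  \sum_w f (G *m mxval w) = \sum_w f (mxval w).
Proof.
move=> fe [G1 G1' GG' G'G].
apply: (@sum_mxval_reindex f (mulmx G) (mulmx G')) => // [M M1|M N MN|M].
- exact: mxleM1l.
- by rewrite -mulmxBr; exact: mxleM1l.
- by rewrite mulmxA G'G mul1mx.
Qed.

Lemma sum_mxval_mulr (f : 'M[F]_(k, n) -> R) H H' : near_invariant f -> GLO H H' ->
  \sum_w f (mxval w *m H) = \sum_w f (mxval w).
Proof.
move=> fe [H1 H1' HH' H'H].
apply: (@sum_mxval_reindex f (mulmxr H) (mulmxr H')) => // [M M1|M N MN|M] /=.
- exact: mxleM1r.
- by rewrite -mulmxBl; exact: mxleM1r.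
- by rewrite -mulmxA HH' mulmx1.
Qed.

Definition mixmx (I : pred 'I_n) (u v : intmx) : intmx := [ffun j => if I j then u j else v j].

Lemma sum_mixmx I (f : intmx -> R) :
  \sum_u \sum_v f (mixmx I u v) = #|{: intmx}|%:R * \sum_w f w.
Proof.
rewrite (pair_bigA _ (fun u v => f (mixmx I u v)))/=.
pose h (p : intmx * intmx) := (mixmx I p.1 p.2, mixmx I p.2 p.1).
have hK : involutive h.
  by move=> [u v]; congr pair; apply/ffunP => j; rewrite !ffunE/= ?ffunE; case: (I j).
rewrite (reindex_inj (can_inj hK)) (eq_bigr (fun p => f p.1)) => [|[u v] _]; last first.
  by congr f; apply/ffunP => j; rewrite !ffunE/= ?ffunE; case: (I j).
rewrite -(pair_bigA _ (fun u _ => f u))/= mulr_sumr; apply: eq_bigr => u _.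
by rewrite sumr_const mulr_natl.
Qed.

Context (v : R) (V : residue_system F v) (v0 : 0 <= v) (ev : e <= v) (v1 : v < 1).

Lemma residue_mass a : absv a <= 1 ->
  #|E|%:R <= #|V|%:R * \sum_(t : E) (absv (res_val t - a) <= v)%R%:R :> R.
Proof.
move=> a1; have inv b : absv b <= 1 ->
    \sum_(t : E) (absv (res_val t - b) <= v)%R%:R =
    \sum_(t : E) (absv (res_val t - a) <= v)%R%:R :> R.
  move=> b1; rewrite -(@res_shift _ _ _ E (fun x => (absv (x - a) <= v)%R%:R) (a - b))//.
  - by apply: eq_bigr => t _; rewrite -addrA [a - b]addrC addrK.
  - exact: absvB_le.
  - move=> x y _ _ xy; congr (nat_of_bool _)%:R; apply: absv_near_le.
    by rewrite opprB addrA subrK (le_trans xy).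
rewrite -[X in X%:R * _]sum1_card natr_sum mulr_suml -[X in X%:R <= _]sum1_card natr_sum.
rewrite (eq_bigr (fun b : V => \sum_(t : E) (absv (res_val t - res_val b) <= v)%R%:R)).
  rewrite exchange_big/=; apply: ler_sum => t _.
  rewrite (bigD1 (res_cls V (res_val t)))//= res_valP ?res_val_int// lerDl.
  exact: sumr_ge0.
by move=> b _; rewrite mul1r inv// res_val_int.
Qed.

Definition good (w : intmx) := [forall j : 'I_k, exists c, forall i,
  absv (mxval w i c - (i == j)%:R) <= v].

(* The columns are independent, and each of them is close to a given basis vector
   with probability at least [#|V|^-k]. *)
Lemma bad_sum : \sum_(w : intmx) (~~ good w)%:R <=
  k%:R * (1 - #|V|%:R^-1 ^+ k) ^+ n * #|{: intmx}|%:R :> R.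
Proof.
pose hit (j : 'I_k) (x : {ffun 'I_k -> E}) : R :=
  \prod_i (absv (res_val (x i) - (i == j)%:R) <= v)%R%:R.
have hitE j x : hit j x = [forall i, absv (res_val (x i) - (i == j)%:R) <= v]%:R.
  have [/forallP h|/forallPn[i /negPf h]] :=
      boolP [forall i, absv (res_val (x i) - (i == j)%:R) <= v].
    by rewrite /hit big1// => i _; rewrite h.
  by rewrite /hit (bigD1 i)//= h mul0r.
have V0 : (0 < #|V|)%N by apply/card_gt0P; exists (res_cls V 0).
have E0 : (0 < #|E|)%N by apply/card_gt0P; exists (res_cls E 0).
set K := #|V|%:R^-1.
have sum_hit j : \sum_x (1 - hit j x) <= (1 - K ^+ k) * #|{ffun 'I_k -> E}|%:R.
  rewrite sumrB mulrBl mul1r sumr_const lerD2l lerNl opprK.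
  rewrite -(bigA_distr_bigA (fun i (t : E) => (absv (res_val t - (i == j)%:R) <= v)%R%:R))/=.
  rewrite card_ffun natrX card_ord -exprMn -{1}[k]card_ord -prodr_const.
  apply: ler_prod => i _; rewrite mulr_ge0 ?invr_ge0//= ler_pdivrMl ?ltr0n//.
  by apply: residue_mass; case: eqP => _; rewrite ?absv1 ?absv0.
have bad_le w : (~~ good w)%:R <= \sum_j \prod_c (1 - hit j (w c)).
  have hit01 j x : 0 <= 1 - hit j x by rewrite hitE subr_ge0 lern1 leq_b1.
  have [_|/forallPn[j /existsPn nj]] := boolP (good w).
    by apply: sumr_ge0 => j _; exact: prodr_ge0.
  rewrite (bigD1 j)//= big1 ?lerDl ?sumr_ge0// => [i _|c _]; first exact: prodr_ge0.
  rewrite hitE (_ : [forall _, _] = false) ?subr0//; apply/negbTE; apply: contra (nj c).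
  by move=> /forallP h; apply/forallP => i; rewrite mxE.
apply: le_trans (ler_sum _ (fun w _ => bad_le w)) _.
rewrite exchange_big/= -mulrA mulr_natl -[X in _ *+ X]card_ord -sumr_const.
apply: ler_sum => j _; rewrite -(bigA_distr_bigA (fun _ x => 1 - hit j x))/=.
rewrite card_ffun card_ord natrX -exprMn -[X in _ ^+ X]card_ord -prodr_const.
apply: ler_prod => c _; rewrite sum_hit andbT sumr_ge0// => x _.
by rewrite hitE subr_ge0 lern1 leq_b1.
Qed.

Lemma goodP w : good w ->
  forall j : 'I_k, exists c, forall i, absv (mxval w i c - (i == j)%:R) <= v.
Proof. by move=> /forallP gw j; have /existsP[c /forallP] := gw j; exists c. Qed.

End HaarSums.

Lemma expr_small (R : realType) (a C d : R) : 0 <= a < 1 -> 0 < d ->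
  exists n, C * a ^+ n <= d.
Proof.
move=> /andP[a0 a1] d0; have C1 : 0 < `|C| + 1 by rewrite ltr_pwDr.
have a1' : `|a| < 1 by rewrite ger0_norm.
have /cvgrPdist_le/(_ _ (divr_gt0 d0 C1))[n _ /(_ n (leqnn n))] := cvg_expr a1'.
rewrite /= sub0r normrN ger0_norm ?exprn_ge0// ler_pdivlMr// => h; exists n.
apply: le_trans h; rewrite [leRHS]mulrC ler_wpM2r ?exprn_ge0//.
by rewrite (le_trans (ler_norm C))// lerDl.
Qed.

Section SkewLaw.
Context {R : realType} {F : nonArchFieldType R}
  (F_nondiscrete : ~ (forall A : set F, open A))
  (F_locally_compact : locally_compact [set: F]) (two_neq0 : (2%:R : F) != 0).

Definition saturated n (e : R) (B : set 'M[F]_n) :=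
  forall M N, mxle e (M - N) -> B M = B N.

Definition near_skew n r e (X : infmx F) := exists Y : 'M[F]_n,
  [/\ mxle e (corner n X - Y), Y^T = - Y & mxle r Y].

Record skew_law (Q : probability (borel (infmx F)) R) := {
  skew_law_conj : forall n (h : 'M[F]_n -> R) G G', test h -> GLO G G' ->
    Ex Q (fun X => h (G *m corner n X *m G^T)) = Ex Q (h \o corner n) ;
  skew_law_tight : forall n e d, 0 < e -> 0 < d -> exists2 r, 0 < r &
    Pr Q (~` near_skew n r e) <= d
}.

Section Half.
Context (n : nat) (e r : R) (e0 : 0 < e) (r0 : 0 < r).

Lemma cyl_near_skew : cyl (near_skew n r e).
Proof.
have le_near X X' : mxnear n e X X' -> near_skew n r e X -> near_skew n r e X'.
  move=> /mxnear_sym/mxnear_corner XX' [Y [XY sY rY]]; exists Y; split=> //.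
  by have := mxleD XX' XY; rewrite addrA subrK.
exists n, e; split=> // X X' XX'; apply/propext; split; apply: le_near => //.
exact: mxnear_sym.
Qed.

Definition half_spec (X : infmx F) (S : 'M[F]_n) := exists Y H H' I,
  [/\ mxle e (corner n X - Y), mxle r Y, GLO H H', bipartite I S & H *m Y *m H^T = S - S^T].

(* The choice by [xget] depends on the set [half_spec X] only, hence on the class
   of [X] at precision [e]: this makes [half] locally constant. *)
Definition half (X : infmx F) : 'M[F]_n := xget 0 [set S | half_spec X S].

Lemma cyl_half : cyl half.
Proof.
have le_near X X' S : mxnear n e X X' -> half_spec X S -> half_spec X' S.
  move=> /mxnear_sym/mxnear_corner XX' [Y [H [H' [I [XY rY HH bS HY]]]]].
  exists Y, H, H', I; split=> //.
  by have := mxleD XX' XY; rewrite addrA subrK.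
exists n, e; split=> // X X' XX'; congr xget; apply/seteqP; split=> S; apply: le_near => //.
exact: mxnear_sym.
Qed.

Lemma GLO_conj_le (H H' Y : 'M[F]_n) a : 0 <= a -> GLO H H' -> mxle a Y -> mxle a (H *m Y *m H^T).
Proof.
by move=> a0 [H1 _ _ _] Ya; apply: mxleM1r => //; [exact: mxleM1l|exact: mxle_tr].
Qed.

Lemma half_le X : mxle r (half X).
Proof.
rewrite /half; case: xgetP => [S _ [Y [H [H' [I [_ rY HH bS HY]]]]]|_]; last exact/mxle0/ltW.
by apply: bipartite_mxle bS _; [exact: ltW|rewrite -HY; apply: GLO_conj_le HH rY; exact: ltW].
Qed.

Lemma halfP X : near_skew n r e X -> exists H H' I,
  [/\ GLO H H', bipartite I (half X) & mxle e (H *m corner n X *m H^T - (half X - (half X)^T))].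
Proof.
move=> [Y [XY sY rY]].
have [H [H' [S [I [HH HS bS]]]]] := skew_bipartite two_neq0 sY.
have : half_spec X (half X).
  by apply: (@xgetPex _ 0 [set S | half_spec X S]); exists S, Y, H, H', I.
move=> [Y' [K [K' [J [XY' _ KK bJ KY]]]]]; exists K, K', J; split=> //.
by rewrite -KY -mulmxBl -mulmxBr; apply: GLO_conj_le KK XY'; exact: ltW.
Qed.

Lemma near_skew_le X : e <= r -> near_skew n r e X -> mxle r (corner n X).
Proof.
by move=> er [Y [XY _ rY]]; rewrite -[corner n X](subrK Y); apply: mxleD => //; exact: mxle_le XY.
Qed.

End Half.

(* [u] is only used on the columns in [I] and [v] on the others, so that the two
   independent matrices can be replaced by a single one. *)
Lemma bipartite_mix n k eta (E : residue_system F eta) (I : pred 'I_n) (S : 'M[F]_n) (u v : intmx E k n) :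
  bipartite I S ->
  mxval u *m S *m (mxval v)^T = mxval (mixmx I u v) *m S *m (mxval (mixmx I u v))^T.
Proof.
move=> IS; apply/matrixP => i j; rewrite !mxE; apply: eq_bigr => l _.
rewrite !mxE !mulr_suml; apply: eq_bigr => l' _; rewrite !mxE !ffunE.
have [/andP[-> /negPf ->]//|h] := boolP (I l' && ~~ I l).
by rewrite (IS _ _ h) !mulr0 !mul0r.
Qed.

Section FiniteContent.
Context (Q : probability (borel (infmx F)) R) (Q_skew : skew_law Q).
Context (k l : nat) (e r eta v : R) (e0 : 0 < e) (r0 : 0 < r) (er : e <= r).
Context (eta0 : 0 < eta) (eta_r : eta * r <= e) (v0 : 0 <= v) (etav : eta <= v) (v1 : v < 1).
Context (E : residue_system F eta) (V : residue_system F v).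

Let n := (k + l)%N.
Let U : R := #|{: intmx E k n}|%:R.
Let half' : infmx F -> 'M[F]_n := half n e r.

Let eta1 : eta <= 1. Proof. by rewrite (le_trans etav)// ltW. Qed.

Let U0 : 0 < U.
Proof.
by rewrite ltr0n; apply/card_gt0P; exists [ffun => [ffun => res_cls E 0]].
Qed.

Let trial (u w : intmx E k n) (X : infmx F) : 'M[F]_k :=
  mxval u *m half' X *m (mxval w)^T.

Let cyl_trial A (f : 'M[F]_k -> A) u w : cyl (fun X => f (trial u w X)).
Proof.
exact: (cyl_comp (fun S : 'M[F]_n => f (mxval u *m S *m (mxval w)^T)) (cyl_half n r e0)).
Qed.

Let avg (B : set (infmx F)) : R := U ^- 2 *
  \sum_(u : intmx E k n) \sum_(w : intmx E k n) Pr Q [set X | B (extmx (trial u w X))].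

Let avg_ge0 B : 0 <= avg B.
Proof.
apply: mulr_ge0; first by rewrite invr_ge0 exprn_ge0// ltW.
by apply: sumr_ge0 => u _; apply: sumr_ge0 => w _; exact: Pr_ge0.
Qed.

Let avgT : avg setT = 1.
Proof.
rewrite /avg (eq_bigr (fun=> U)) => [|u _]; last first.
  by rewrite (eq_bigr (fun=> 1)) ?sumr_const// => w _; exact: PrT.
by rewrite sumr_const -mulr_natl -expr2 mulVf// expf_neq0// gt_eqF.
Qed.

Let avgU A B : cyl A -> cyl B -> A `&` B = set0 -> avg (A `|` B) = avg A + avg B.
Proof.
move=> cA cB AB; rewrite /avg -mulrDr -big_split/=; congr (_ * _).
apply: eq_bigr => u _; rewrite -big_split/=; apply: eq_bigr => w _.
rewrite -PrU//; try exact: (cyl_measurable (cyl_trial (fun M => _ (extmx M)) u w)).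
apply/seteqP; split=> // X [AX BX].
by have : (A `&` B) (extmx (trial u w X)) by []; rewrite AB.
Qed.

Definition trial_content : cyl_content F := Build_cyl_content avg_ge0 avgT avgU.

Let corner_extmx m (M : 'M[F]_m) : corner m (extmx M) = M.
Proof. by apply/matrixP => i j; rewrite mxE extmx_in. Qed.

Let avg2 (B : set 'M[F]_k) (S : 'M[F]_n) : R := U ^- 2 *
  \sum_(u : intmx E k n) \sum_(w : intmx E k n) \1_B (mxval u *m S *m (mxval w)^T).

Let bmeas_avg2 B : bmeas (fun X : borel (infmx F) => avg2 B (half' X)).
Proof.
apply: bmeasZ; apply: bmeas_sum => u _; apply: bmeas_sum => w _.
apply: (@cyl_bmeas _ _ _ 1); first exact: (cyl_trial (\1_B : _ -> R)).
by move=> X; exact: normr_indic_le1.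
Qed.

Let trial_contentE B : tc trial_content (corner k @^-1` B) = Ex Q (fun X => avg2 B (half' X)).
Proof.
have bt u w : bmeas (fun X : borel (infmx F) => \1_B (trial u w X) : R).
  apply: (@cyl_bmeas _ _ _ 1); first exact: (cyl_trial (\1_B : _ -> R)).
  by move=> X; exact: normr_indic_le1.
rewrite /= /avg /avg2 ExZ; last by apply: bmeas_sum => u _; apply: bmeas_sum => w _; exact: bt.
congr (_ * _); rewrite Ex_sum => [|u _]; last by apply: bmeas_sum => w _; exact: bt.
apply: eq_bigr => u _; rewrite Ex_sum => [|w _]; last exact: bt.
apply: eq_bigr => w _; rewrite -Ex_indic; last first.
  exact: (cyl_measurable (cyl_trial (fun M => B (corner k (extmx M))) u w)).
apply: eq_Ex => X; rewrite !indicE; congr (nat_of_bool _)%:R.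
by apply/idP/idP => /set_mem/= h; apply: mem_set => /=; move: h; rewrite corner_extmx.
Qed.

Let eqB (B : set 'M[F]_k) M N : B M = B N -> \1_B M = \1_B N :> R.
Proof.
move=> BMN; rewrite !indicE; congr (nat_of_bool _)%:R.
by apply/idP/idP => /set_mem h; apply: mem_set; rewrite ?BMN// -BMN.
Qed.

Let prod3_le m1 m2 m3 m4 (A : 'M[F]_(m1, m2)) (S : 'M[F]_(m2, m3)) (C : 'M[F]_(m3, m4)) a c :
  0 <= a -> 0 <= c -> mxle a A -> mxle r S -> mxle c C -> mxle (a * r * c) (A *m S *m C).
Proof.
move=> a0 c0 Aa Sr Cc; apply: mxleM => //; first by rewrite mulr_ge0// ltW.
by apply: mxleM => //; exact: ltW.
Qed.

Let avg2_inv B S G G' H H' : saturated e B -> mxle r S -> GLO G G' -> GLO H H' ->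
  avg2 [set M | B (G *m M *m H)] S = avg2 B S.
Proof.
move=> sB Sr GG HH; have [G1 _ _ _] := GG; have [H1 _ _ _] := HH.
have eta_r' : 1 * r * eta <= e by rewrite mul1r mulrC.
have eta_r'' : eta * r * 1 <= e by rewrite mulr1.
rewrite /avg2; congr (_ * _).
have -> : \sum_(u : intmx E k n) \sum_(w : intmx E k n)
      \1_[set M | B (G *m M *m H)] (mxval u *m S *m (mxval w)^T) =
    \sum_(u : intmx E k n) \sum_(w : intmx E k n)
      \1_B ((G *m mxval u) *m S *m (H^T *m mxval w)^T) :> R.
  apply: eq_bigr => u _; apply: eq_bigr => w _; rewrite !indicE trmx_mul trmxK !mulmxA.
  by congr (nat_of_bool _)%:R; apply/idP/idP => /set_mem/= h; apply: mem_set; move: h; rewrite /= !mulmxA.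
rewrite exchange_big/= [RHS]exchange_big/=.
transitivity (\sum_(w : intmx E k n) \sum_(u : intmx E k n)
    \1_B (mxval u *m S *m (H^T *m mxval w)^T) : R).
  apply: eq_bigr => w _.
  apply: (sum_mxval_mull E (ltW eta0) (f := fun M => \1_B (M *m S *m (H^T *m mxval w)^T)) _ GG).
  move=> M N M1 N1 MN; apply/eqB/sB; rewrite -!mulmxBl; apply: mxle_le eta_r'' _.
  apply: prod3_le => //; [exact: ltW|apply: mxle_tr].
  by apply: mxleM1l => //; [exact: mxle_tr|exact: mxval_int].
rewrite exchange_big/= [RHS]exchange_big/=; apply: eq_bigr => u _.
apply: (sum_mxval_mull E (ltW eta0) (f := fun M => \1_B (mxval u *m S *m M^T)) _ (GLO_tr HH)).
move=> M N M1 N1 MN; apply/eqB/sB; rewrite -mulmxBr -linearB/=; apply: mxle_le eta_r' _.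
by apply: prod3_le => //; [exact: ltW|exact: mxval_int|exact: mxle_tr].
Qed.

Lemma trial_content_inv B G G' H H' : saturated e B -> GLO G G' -> GLO H H' ->
  tc trial_content [set X | B (G *m corner k X *m H)] = tc trial_content (corner k @^-1` B).
Proof.
move=> sB GG HH.
rewrite -[X in tc _ X]/(corner k @^-1` [set M | B (G *m M *m H)]) !trial_contentE.
by apply: eq_Ex => X; exact: (avg2_inv sB (half_le _ _ _) GG HH).
Qed.

Let conj_avg (B : set 'M[F]_k) (A : 'M[F]_n) : R :=
  U^-1 * \sum_(w : intmx E k n) \1_B (mxval w *m A *m (mxval w)^T).

Let avg2_tau B X : saturated e B -> near_skew n r e X ->
  avg2 [set M | B (M - M^T)] (half' X) = conj_avg B (corner n X).
Proof.
move=> sB nX; have [H [H' [I [HH bS HS]]]] := halfP e0 nX.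
have Xr := near_skew_le er nX; have [H1 _ _ _] := HH.
pose f (w : intmx E k n) : R := \1_[set M | B (M - M^T)] (mxval w *m half' X *m (mxval w)^T).
rewrite /avg2 /conj_avg.
have -> : \sum_(u : intmx E k n) \sum_(w : intmx E k n)
    \1_[set M | B (M - M^T)] (mxval u *m half' X *m (mxval w)^T) =
    \sum_(u : intmx E k n) \sum_(w : intmx E k n) f (mixmx I u w).
  by apply: eq_bigr => u _; apply: eq_bigr => w _; rewrite (bipartite_mix _ _ bS).
rewrite sum_mixmx expr2 invfM -mulrA mulKf ?gt_eqF//; congr (_ * _).
rewrite -(sum_mxval_mulr E (ltW eta0) (f := fun W => \1_B (W *m corner n X *m W^T)) _ HH).
  apply: eq_bigr => w _; rewrite /f.
  have := eqB (B := [set M | B (M - M^T)]); rewrite indicE.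
  move=> _; rewrite indicE; congr (nat_of_bool _)%:R.
  suff BE : B (mxval w *m half' X *m (mxval w)^T - (mxval w *m half' X *m (mxval w)^T)^T) =
      B (mxval w *m H *m corner n X *m (mxval w *m H)^T).
    by apply/idP/idP => /set_mem/= h; apply: mem_set => /=; move: h; rewrite BE.
  symmetry; apply: sB; rewrite !trmx_mul trmxK.
  rewrite (_ : _ - _ = mxval w *m (H *m corner n X *m H^T - (half' X - (half' X)^T)) *m (mxval w)^T).
    apply: mxleM1r; [exact: ltW| |exact/mxle_tr/mxval_int].
    by apply: mxleM1l => //; [exact: ltW|exact: mxval_int].
  by rewrite !mulmxBr !mulmxBl !mulmxA.
move=> M N M1 N1 MN; apply/eqB/sB.
rewrite (_ : _ - _ = (M - N) *m corner n X *m M^T + N *m corner n X *m (M - N)^T); last first.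
  by rewrite !mulmxBl linearB/= mulmxBr addrA subrK.
apply: mxleD.
  have eta_r' : eta * r * 1 <= e by rewrite mulr1.
  apply: mxle_le eta_r' _.
  by apply: prod3_le => //; [exact: ltW|exact: mxle_tr].
have eta_r' : 1 * r * eta <= e by rewrite mul1r mulrC.
apply: mxle_le eta_r' _.
by apply: prod3_le => //; [exact: ltW|exact: mxle_tr].
Qed.

Let ulsub_corner (X : infmx F) : ulsubmx (corner n X) = corner k X.
Proof. by apply/matrixP => i j; rewrite !mxE. Qed.

Let test_conj (B : set 'M[F]_k) (G : 'M[F]_(k, n)) : mxle 1 G -> saturated e B ->
  test (fun A : 'M[F]_n => \1_B (G *m A *m G^T)).
Proof.
move=> G1 sB; split=> [|Y]; last exact: normr_indic_le1.
apply: (@cyl_corner _ _ _ n (fun A => \1_B (G *m A *m G^T) : R) e e0) => M N MN.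
apply/eqB/sB; rewrite -mulmxBl -mulmxBr.
by apply: mxleM1r; [exact: ltW|apply: mxleM1l => //; exact: ltW|exact: mxle_tr].
Qed.

Let bmeas_conj B w : saturated e B ->
  bmeas (fun X : borel (infmx F) => \1_B (mxval (w : intmx E k n) *m corner n X *m (mxval w)^T) : R).
Proof. by move=> sB; exact: (test_bmeas (test_conj (mxval_int w) sB)). Qed.

Let Ex_good B w : saturated e B -> good v w ->
  Ex Q (fun X => \1_B (mxval (w : intmx E k n) *m corner n X *m (mxval w)^T)) =
  Pr Q (corner k @^-1` B).
Proof.
move=> sB gw; have [G [G' [GG Gw]]] := GLO_extend_rows v0 v1 (mxval_int w) (goodP gw).
have tB : test (fun Y : 'M[F]_n => \1_B (ulsubmx Y)).
  split=> [|Y]; last exact: normr_indic_le1.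
  apply: (@cyl_corner _ _ _ n (fun Y => \1_B (ulsubmx Y) : R) e e0) => M N MN.
  by apply/eqB/sB => i j; have := MN (lshift l i) (lshift l j); rewrite !mxE.
have cB : cyl (corner k @^-1` B : set (infmx F)).
  by apply: (@cyl_corner _ _ _ k (fun M => B M : Prop) e e0) => M N; exact: sB.
rewrite -Ex_indic; last exact: cyl_measurable.
transitivity (Ex Q ((fun Y : 'M[F]_n => \1_B (ulsubmx Y) : R) \o corner n)); last first.
  by apply: eq_Ex => X; rewrite /= ulsub_corner !indicE.
rewrite -(skew_law_conj Q_skew tB GG); apply: eq_Ex => X; congr (\1_B _).
by rewrite /ulsubmx -!mul_usub_mx -mulmx_lsub -trmx_usub Gw.
Qed.

Lemma trial_content_tau B d : saturated e B ->
  k%:R * (1 - #|V|%:R^-1 ^+ k) ^+ n <= d -> Pr Q (~` near_skew n r e) <= d ->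
  `|tc trial_content [set X | B (corner k X - (corner k X)^T)] - Pr Q (corner k @^-1` B)| <= d + d.
Proof.
move=> sB kd nd; have cN := cyl_near_skew n r e0.
have mN : measurable (~` near_skew n r e : set (borel (infmx F))).
  by apply: cyl_measurable; exact: cyl_setC.
rewrite -[X in tc _ X]/(corner k @^-1` [set M | B (M - M^T)]) trial_contentE.
have bC : bmeas (fun X : borel (infmx F) => conj_avg B (corner n X)).
  by apply: bmeasZ; apply: bmeas_sum => w _; exact: bmeas_conj.
have sum01 (f : intmx E k n -> R) : (forall w, 0 <= f w <= 1) -> 0 <= U^-1 * \sum_w f w <= 1.
  move=> f01; apply/andP; split.
    apply: mulr_ge0; [by rewrite invr_ge0 ltW|apply: sumr_ge0 => w _; by have /andP[] := f01 w].
  rewrite ler_pdivrMl// mulr1 /U -sumr_const; apply: ler_sum => w _.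
  by have /andP[] := f01 w.
have ind01 (A : set 'M[F]_k) M : 0 <= (\1_A M : R) <= 1 by rewrite indicE ler0n lern1 leq_b1.
have avg01 A S : 0 <= avg2 A S <= 1.
  rewrite /avg2 expr2 invfM -mulrA mulr_sumr; apply: (sum01 (fun u => U^-1 * _)) => u.
  by apply: (sum01 (fun w => _)) => w.
apply: le_trans (ler_distD (Ex Q (fun X => conj_avg B (corner n X))) _ _) _.
apply: lerD.
  rewrite -ExB//; apply: le_trans nd; rewrite -Ex_indic//.
  apply: normr_Ex_le; [exact: bmeasB|exact: bmeas_indic|move=> X].
  have [nX|nX] := pselect (near_skew n r e X).
    by rewrite avg2_tau// subrr normr0 indicE.
  rewrite [X in _ <= X]indicE mem_set//=.
  have /andP[a0 a1] := avg01 [set M | B (M - M^T)] (half' X).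
  have /andP[c0 c1] : 0 <= conj_avg B (corner n X) <= 1 by apply: (sum01 (fun w => _)) => w.
  by rewrite ler_norml; apply/andP; split; lra.
apply: le_trans kd; rewrite /conj_avg ExZ; last by apply: bmeas_sum => w _; exact: bmeas_conj.
rewrite Ex_sum => [|w _]; last exact: bmeas_conj.
have {1}-> : Pr Q (corner k @^-1` B) = U^-1 * \sum_(w : intmx E k n) Pr Q (corner k @^-1` B).
  by rewrite sumr_const -[X in _ * X]mulr_natl mulKf// gt_eqF.
have Ui0 : 0 <= U^-1 by rewrite invr_ge0 ltW.
rewrite -mulrBr -sumrB normrM (ger0_norm Ui0) (ler_pdivrMl _ _ U0) mulrC.
apply: le_trans (bad_sum E eta1 k n V etav).
apply: le_trans (ler_norm_sum _ _ _) _; apply: ler_sum => w _.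
have [gw|_] := boolP (good v w); first by rewrite Ex_good// subrr normr0.
have cB : cyl (corner k @^-1` B : set (infmx F)).
  by apply: (@cyl_corner _ _ _ k (fun M => B M : Prop) e e0) => M N; exact: sB.
have p0 := Pr_ge0 Q (corner k @^-1` B); have p1 := Pr_le1 Q (cyl_measurable cB).
have := normr_Ex_le_cst Q (bmeas_conj w sB) (fun X => (test_conj (mxval_int w) sB).2 (corner n X)).
have : 0 <= Ex Q (fun X => \1_B (mxval w *m corner n X *m (mxval w)^T)) by apply: Ex_ge0 => X; rewrite indicE.
move=> E0; rewrite ger0_norm// => E1.
by rewrite ler_norml/=; apply/andP; split; lra.
Qed.

End FiniteContent.

Lemma finite_content (Q : probability (borel (infmx F)) R) k e d : skew_law Q ->
  0 < e -> 0 < d -> exists m : cyl_content F, forall B : set 'M[F]_k, saturated e B ->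
    (forall G G' H H', GLO G G' -> GLO H H' ->
      tc m [set X | B (G *m corner k X *m H)] = tc m (corner k @^-1` B)) /\
    `|tc m [set X | B (corner k X - (corner k X)^T)] - Pr Q (corner k @^-1` B)| <= d.
Proof.
move=> Qs e0 d0; have d2 : 0 < d / 2%:R by rewrite divr_gt0.
have [x x0 v1] := exists_absv_lt1 F_nondiscrete; set v := absv x in v1.
have v0 : 0 < v by rewrite absv_gt0.
have [V] := exists_residue_system F_nondiscrete F_locally_compact v0 (ltW v1).
have V0 : (0 < #|V|)%N by apply/card_gt0P; exists (res_cls V 0).
have K01 : 0 < (#|V|%:R^-1 : R) ^+ k <= 1.
  by rewrite exprn_gt0 ?invr_gt0 ?ltr0n//= exprn_ile1 ?invr_ge0// invf_le1 ?ltr0n// ler1n.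
have a01 : 0 <= 1 - (#|V|%:R^-1 : R) ^+ k < 1 by lra.
have [l ld] := expr_small k%:R a01 d2.
have ld' : k%:R * (1 - #|V|%:R^-1 ^+ k) ^+ (k + l) <= d / 2%:R.
  apply: le_trans ld; rewrite ler_wpM2l// exprD ler_piMl//.
    by rewrite exprn_ge0//; lra.
  by rewrite exprn_ile1//; lra.
have [r' r'0 rQ] := skew_law_tight Qs (k + l) e0 d2.
pose r := Num.max r' e; have r0 : 0 < r by rewrite lt_max r'0.
have er : e <= r by rewrite le_max lexx orbT.
have rQ' : Pr Q (~` near_skew (k + l) r e) <= d / 2%:R.
  apply: le_trans rQ; apply: le_Pr.
  - by apply: cyl_measurable; apply: cyl_setC; exact: cyl_near_skew.
  - by apply: cyl_measurable; apply: cyl_setC; exact: cyl_near_skew.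
  move=> X nX [Y [XY sY rY]]; apply: nX; exists Y; split=> //.
  by apply: mxle_le rY; rewrite le_max lexx.
pose eta := Num.min v (e / r); have eta0 : 0 < eta by rewrite lt_min v0 divr_gt0.
have etav : eta <= v by rewrite ge_min lexx.
have eta_r : eta * r <= e by rewrite -ler_pdivlMr// ge_min lexx orbT.
have eta1 : eta <= 1 by rewrite (le_trans etav)// ltW.
have [E] := exists_residue_system F_nondiscrete F_locally_compact eta0 eta1.
exists (trial_content Q k l r e0 E) => B sB; split=> [G G' H H'|].
  exact: trial_content_inv.
have -> : d = d / 2%:R + d / 2%:R by lra.
by apply: trial_content_tau ld' rQ' => //; exact: ltW.
Qed.

End SkewLaw.

Section Ultralimits.
Context {R : realType} (I : Type) (U : set_system I) {FU : UltraFilter U}.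

Lemma ultra_cvg (f : I -> R) (M : R) : (forall i, `|f i| <= M) -> exists l : R, f @ U --> l.
Proof.
move=> fM; have cI : compact `[- M, M] by exact: segment_compact.
have fI : U (f @^-1` [set` `[- M, M]]).
  by apply: filterE => i; rewrite /= in_itv/=; move: (fM i); rewrite ler_norml.
have [l [_ cl]] := cI (f @ U) _ fI; exists l => A Al.
have [//|nA] := in_ultra_setVsetC (f @^-1` A) FU.
by have [x [/= ]] := cl _ _ (nA : (f @ U) (~` A)) Al.
Qed.

Context {F : nonArchFieldType R}.

Lemma ultra_content (m : I -> cyl_content F) : exists m' : cyl_content F,
  forall A, cyl A -> (fun i => tc (m i) A) @ U --> tc m' A.
Proof.
have tc_le1 i A : cyl A -> `|tc (m i) A| <= 1.
  by move=> cA; rewrite ger0_norm ?tc_ge0// -(tcT (m i)) le_tc//; exact: cyl_cst.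
have /choice[l lP] : forall A, exists l : R, 0 <= l /\ (cyl A -> (fun i => tc (m i) A) @ U --> l).
  move=> A; have [cA|nA] := pselect (cyl A); last by exists 0.
  have [l lA] := ultra_cvg (fun i => tc_le1 i A cA); exists l; split=> //.
  rewrite -(cvg_lim (@Rhausdorff R) lA); apply: limr_ge; first by apply/cvg_ex; exists l.
  by apply: filterE => i; exact: tc_ge0.
have FP : ProperFilter U by exact: ultra_proper.
have l_eq A x : cyl A -> (fun i => tc (m i) A) @ U --> x -> l A = x.
  move=> cA; exact: (cvg_unique _ ((lP A).2 cA)).
have lT : l setT = 1.
  apply: l_eq; first exact: cyl_cst.
  by under eq_fun do rewrite tcT; exact: cvg_cst.
have lU A B : cyl A -> cyl B -> A `&` B = set0 -> l (A `|` B) = l A + l B.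
  move=> cA cB AB; apply: l_eq; first exact: cyl_setU.
  under eq_fun do rewrite tcU//.
  by apply: cvgD; [exact: (lP A).2|exact: (lP B).2].
exists (Build_cyl_content (fun A => (lP A).1) lT lU) => A cA.
exact: (lP A).2.
Qed.

End Ultralimits.

Section Surjectivity.
Context {R : realType} {F : nonArchFieldType R}
  (F_nondiscrete : ~ (forall A : set F, open A))
  (F_locally_compact : locally_compact [set: F]) (two_neq0 : (2%:R : F) != 0).

Lemma eventually_id_extmx (g : infmx F) : eventually_id g ->
  exists N, forall n, (N <= n)%N -> g = extmx (corner n g).
Proof.
case=> N gN; exists N => n Nn; apply/funext => -[i j].
have [ni|ni] := leqP n i.
  by rewrite extmx_outl// gN// (leq_trans Nn)// (leq_trans ni)// leq_addr.
have [nj|nj] := leqP n j.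
  by rewrite extmx_outr// gN// (leq_trans Nn)// (leq_trans nj)// leq_addl.
by rewrite (@extmx_in _ _ n _ (Ordinal ni) (Ordinal nj)) mxE.
Qed.

Lemma corner_mul n (G H : 'M[F]_n) : corner n (infmx_mul (extmx G) (extmx H)) = G *m H.
Proof.
apply/matrixP => i j; rewrite !mxE /infmx_mul/= (@fsum_ord _ _ _ n) => [|k nk].
  by apply: eq_bigr => k _; rewrite !extmx_in.
by rewrite extmx_row0// mul0r.
Qed.

Lemma corner_infmx1 n : corner n (infmx1 : infmx F) = 1%:M.
Proof. by apply/matrixP => i j; rewrite !mxE. Qed.

Lemma mat_act_corner_large (g : GLinfty F * GLinfty F) : exists N, forall n, (N <= n)%N ->
  exists G G' H H', [/\ GLO G G', GLO H H' &
    forall X, corner n (mat_act F g X) = G *m corner n X *m H].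
Proof.
have [N1 h1] := eventually_id_extmx (gl_mx_id g.1).
have [N2 h2] := eventually_id_extmx (gl_inv_id g.1).
have [N3 h3] := eventually_id_extmx (gl_mx_id g.2).
have [N4 h4] := eventually_id_extmx (gl_inv_id g.2).
exists (maxn (maxn N1 N2) (maxn N3 N4)) => n; rewrite !geq_max => /andP[/andP[n1 n2] /andP[n3 n4]].
exists (corner n (gl_mx g.1)), (corner n (gl_inv g.1)), (corner n (gl_inv g.2)), (corner n (gl_mx g.2)).
have int (Y : infmx F) : (forall ij, ring_of_integers (Y ij)) -> mxle 1 (corner n Y).
  by move=> Y1 i j; rewrite mxE; exact: Y1.
split.
- split; [exact/int/gl_mx_int|exact/int/gl_inv_int| |].
    by rewrite -corner_mul -h1// -h2// gl_mulV corner_infmx1.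
  by rewrite -corner_mul -h1// -h2// gl_mulVr corner_infmx1.
- split; [exact/int/gl_inv_int|exact/int/gl_mx_int| |].
    by rewrite -corner_mul -h3// -h4// gl_mulVr corner_infmx1.
  by rewrite -corner_mul -h3// -h4// gl_mulV corner_infmx1.
by move=> X; rewrite -corner_mul2 -h1// -h4.
Qed.

Context (nu : Pinv R (skew_act F)).

Let nuP := repr_prob (set_val nu).

Definition skew_distribution : probability (borel (infmx F)) R :=
  distribution nuP (borel_fun skew_val_continuous).

Lemma skew_distributionE (A : set (infmx F)) :
  Pr skew_distribution A = Pr nuP (skew_val @^-1` A).
Proof. by []. Qed.

Lemma skew_law_distribution : skew_law skew_distribution.
Proof.
split=> [n h G G' th GG|n e d e0 d0].
  have [g gE] := skew_act_corner GG.
  have bh : bmeas (h \o corner n : borel (infmx F) -> R) := test_bmeas th.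
  have bG : bmeas (fun X : borel (infmx F) => h (G *m corner n X *m G^T)).
    have [k kE] := mat_act_corner GG (GLO_tr GG).
    apply: (@cyl_bmeas _ _ _ 1) => [|X]; last exact: th.2.
    rewrite (_ : (fun _ => _) = (h \o corner n) \o mat_act F k).
      exact: (cyl_mat_act k th.1).
    by apply/funext => X /=; rewrite kE.
  rewrite /skew_distribution !Ex_distribution//.
  pose f (A : borel (skew_infmx F)) := h (corner n (skew_val A)).
  have bf : bmeas f.
    have [mh [M hM]] := bh; split; last by exists M => A; exact: hM.
    exact: (measurableT_comp mh (continuous_borel skew_val_continuous)).
  transitivity (Ex nuP (f \o skew_act F g)).
    by apply: eq_Ex => A; rewrite /f /= -/(skew_act F g A) gE.
  rewrite -(@Ex_distribution _ _ _ _ _ nuP (borel_fun (act_continuous (skew_act F) g)) f)//.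
  apply: Ex_eq_prob => A mA; have /invariantP := set_valP nu; exact.
have [r r0 rP] := Pr_corner_tail_small skew_distribution n d0.
exists r => //; apply: le_trans rP; rewrite !skew_distributionE; apply: le_Pr.
- by apply: (preimage_cyl_measurable skew_val_continuous); apply: cyl_setC; exact: cyl_near_skew.
- by apply: (preimage_cyl_measurable skew_val_continuous); exact: cyl_corner_tail.
move=> A /= nA; apply: contrapT => nr; apply: nA.
exists (corner n (skew_val A)); split.
- by rewrite subrr; exact/mxle0/ltW.
- by apply/matrixP => i j; rewrite !mxE; exact: (set_mem (valP A)).
- by move=> i j; rewrite mxE leNgt; apply/negP => rA; apply: nr; exists (i, j).
Qed.

Lemma corner_preimage n (A : set (infmx F)) n0 e0 : (n0 <= n)%N ->
  (forall X Y, mxnear n0 e0 X Y -> A X = A Y) ->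
  0 <= e0 -> corner n @^-1` [set M | A (extmx M)] = A.
Proof.
move=> nn Ae e00; apply/seteqP; split=> X /=; rewrite -(Ae X)// => i j ni nj.
all: have ni' := leq_trans ni nn; have nj' := leq_trans nj nn.
all: rewrite (@extmx_in _ _ n _ (Ordinal ni') (Ordinal nj')) mxE subrr absv0//.
Qed.

Lemma tau_star_surj_content : exists2 m : cyl_content F,
  (forall g A, cyl A -> tc m (mat_act F g @^-1` A) = tc m A) &
  forall A, cyl A -> tc m (@infmx_tau R F @^-1` A) = Pr nuP (skew_val @^-1` A).
Proof.
have /choice[m mP] : forall n, exists m : cyl_content F,
    forall B : set 'M[F]_n, saturated (inv_succ n) B ->
    (forall G G' H H', GLO G G' -> GLO H H' ->
      tc m [set X | B (G *m corner n X *m H)] = tc m (corner n @^-1` B)) /\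
    `|tc m [set X | B (corner n X - (corner n X)^T)] -
      Pr skew_distribution (corner n @^-1` B)| <= inv_succ n.
  move=> n; apply: (finite_content F_nondiscrete F_locally_compact two_neq0 _ skew_law_distribution).
    exact: inv_succ_gt0.
  exact: inv_succ_gt0.
have [U [FU sU]] := ultraFilterLemma (eventually_filter : ProperFilter \oo).
have FP : ProperFilter U by exact: ultra_proper.
have [m' m'P] := ultra_content (U := U) m.
have cyl_level A : cyl A -> \forall n \near \oo, corner n @^-1` [set M | A (extmx M)] = A /\
    saturated (inv_succ n) [set M : 'M[F]_n | A (extmx M)].
  move=> [n0 [e0 [e00 Ae]]]; have [n1 n1e] := inv_succ_small e00.
  exists (maxn n0 n1) => // n; rewrite /= geq_max => /andP[nn n1n].
  split; first exact: corner_preimage Ae (ltW e00).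
  move=> M N MN; apply: Ae; apply: mxnear_le nn (le_trans (inv_succ_le n1n) n1e) _.
  by apply/mxnear_corner => i j; have := MN i j; rewrite !mxE !extmx_in.
have eq_lim (f g : nat -> R) (x y : R) : (\forall n \near \oo, f n = g n) ->
    f n @[n --> U] --> x -> g n @[n --> U] --> y -> x = y.
  move=> fg fx gy; apply: (cvg_unique (@Rhausdorff R) fx); apply: cvg_trans gy.
  by apply: near_eq_cvg; apply: sU; apply: filterS fg => n ->.
exists m' => [g A cA|A cA].
  apply: eq_lim (m'P _ (cyl_mat_act g cA)) (m'P _ cA).
  have [N gN] := mat_act_corner_large g.
  near=> n; have [AE sA] : corner n @^-1` [set M | A (extmx M)] = A /\
    saturated (inv_succ n) [set M : 'M[F]_n | A (extmx M)] by near: n; exact: cyl_level.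
  have nN : (N <= n)%N by near: n; exact: nbhs_infty_ge.
  have [G [G' [H [H' [GG HH gE]]]]] := gN _ nN.
  have := (mP n _ sA).1 _ _ _ _ GG HH; rewrite -{3 4}AE => <-; congr tc.
  by apply/seteqP; split=> X /=; rewrite gE.
have lim0 : `|tc (m n) (@infmx_tau R F @^-1` A) - Pr nuP (skew_val @^-1` A)| @[n --> U] --> (0 : R).
  apply/cvgrPdist_le => e e0; apply: sU.
  have [n1 n1e] := inv_succ_small e0.
  near=> n; have [AE sA] : corner n @^-1` [set M | A (extmx M)] = A /\
    saturated (inv_succ n) [set M : 'M[F]_n | A (extmx M)] by near: n; exact: cyl_level.
  have n1n : (n1 <= n)%N by near: n; exact: nbhs_infty_ge.
  rewrite sub0r normrN normr_id; apply: le_trans (le_trans (inv_succ_le n1n) n1e).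
  have := (mP n _ sA).2; rewrite AE; congr (`|tc _ _ - _| <= _).
  by rewrite -{2}AE; apply/seteqP; split=> X /=; rewrite corner_tau.
apply/eqP; rewrite -subr_eq0 -normr_eq0; apply/eqP.
have lim1 : `|tc (m n) (@infmx_tau R F @^-1` A) - Pr nuP (skew_val @^-1` A)| @[n --> U] -->
    `|tc m' (@infmx_tau R F @^-1` A) - Pr nuP (skew_val @^-1` A)|.
  by apply: cvg_norm; apply: cvgB; [exact: m'P (cyl_tau cA)|exact: cvg_cst].
exact: (cvg_unique (@Rhausdorff R) lim1 lim0).
Unshelve. all: by end_near. Qed.

End Surjectivity.

Lemma cvg_to_initial (S : choiceType) (T : topologicalType) (f : S -> T) (I : Type)
    (G : set_system I) (FG : Filter G) (h : I -> S) (s : S) :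
  f (h i) @[i --> G] --> f s -> h i @[i --> G] --> (s : initial_topology f).
Proof.
move=> fh A [_ [[B oB <-] Bs] BA].
have fB : \forall i \near G, B (f (h i)) by apply: fh; exact: open_nbhs_nbhs.
by apply: filterS fB => i; exact: BA.
Qed.

Lemma continuous_ultraP (S T : topologicalType) (g : S -> T) :
  (forall (U : set_system S) s, UltraFilter U -> U --> s -> g @ U --> g s) -> continuous g.
Proof.
move=> gU s A As; apply: contrapT => nA.
pose G := within (~` (g @^-1` A)) (nbhs s).
have FG : ProperFilter G.
  apply: Build_ProperFilter => h; apply: nA; have {}h : nbhs s [set x | ~ ~ A (g x)] := h.
  by apply: filterS h => x; exact: contrapT.
have [U [FU GU]] := ultraFilterLemma FG.
have Us : U --> s.
  move=> B Bs; apply: GU; rewrite /G /within /=.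
  by apply: (@filterS _ (nbhs s) _ B _ _ Bs) => x Bx _.
have UA : U (g @^-1` A) := gU U s FU Us A As.
have UnA : U (~` (g @^-1` A)) by apply: GU; exact: withinT.
by have [x []] := filter_ex (filterI UA UnA).
Qed.

(** * Weak convergence of invariant measures *)

Section WeakConvergence.
Context {R : realType} (G : Type) (T : ptopologicalType) (a : cont_action G T).

Lemma Pinv_cvgP (I : Type) (U : set_system I) (FU : Filter U) (h : I -> Pinv R a) (nu : Pinv R a) :
  h @ U --> nu <-> forall f : T -> R, continuous f -> bounded_fun f ->
    Ex (repr_prob (set_val (h i))) f @[i --> U] --> Ex (repr_prob (set_val nu)) f.
Proof.
have ci : continuous (@integration R T : borel_prob R T -> _) by exact: initial_continuous.
have cs : continuous (set_val : Pinv R a -> borel_prob R T) by exact: initial_continuous.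
split=> [hnu f cf bf|hnu].
  pose f' : set_type (@Cb R T) := exist _ f (mem_set (conj cf bf)).
  have : integration (set_val (h i)) @[i --> U] --> integration (set_val nu).
    exact: (cvg_comp _ _ (cvg_comp _ _ hnu (cs nu)) (ci (set_val nu))).
  move=> hI; have ev := @proj_continuous _ (fun _ : set_type (@Cb R T) => R) f'.
  exact: (cvg_comp _ _ hI (ev (integration (set_val nu)))).
apply: (@cvg_to_initial _ _ set_val); apply: (@cvg_to_initial _ _ (@integration R T)).
apply/cvg_sup => f; apply: cvg_to_initial; have [cf bf] := set_valP f; exact: hnu.
Qed.

End WeakConvergence.

Section Homeomorphism.
Context {R : realType} {F : nonArchFieldType R}
  (F_nondiscrete : ~ (forall A : set F, open A))
  (F_locally_compact : locally_compact [set: F]).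

Lemma tau_star_affine : is_affine (@tau_star R F).
Proof.
move=> t mu mu'; apply: val_inj; apply: borel_prob_ext => A mA /=.
have mT : measurable (tau @^-1` A : set (borel (infmx F))).
  by rewrite -[X in measurable X]setTI; apply: continuous_borel => //; exact: tau_continuous.
by rewrite borel_convE// !borel_pushE// borel_convE.
Qed.

Lemma tau_star_Ex (mu : Pinv R (mat_act F)) (f : skew_infmx F -> R) M : continuous f ->
  (forall A, `|f A| <= M) ->
  Ex (repr_prob (set_val (tau_star mu))) f = Ex (repr_prob (set_val mu)) (f \o tau).
Proof.
move=> cf fM; have bf : bmeas (f : borel (skew_infmx F) -> R) by exact: continuous_bmeas fM.
transitivity (Ex (distribution (repr_prob (set_val mu)) (borel_fun tau_continuous)) f).
  by apply: Ex_eq_prob => A mA; exact: borel_pushE.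
exact: Ex_distribution.
Qed.

Lemma bounded_funP (T : Type) (f : T -> R) : bounded_fun f <-> exists M, forall x, `|f x| <= M.
Proof.
split=> [[M [_ fM]]|[M fM]]; first by exists (M + 1) => x; apply: (fM (M + 1)); rewrite ?ltrDl.
exists M; split; first by rewrite num_real.
by move=> N MN x _ /=; rewrite (le_trans (fM x))// ltW.
Qed.

Lemma tau_star_continuous : continuous (@tau_star R F).
Proof.
move=> mu; apply: (Pinv_cvgP (nbhs_filter mu) _ _).2 => f cf bf; have [M fM] := (bounded_funP f).1 bf.
under eq_fun do rewrite (tau_star_Ex _ cf fM); rewrite (tau_star_Ex _ cf fM).
have ct : continuous (f \o @tau R F).
  by move=> X; apply: continuous_comp; [exact: tau_continuous|exact: cf].
have bt : bounded_fun (f \o @tau R F) by apply/bounded_funP; exists M => X; exact: fM.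
exact: (Pinv_cvgP (nbhs_filter mu) id mu).1 (@cvg_id _ (nbhs mu)) _ ct bt.
Qed.

Lemma Pr_tau (mu : Pinv R (mat_act F)) (A : set (infmx F)) : cyl A ->
  Pr (repr_prob (set_val mu)) (@infmx_tau R F @^-1` A) =
  Pr (repr_prob (set_val (tau_star mu))) (skew_val @^-1` A).
Proof.
move=> cA; rewrite /Pr borel_pushE//.
exact: (preimage_cyl_measurable skew_val_continuous cA).
Qed.

Lemma Pr_skew_cvg (U : set_system (Pinv R (skew_act F))) nu (A : set (infmx F)) :
  Filter U -> U --> nu -> cyl A ->
  Pr (repr_prob (set_val i)) (skew_val @^-1` A) @[i --> U] -->
  Pr (repr_prob (set_val nu)) (skew_val @^-1` A).
Proof.
move=> FU Unu cA.
have mA : measurable (skew_val @^-1` A : set (borel (skew_infmx F))).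
  exact: (preimage_cyl_measurable skew_val_continuous cA).
under eq_fun do rewrite -Ex_indic//; rewrite -Ex_indic//.
apply: (Pinv_cvgP FU id nu).1 => //; last first.
  by apply/bounded_funP; exists 1 => x; exact: normr_indic_le1.
have cI : continuous (\1_A : infmx F -> R).
  by apply: cyl_continuous; exact: (cyl_comp (fun P : Prop => `[< P >]%:R : R) cA).
have cf : continuous ((\1_A : infmx F -> R) \o skew_val).
  by move=> x; apply: continuous_comp; [exact: skew_val_continuous|exact: cI].
exact: cf.
Qed.

Definition probability_content (P : probability (borel (infmx F)) R) : cyl_content F :=
  @Build_cyl_content R F (fun A => Pr P A) (fun A => Pr_ge0 P A) (PrT P)
    (fun A B cA cB => PrU P (cyl_measurable cA) (cyl_measurable cB)).

Lemma tau_star_inverse_continuous (g : Pinv R (skew_act F) -> Pinv R (mat_act F)) :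
  cancel g (@tau_star R F) -> continuous g.
Proof.
move=> gK; apply: continuous_ultraP => U nu FU Unu.
have FP : ProperFilter U by exact: ultra_proper.
have [m mP] := ultra_content (U := U) (fun i => probability_content (repr_prob (set_val (g i)))).
have m_inv k A : cyl A -> tc m (mat_act F k @^-1` A) = tc m A.
  move=> cA; have := mP _ (cyl_mat_act k cA).
  under eq_fun do rewrite /= /Pr (Pinv_bi_invariant _ _ cA).
  by move=> h; apply: (cvg_unique (@Rhausdorff R) h); exact: mP.
have m_tau A : cyl A -> tc m (@infmx_tau R F @^-1` A) =
    Pr (repr_prob (set_val nu)) (skew_val @^-1` A).
  move=> cA; have := mP _ (cyl_tau cA).
  under eq_fun do rewrite [tc _ _](Pr_tau _ cA) gK.
  by move=> h; apply: (cvg_unique (@Rhausdorff R) h); exact: Pr_skew_cvg.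
have [mu muE mu_m] := extension_Pinv F_nondiscrete F_locally_compact m_inv m_tau.
have -> : g nu = mu by apply: (tau_star_inj F_nondiscrete F_locally_compact); rewrite gK.
apply: (Pinv_cvgP _ _ _).2 => f cf bf; have [M fM] := (bounded_funP f).1 bf.
by apply: (portmanteau _ cf fM) => A cA; rewrite mu_m//; exact: mP.
Qed.

End Homeomorphism.

Theorem theorem1p4 (R : realType) (F : nonArchFieldType R)
    (F_nondiscrete : ~ (forall A : set F, open A))
    (F_locally_compact : locally_compact [set: F])
    (F_char : 2%N \notin [pchar F]) :
  is_affine (@tau_star R F) /\ is_homeomorphism (@tau_star R F).
Proof.
split; first exact: tau_star_affine.
have two_neq0 : (2%:R : F) != 0 by move: F_char; rewrite inE.
have /choice[g gK] nu : exists mu, @tau_star R F mu = nu.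
  have [m m_inv m_tau] := tau_star_surj_content F_nondiscrete F_locally_compact two_neq0 nu.
  have [mu muE _] := extension_Pinv F_nondiscrete F_locally_compact m_inv m_tau.
  by exists mu.
exists g; split=> //; last exact: tau_star_inverse_continuous.
- by move=> mu; apply: (tau_star_inj F_nondiscrete F_locally_compact); rewrite gK.
- exact: tau_star_continuous.
Qed.
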